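(* Let $\mathcal{K}\subseteq\mathbb{R}^d$ be convex and compact with $0\in\mathcal{K}$, and let $R=\max_{x\in\mathcal{K}}\|x\|$. Assume: (i) $|\tilde F(x;z)|\le B$ for all $x\in\mathcal{K}$, $z\in\mathcal{Z}$; (ii) $\|\nabla\tilde F(x;z)\|\le G_{\tilde F}$ for all $x\in\mathcal{K}$, $z\in\mathcal{Z}$, and $\mathbb{E}_{z\sim p(z;x)}\|\nabla\log p(z;x)\|^4\le G_p^4$ for all $x\in\mathcal{K}$; put $G=\max\{G_{\tilde F},G_p\}$; (iii) $\|\nabla^2\tilde F(x;z)\|\le L_{\tilde F}$ for all $x\in\mathcal{K}$, $z\in\mathcal{Z}$, and $\mathbb{E}_{z\sim p(z;x)}\|\nabla^2\log p(z;x)\|^2\le L_p^2$ for all $x\in\mathcal{K}$ (spectral norms); put $L=\max\{L_{\tilde F},L_p\}$. Let $\bar L=\left(4B^2G^4+16G^4+4L^2+4B^2L^2\right)^{1/2}$. Assume moreover that $F$ is nonnegative, monotone and continuous DR-submodular on a domain $\mathcal{X}=\prod_{i=1}^d\mathcal{X}_i\supseteq\mathcal{K}$, where each $\mathcal{X}_i$ is a compact subset of $\mathbb{R}_{\ge0}$, and let $x^*$ be a maximizer of $F$ on $\mathcal{K}$. Run the one-sample stochastic Frank-Wolfe method (1-SFW) with the exact Hessian option and the DR-submodular maximization update, started at $x_1=0$, for $T\ge1$ iterations, with $\rho_t=(t-1)^{-1}$ (for $t\ge2$) and $\eta_t=T^{-1}$. Then $x_{T+1}\in\mathcal{K}$ and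 $$\mathbb{E}[F(x_{T+1})]\ge(1-e^{-1})F(x^* )-\frac{4R\sqrt C}{T^{1/2}}-\frac{\bar LR^2}{2T},$$ where $C=\max\{4(2G+R\bar L)^2,\,256,\,[2R(\bar L+L)]^4\}$.
   Context: Problem (non-oblivious stochastic optimization): $F:\mathbb{R}^d\to\mathbb{R}$, $F(x)=\mathbb{E}_{z\sim p(z;x)}[\tilde F(x;z)]$, where $\tilde F:\mathbb{R}^d\times\mathcal{Z}\to\mathbb{R}$ and, for each $x$, $p(\cdot;x)$ is a probability density on $\mathcal{Z}$ which may depend on $x$. Gradients $\nabla$ and Hessians $\nabla^2$ are with respect to $x$; $\|\cdot\|$ is the Euclidean norm for vectors and the spectral norm for matrices. DR-submodularity: vector inequalities are coordinatewise. A differentiable $F:\mathcal{X}\to\mathbb{R}_{\ge0}$ is continuous DR-submodular if for all $x,y\in\mathcal{X}$ with $x\le y$ and every $i$, $\frac{\partial F}{\partial x_i}(x)\ge\frac{\partial F}{\partial x_i}(y)$; it is monotone if $F(x)\le F(y)$ whenever $x,y\in\mathcal{X}$, $x\le y$. Hessian estimator: $$\tilde\nabla^2F(x;z)=\tilde F(x;z)[\nabla\log p(z;x)][\nabla\log p(z;x)]^\top+\nabla^2\tilde F(x;z)+[\nabla\tilde F(x;z)][\nabla\log p(z;x)]^\top+\tilde F(x;z)\nabla^2\log p(z;x)+[\nabla\log p(z;x)][\nabla\tilde F(x;z)]^\top.$$ Standing assumptions: $F$, $\tilde F(\cdot;z)$ and $\log p(z;\cdot)$ are twice continuously differentiable,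 all functions are measurable in $z$, and for all $x\in\mathcal{K}$ the estimators are unbiased: $\mathbb{E}_{z\sim p(z;x)}[\nabla\tilde F(x;z)]=\nabla F(x)$ and $\mathbb{E}_{z\sim p(z;x)}[\tilde\nabla^2F(x;z)]=\nabla^2F(x)$. Algorithm 1-SFW (exact Hessian option, DR-submodular maximization update). Input: $\rho_t,\eta_t\in(0,1]$, initial point $x_1$, number of iterations $T$. For $t=1,\dots,T$: - If $t=1$: sample $z_1\sim p(\cdot;x_1)$ and set $d_1=\nabla\tilde F(x_1;z_1)$. - If $t\ge2$: draw $a$ uniformly from $[0,1]$ independently of the past; set $x_t(a)=ax_t+(1-a)x_{t-1}$; sample (conditionally on the past and $a$) $z_t\sim p(\cdot;x_t(a))$; set $\tilde\Delta_t=\tilde\nabla^2F(x_t(a);z_t)\,(x_t-x_{t-1})$ and $d_t=(1-\rho_t)(d_{t-1}+\tilde\Delta_t)+\rho_t\nabla\tilde F(x_t;z_t)$. - Update: $v_t\in\arg\max_{v\in\mathcal{K}}v^\top d_t$ (measurably selected), $x_{t+1}=x_t+\eta_tv_t$. The expectation is over all randomness of the algorithm. *)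

(* Defs.v *)
From HB Require Import structures.
From mathcomp Require Import all_boot all_order all_algebra.
From mathcomp Require Import all_classical all_reals all_analysis.

Set Implicit Arguments.
Unset Strict Implicit.
Unset Printing Implicit Defensive.

Import Order.TTheory GRing.Theory Num.Theory.
Import numFieldNormedType.Exports.

Local Open Scope classical_set_scope.
Local Open Scope ring_scope.

(* The norm that MathComp-Analysis puts on matrices is the sup norm; the
   Euclidean and spectral norms are therefore defined here.  (The topology, and
   so continuity, differentiability and compactness, is the same.) *)

Definition dotv (R : realType) (n : nat) (u v : 'cV[R]_n) : R :=
  \sum_(i < n) u i ord0 * v i ord0.

Definition enorm (R : realType) (n : nat) (u : 'cV[R]_n) : R :=
  Num.sqrt (dotv u u).

Definition specnorm (R : realType) (n : nat) (M : 'M[R]_n) : R :=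
  sup [set enorm (M *m u) | u in [set u : 'cV[R]_n | enorm u <= 1]].

Definition lev (R : realType) (n : nat) (x y : 'cV[R]_n) : Prop :=
  forall i, x i ord0 <= y i ord0.

Definition box (R : realType) (n : nat) (Xs : 'I_n -> set R) : set 'cV[R]_n :=
  [set x | forall i, Xs i (x i ord0)].

Definition partial (R : realType) (n : nat) (i : 'I_n) (f : 'cV[R]_n -> R) :
  'cV[R]_n -> R := fun x => 'D_(delta_mx i ord0) f x.

Definition grad (R : realType) (n : nat) (f : 'cV[R]_n -> R) (x : 'cV[R]_n) :
  'cV[R]_n := \col_i partial i f x.

Definition hess (R : realType) (n : nat) (f : 'cV[R]_n -> R) (x : 'cV[R]_n) :
  'M[R]_n := \matrix_(i, j) partial i (partial j f) x.

Definition twice_cont_diff (R : realType) (n : nat) (f : 'cV[R]_n -> R) : Prop :=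
  [/\ forall x, differentiable f x,
      forall i x, differentiable (partial i f) x &
      forall i j, continuous (partial i (partial j f))].

Definition monotone_on (R : realType) (n : nat) (X : set 'cV[R]_n)
    (F : 'cV[R]_n -> R) : Prop :=
  forall x y, X x -> X y -> lev x y -> F x <= F y.

Definition dr_submodular_on (R : realType) (n : nat) (X : set 'cV[R]_n)
    (F : 'cV[R]_n -> R) : Prop :=
  forall x y, X x -> X y -> lev x y -> forall i, partial i F y <= partial i F x.

Definition argmax_lin (R : realType) (n : nat) (K : set 'cV[R]_n)
    (g : 'cV[R]_n) : set 'cV[R]_n :=
  [set v | K v /\ forall u, K u -> dotv u g <= dotv v g].

(* [p x z] stands for p(z; x) and [Ft x z] for the stochastic function
   \tilde F(x; z); densities are taken with respect to a reference measure [mu]. *)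

Definition is_density (R : realType) (dZ : measure_display)
    (Z : measurableType dZ) (mu : {measure set Z -> \bar R}) (q : Z -> R) : Prop :=
  [/\ measurable_fun setT q, forall z, 0 <= q z & (\int[mu]_z (q z)%:E = 1)%E].

(* E_{z ~ p(.; x)}[f z].  For measurable integrands, an equation between this
   integral and a real number forces integrability. *)
Definition Ez (R : realType) (n : nat) (dZ : measure_display)
    (Z : measurableType dZ) (mu : {measure set Z -> \bar R})
    (p : 'cV[R]_n -> Z -> R) (x : 'cV[R]_n) (f : Z -> R) : \bar R :=
  (\int[mu]_z (f z * p x z)%:E)%E.

Definition logp (R : realType) (n : nat) (Z : Type) (p : 'cV[R]_n -> Z -> R)
    (x : 'cV[R]_n) (z : Z) : R := ln (p x z).

(* The estimator \tilde\nabla^2 F(x; z). *)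
Definition hess_est (R : realType) (n : nat) (Z : Type)
    (p Ft : 'cV[R]_n -> Z -> R) (x : 'cV[R]_n) (z : Z) : 'M[R]_n :=
  let s := grad (logp p ^~ z) x in
  let g := grad (Ft ^~ z) x in
  Ft x z *: (s *m s^T) + hess (Ft ^~ z) x + g *m s^T
    + Ft x z *: hess (logp p ^~ z) x + s *m g^T.

Definition measurable_z (R : realType) (n : nat) (dZ : measure_display)
    (Z : measurableType dZ) (f : 'cV[R]_n -> Z -> R) : Prop :=
  forall x,
    [/\ measurable_fun setT (f x),
        forall i, measurable_fun setT (fun z => grad (f ^~ z) x i ord0) &
        forall i j, measurable_fun setT (fun z => hess (f ^~ z) x i j)].

(* sigma(z_s, v_s : 1 <= s < t;  a_s : 2 <= s < t).  The iterates x_s (s <= t)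
   and the directions d_s (s < t) are functions of these variables. *)
Definition past (R : realType) (n : nat) (dO dZ : measure_display)
    (Omega : measurableType dO) (Z : measurableType dZ)
    (a : nat -> Omega -> R) (z : nat -> Omega -> Z)
    (v : nat -> Omega -> 'cV[R]_n) (t : nat) : set (set Omega) :=
  <<s (\bigcup_(s in [set s | (1 <= s < t)%N])
         (preimage_set_system setT (z s) measurable `|`
          \bigcup_i preimage_set_system setT (fun w => v s w i ord0) measurable))
      `|` (\bigcup_(s in [set s | (2 <= s < t)%N])
             preimage_set_system setT (a s) measurable) >>.

Definition past_and_a (R : realType) (n : nat) (dO dZ : measure_display)
    (Omega : measurableType dO) (Z : measurableType dZ)
    (a : nat -> Omega -> R) (z : nat -> Omega -> Z)
    (v : nat -> Omega -> 'cV[R]_n) (t : nat) : set (set Omega) :=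
  <<s past a z v t `|` preimage_set_system setT (a t) measurable >>.

(* One execution of T iterations of one-sample stochastic Frank-Wolfe (exact
   Hessian option, DR-submodular update), as processes on a probability space;
   only the indices 1 <= t <= T (2 <= t <= T for [a]) are constrained. *)
Record sfw_run (R : realType) (n : nat) (dO dZ : measure_display)
    (Omega : measurableType dO) (P : probability Omega R)
    (Z : measurableType dZ) (mu : {measure set Z -> \bar R})
    (p Ft : 'cV[R]_n -> Z -> R) (K : set 'cV[R]_n)
    (rho eta : nat -> R) (x1 : 'cV[R]_n) (T : nat)
    (a : nat -> {RV P >-> R}) (z : nat -> {RV P >-> Z})
    (x d v : nat -> Omega -> 'cV[R]_n) : Prop := SfwRun {
  run_x1 : forall w, x 1%N w = x1;
  run_z1 : forall A, measurable A ->
    distribution P (z 1%N) A = (\int[mu]_(y in A) (p x1 y)%:E)%E;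
  run_d1 : forall w, d 1%N w = grad (Ft ^~ (z 1%N w)) x1;
  run_a_unif : forall t, (2 <= t <= T)%N -> forall A, measurable A ->
    distribution P (a t) A = uniform_prob (@ltr01 R) A;
  run_a_indep : forall t, (2 <= t <= T)%N -> forall E A,
    past a z v t E -> measurable A ->
    P (E `&` a t @^-1` A) = (P E * P (a t @^-1` A))%E;
  (* conditional law of z_t given the past and a_t: density p(.; x_t(a_t)) *)
  run_z : forall t, (2 <= t <= T)%N -> forall E A,
    past_and_a a z v t E -> measurable A ->
    P (E `&` z t @^-1` A) =
    (\int[P]_(w in E) \int[mu]_(y in A)
       (p (a t w *: x t w + (1 - a t w) *: x t.-1 w) y)%:E)%E;
  run_d : forall t, (2 <= t <= T)%N -> forall w,
    let xa := a t w *: x t w + (1 - a t w) *: x t.-1 w in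
    let Delta := hess_est p Ft xa (z t w) *m (x t w - x t.-1 w) in
    d t w = (1 - rho t) *: (d t.-1 w + Delta)
            + rho t *: grad (Ft ^~ (z t w)) (x t w);
  run_v_meas : forall t, (1 <= t <= T)%N -> forall i,
    measurable_fun setT (fun w => v t w i ord0);
  run_v : forall t, (1 <= t <= T)%N -> forall w, argmax_lin K (d t w) (v t w);
  run_x : forall t, (1 <= t <= T)%N -> forall w,
    x t.+1 w = x t w + eta t *: v t w
}.

(* Main.v *)
Require Import Defs.
From HB Require Import structures.
From mathcomp Require Import all_boot all_order all_algebra.
From mathcomp Require Import all_classical all_reals all_analysis.
From mathcomp Require Import measurable_realfun ring lra.

Set Implicit Arguments.
Unset Strict Implicit.
Unset Printing Implicit Defensive.

Import Order.TTheory GRing.Theory Num.Theory.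
Import numFieldNormedType.Exports.

Local Open Scope classical_set_scope.
Local Open Scope ring_scope.

(** The run tracks [F] along [x_1 = 0, ..., x_(T+1)], where each step moves by
    [v_t / T] with [v_t] in [K]; the iterates are convex combinations of points of
    [K], so they stay in [K].

    The deterministic half is the Frank-Wolfe argument for monotone DR-submodular
    functions. Along a nonnegative direction the gradient of [F] decreases, so [F]
    is concave there, and comparing [x] with the join of [x] and [xstar] gives
    [F xstar - F x <= <grad F x, xstar>] ([dr_gap_le]). As [v_t] maximises
    [<v, d_t>] over [K] and the Hessian of [F] has norm at most [Lbar] on [K], the
    gap [F xstar - F (x_t)] contracts by the factor [1 - 1/T] at each step, up to
    [2 Rad |e_t| / T + Lbar Rad^2 / (2 T^2)] where [e_t = d_t - grad F (x_t)]
    ([one_step_progress]). Summing, with [(1 - 1/T)^T <= exp (- 1)], it remains to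
    show [E |e_t| <= sqrt (C / t)].

    The stochastic half is a recursion for [E |e_t|^2]. With [rho = 1/(t - 1)],
    [e_t = (1 - rho) (e_(t-1) + W_t) + rho V_t], where [W_t] is the error of the
    Hessian increment as an estimator of [grad F (x_t) - grad F (x_(t-1))] and
    [V_t] that of the fresh gradient. Given the past, [W_t] is centred: averaging
    over the sample [z_t] turns the estimator into the Hessian of [F] at the random
    point of the segment, and averaging over the uniform position of that point
    turns the Hessian into the increment of the gradient, by the fundamental theorem
    of calculus and the symmetry of second derivatives ([hess_step_expect]). Its
    second moment is at most [Lbar^2 Rad^2 / T^2] ([hess_est_second_moment]).
    The gradient is evaluated at [x_t] while the sample follows the law attached to
    the random point, so [V_t] is biased; it is the sum of a centred term and of a
    term of norm at most [(Lbar + L) Rad / T] ([grad_noise_orthogonal],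
    [grad_bias_le]). As [1/T <= rho], every error is of order [rho], which yields
    [E |e_t|^2 <= C / t] by induction ([err_recursion], [err_rate]).

    The conditional expectations are never formed as random variables. The law of
    the pair (past, new sample) is identified with a product measure weighted by a
    density, since both agree on rectangles, and Tonelli's theorem then integrates
    out the new sample ([ge0_disintegration], [disintegration]). The joint
    measurability that this needs holds because every function at hand is continuous
    in the point and measurable in the sample ([measurable_caratheodory]). *)

(** * Euclidean and spectral norms *)

Section EuclideanNorm.
Context {R : realType} {n : nat}.
Implicit Types (u v w : 'cV[R]_n) (c : R) (M : 'M[R]_n).

Lemma dotvC u v : dotv u v = dotv v u.
Proof. by apply: eq_bigr => i _; rewrite mulrC. Qed.

Lemma dotvDl u v w : dotv (u + v) w = dotv u w + dotv v w.
Proof. by rewrite -big_split; apply: eq_bigr => i _; rewrite /= mxE mulrDl. Qed.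

Lemma dotvDr u v w : dotv w (u + v) = dotv w u + dotv w v.
Proof. by rewrite dotvC dotvDl !(dotvC w). Qed.

Lemma dotvZl c u v : dotv (c *: u) v = c * dotv u v.
Proof. by rewrite mulr_sumr; apply: eq_bigr => i _; rewrite mxE mulrA. Qed.

Lemma dotvZr c u v : dotv u (c *: v) = c * dotv u v.
Proof. by rewrite dotvC dotvZl dotvC. Qed.

Lemma dotvNl u v : dotv (- u) v = - dotv u v.
Proof. by rewrite -scaleN1r dotvZl mulN1r. Qed.

Lemma dotvNr u v : dotv u (- v) = - dotv u v.
Proof. by rewrite dotvC dotvNl dotvC. Qed.

Lemma dotv0l u : dotv 0 u = 0.
Proof. by rewrite -(scale0r 0) dotvZl mul0r. Qed.

Lemma dotvv_ge0 u : 0 <= dotv u u.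
Proof. by apply: sumr_ge0 => i _; rewrite -expr2 sqr_ge0. Qed.

Lemma enorm_ge0 u : 0 <= enorm u.
Proof. exact: sqrtr_ge0. Qed.

Lemma enorm_sqr u : enorm u ^+ 2 = dotv u u.
Proof. by rewrite sqr_sqrtr ?dotvv_ge0. Qed.

Lemma enorm0 : enorm (0 : 'cV[R]_n) = 0.
Proof. by rewrite /enorm dotv0l sqrtr0. Qed.

Lemma enormZ c u : enorm (c *: u) = `|c| * enorm u.
Proof.
by rewrite /enorm dotvZl dotvZr mulrA -expr2 sqrtrM ?sqr_ge0// sqrtr_sqr.
Qed.

Lemma enormN u : enorm (- u) = enorm u.
Proof. by rewrite -scaleN1r enormZ normrN1 mul1r. Qed.

Lemma enormB u v : enorm (u - v) = enorm (v - u).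
Proof. by rewrite -enormN opprB. Qed.

Lemma dotvv_eq0 u : dotv u u = 0 -> u = 0.
Proof.
move=> /eqP; rewrite psumr_eq0 => [/allP h|i _]; last by rewrite -expr2 sqr_ge0.
apply/matrixP => i j; rewrite ord1 mxE.
have /= := h i (mem_index_enum _); rewrite mulf_eq0 orbb.
by move/eqP.
Qed.

Lemma enorm_eq0 u : enorm u = 0 -> u = 0.
Proof. by move=> u0; apply: dotvv_eq0; rewrite -enorm_sqr u0 expr0n. Qed.

(** The vector [dotv v v *: u - dotv u v *: v] is [dotv v v] times the component of
    [u] orthogonal to [v]; its squared norm is nonnegative. *)
Lemma cauchy_schwarz u v : dotv u v <= enorm u * enorm v.
Proof.
have [->|v0] := eqVneq v 0; first by rewrite dotvC dotv0l enorm0 mulr0.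
have b0 : 0 < dotv v v.
  by rewrite lt_neqAle dotvv_ge0 andbT; apply: contra_neq v0 => /esym/dotvv_eq0.
apply: le_trans (ler_norm _) _.
rewrite -(@ler_pXn2r _ 2)// ?nnegrE ?mulr_ge0 ?enorm_ge0//.
rewrite exprMn !enorm_sqr real_normK ?num_real// mulrC -(ler_pM2l b0).
have := dotvv_ge0 (dotv v v *: u - dotv u v *: v).
rewrite !(dotvDl, dotvDr, dotvNl, dotvNr, dotvZl, dotvZr) (dotvC v u).
by set a := dotv u u; set b := dotv v v; set c := dotv u v; nra.
Qed.

Lemma norm_dotv_le u v : `|dotv u v| <= enorm u * enorm v.
Proof.
by rewrite ler_norml cauchy_schwarz andbT lerNl -dotvNl -(enormN u) cauchy_schwarz.
Qed.

Lemma enormD u v : enorm (u + v) <= enorm u + enorm v.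
Proof.
rewrite -(@ler_pXn2r _ 2)// ?nnegrE ?addr_ge0 ?enorm_ge0//.
rewrite enorm_sqr !(dotvDl, dotvDr) (dotvC v u) sqrrD !enorm_sqr.
have := cauchy_schwarz u v; lra.
Qed.

(** Linear in the squared norms, hence stable under expectation, where Cauchy-Schwarz
    would leave a product of square roots. *)
Lemma dotv_young u v : 2 * dotv u v <= enorm u ^+ 2 + enorm v ^+ 2.
Proof.
have := dotvv_ge0 (u - v).
by rewrite !(dotvDl, dotvDr, dotvNl, dotvNr) (dotvC v u) !enorm_sqr; lra.
Qed.

Lemma enormD_sqr u v : enorm (u + v) ^+ 2 <= 2 * enorm u ^+ 2 + 2 * enorm v ^+ 2.
Proof.
have := dotv_young u v.
by rewrite !enorm_sqr !(dotvDl, dotvDr) (dotvC v u); lra.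
Qed.

Lemma enormD4_sqr u v w (t : 'cV[R]_n) : enorm (u + v + w + t) ^+ 2 <=
  4 * (enorm u ^+ 2 + enorm v ^+ 2 + enorm w ^+ 2 + enorm t ^+ 2).
Proof.
have h1 := enormD_sqr (u + v) (w + t).
have h2 := enormD_sqr u v; have h3 := enormD_sqr w t.
by rewrite -addrA; lra.
Qed.

Lemma norm_coord_le u i : `|u i ord0| <= enorm u.
Proof.
rewrite -(@ler_pXn2r _ 2)// ?nnegrE ?enorm_ge0// real_normK ?num_real//.
rewrite enorm_sqr /dotv (bigD1 i)//= -expr2 lerDl.
by apply: sumr_ge0 => j _; rewrite -expr2 sqr_ge0.
Qed.

Lemma dotv_mulmx u M v : dotv u (M *m v) = \sum_i \sum_j u i ord0 * (M i j * v j ord0).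
Proof. by apply: eq_bigr => i _; rewrite mxE mulr_sumr. Qed.

Lemma dotv_delta u i : dotv u (delta_mx i ord0) = u i ord0.
Proof.
rewrite /dotv (bigD1 i)//= big1 ?addr0; first by rewrite !mxE !eqxx mulr1.
by move=> l lk; rewrite !mxE (negbTE lk) mulr0.
Qed.

(** The bound is the Frobenius norm; its existence makes the supremum that defines
    [specnorm] a genuine least upper bound. *)
Lemma mulmx_enorm_bounded M : exists2 b, 0 <= b & forall u, enorm (M *m u) <= b * enorm u.
Proof.
exists (Num.sqrt (\sum_i enorm (row i M)^T ^+ 2)); first exact: sqrtr_ge0.
move=> u; have s0 : 0 <= \sum_i enorm (row i M)^T ^+ 2.
  by apply: sumr_ge0 => i _; exact: sqr_ge0.
rewrite -(@ler_pXn2r _ 2)// ?nnegrE ?mulr_ge0 ?enorm_ge0 ?sqrtr_ge0//.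
rewrite enorm_sqr exprMn sqr_sqrtr// mulr_suml; apply: ler_sum => i _.
have -> : (M *m u) i ord0 = dotv (row i M)^T u.
  by rewrite mxE; apply: eq_bigr => j _; rewrite !mxE.
rewrite -expr2 -exprMn -real_normK ?num_real//.
by rewrite ler_pXn2r ?nnegrE ?mulr_ge0 ?enorm_ge0 ?norm_dotv_le.
Qed.

Lemma specnorm_ge M u : enorm u <= 1 -> enorm (M *m u) <= specnorm M.
Proof.
move=> u1; apply: ub_le_sup; last by exists u.
have [b b0 hb] := mulmx_enorm_bounded M.
exists b => _ [v /= v1 <-]; apply: le_trans (hb v) _.
by rewrite ler_piMr.
Qed.

Lemma specnorm_ge0 M : 0 <= specnorm M.
Proof.
by apply: le_trans (specnorm_ge M (u := 0) _); rewrite ?enorm_ge0// enorm0.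
Qed.

Lemma enorm_mulmx_le M u : enorm (M *m u) <= specnorm M * enorm u.
Proof.
have [/enorm_eq0->|u0] := eqVneq (enorm u) 0.
  by rewrite mulmx0 enorm0 mulr0.
have {}u0 : 0 < enorm u by rewrite lt_neqAle eq_sym u0 enorm_ge0.
have uN : enorm ((enorm u)^-1 *: u) <= 1.
  by rewrite enormZ ger0_norm ?invr_ge0 ?enorm_ge0// mulVf ?gt_eqF.
have := specnorm_ge M uN.
rewrite -scalemxAr enormZ ger0_norm ?invr_ge0 ?enorm_ge0//.
by rewrite mulrC ler_pdivrMr.
Qed.

End EuclideanNorm.

(** One step of the error recursion before expectations are taken. The inner products
    of [e] with [W] and with [N] are kept, as they vanish on average; the one with the
    bias [D] is absorbed by Young's inequality, where [c * b] is a small number [c]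
    times the scale [b] to which [enorm e] is compared. *)
Lemma momentum_step_sqr {R : realType} {n : nat} (e W V N D : 'cV[R]_n) (rho c b g : R) :
  0 <= rho <= 1 -> 0 <= c -> V = N + D -> enorm V <= g -> enorm D <= c * b ->
  enorm ((1 - rho) *: (e + W) + rho *: V) ^+ 2 <=
  ((1 - rho) ^+ 2 + (1 - rho) * rho * c) * enorm e ^+ 2
  + 2 * (1 - rho) ^+ 2 * enorm W ^+ 2
  + 2 * (1 - rho) ^+ 2 * dotv e W + 2 * ((1 - rho) * rho) * dotv e N
  + (2 * rho ^+ 2 * g ^+ 2 + (1 - rho) * rho * c * b ^+ 2).
Proof.
move=> /andP[r0 r1] c0 VE Vg Db.
have s0 : 0 <= 1 - rho by rewrite subr_ge0.
have hY := enormD_sqr ((1 - rho) *: W) (rho *: V).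
rewrite !enormZ !ger0_norm// !exprMn in hY.
have hV : enorm V ^+ 2 <= g ^+ 2.
  by rewrite ler_pXn2r// nnegrE ?enorm_ge0// (le_trans (enorm_ge0 V)).
have hD : 2 * dotv e D <= c * (enorm e ^+ 2 + b ^+ 2).
  apply: (@le_trans _ _ (2 * (enorm e * (c * b)))).
    rewrite ler_wpM2l//; apply: le_trans (cauchy_schwarz _ _) _.
    by rewrite ler_wpM2l ?enorm_ge0.
  have := mulr_ge0 c0 (sqr_ge0 (enorm e - b)); move: (enorm e) => k; clear; lra.
have -> : enorm ((1 - rho) *: (e + W) + rho *: V) ^+ 2 =
    (1 - rho) ^+ 2 * enorm e ^+ 2 + 2 * (1 - rho) ^+ 2 * dotv e W
    + 2 * ((1 - rho) * rho) * dotv e N + (1 - rho) * rho * (2 * dotv e D)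
    + enorm ((1 - rho) *: W + rho *: V) ^+ 2.
  rewrite VE !enorm_sqr.
  rewrite !(dotvDl, dotvDr, dotvZl, dotvZr) (dotvC W e) (dotvC N e) (dotvC D e).
  rewrite (dotvC N W) (dotvC D W) (dotvC D N).
  ring.
have := ler_wpM2l (mulr_ge0 s0 r0) hD.
have := ler_wpM2l (sqr_ge0 rho) hV.
move: hY; move: (enorm ((1 - rho) *: W + rho *: V)) (enorm e) (enorm W) (enorm V)
  (dotv e W) (dotv e N) (dotv e D).
clear; move=> y k w k' p q r; lra.
Qed.

(** * Calculus along lines *)

Section LineCalculus.
Context {R : realType} {n : nat}.
Implicit Types (f : 'cV[R]_n -> R) (x u v : 'cV[R]_n) (s : R).

Lemma cV_sum_delta u : u = \sum_i u i ord0 *: delta_mx i ord0.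
Proof.
apply/matrixP => i j; rewrite ord1 summxE (bigD1 i)//= big1 ?addr0; last first.
  by move=> k ki; rewrite !mxE eq_sym (negbTE ki) mulr0.
by rewrite !mxE !eqxx mulr1.
Qed.

Lemma derive_dotv_grad f x u : differentiable f x -> 'D_u f x = dotv (grad f x) u.
Proof.
move=> df; rewrite deriveE// {1}(cV_sum_delta u) linear_sum.
by apply: eq_bigr => i _; rewrite linearZ /= mxE /partial deriveE// mulrC.
Qed.

(** Up to the shift of the base point, the difference quotients of the restriction to
    the line are those of the directional derivative. *)
Lemma is_derive_line f x u s : differentiable f (x + s *: u) ->
  is_derive s 1 (fun r => f (x + r *: u)) (dotv (grad f (x + s *: u)) u).
Proof.
move=> df; rewrite -derive_dotv_grad//.
have dfu : derivable f (x + s *: u) u by exact: diff_derivable.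
have E : (fun h : R => h^-1 *: (f (x + (h *: (1:R) + s) *: u) - f (x + s *: u)))
  = (fun h : R => h^-1 *: ((f \o shift (x + s *: u)) (h *: u) - f (x + s *: u))).
  apply/funext => h /=; congr (_ *: (f _ - _)).
  by rewrite [h *: 1]mulr1 scalerDl addrCA.
split; rewrite /derivable /derive /=.
  by move: dfu; rewrite /derivable -E.
by move: dfu; rewrite /derivable -E.
Qed.

(** With [hess f x i j] the i-th derivative of the j-th one, the direction [u] acts on
    rows and the functional [v] on columns, hence the order of the factors. *)
Lemma is_derive_line_grad f x u v s : (forall i y, differentiable (partial i f) y) ->
  is_derive s 1 (fun r => dotv v (grad f (x + r *: u)))
    (dotv u (hess f (x + s *: u) *m v)).
Proof.
move=> df.
have -> : (fun r => dotv v (grad f (x + r *: u))) =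
    \sum_i (fun r => v i ord0 * partial i f (x + r *: u)).
  apply/funext => r; rewrite fct_sumE; apply: eq_bigr => i _.
  by rewrite mxE.
rewrite (_ : dotv _ _ = \sum_i v i ord0 * dotv (grad (partial i f) (x + s *: u)) u).
  apply: is_derive_sum => i; apply: is_deriveZ.
  exact: is_derive_line.
rewrite dotv_mulmx exchange_big; apply: eq_bigr => i _.
rewrite mulr_sumr; apply: eq_bigr => j _; rewrite !mxE.
by rewrite mulrCA mulrA mulrC mulrCA.
Qed.

Lemma increment_le (g dg : R -> R) (c : R) :
  (forall s, is_derive s 1 g (dg s)) ->
  (forall s, 0 <= s <= 1 -> dg s <= c) -> g 1 - g 0 <= c.
Proof.
move=> gd gc.
have [s s01 ->] : exists2 s, s \in `[0, 1]%R & g 1 - g 0 = dg s * (1 - 0).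
  apply: MVT_segment => //.
  apply: continuous_subspaceT => s.
  by apply/differentiable_continuous/derivable1_diffP; case: (gd s).
by rewrite subr0 mulr1; exact: gc.
Qed.

End LineCalculus.

(** * Symmetry of the Hessian and second-order bounds *)

Section SecondDerivatives.
Context {R : realType} {n : nat}.
Implicit Types (f : 'cV[R]_n -> R) (x u v : 'cV[R]_n).

Lemma continuous_partial f : twice_cont_diff f -> forall i, continuous (partial i f).
Proof. by case=> _ df _ i x; exact: differentiable_continuous. Qed.

(** The mean value theorem applied twice to the second difference over a square, first
    in the direction [i], then in the direction [j]. The left-hand side is symmetric
    in [i] and [j], the right-hand side is not: this is the source of the symmetry of
    second derivatives. *)
Lemma second_difference_MVT f (df : twice_cont_diff f) x (i j : 'I_n) (h : R) : 0 < h ->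
  exists s t, [/\ 0 <= s <= h, 0 <= t <= h &
    f (x + h *: delta_mx i ord0 + h *: delta_mx j ord0) - f (x + h *: delta_mx i ord0)
    - (f (x + h *: delta_mx j ord0) - f x)
    = h ^+ 2 * partial j (partial i f)
        (x + s *: delta_mx i ord0 + t *: delta_mx j ord0)].
Proof.
move=> h0; case: df => df ddf _.
set ei := delta_mx i ord0; set ej := delta_mx j ord0.
pose g s := f (x + h *: ej + s *: ei) - f (x + s *: ei).
have dotvE (k : 'I_n) y (q : 'cV[R]_n -> R) :
    dotv (grad q y) (delta_mx k ord0) = partial k q y by rewrite dotv_delta mxE.
have gd (s : R) : is_derive s 1 g (partial i f (x + h *: ej + s *: ei) - partial i f (x + s *: ei)).
  rewrite -!(dotvE i).
  by apply: is_deriveB; apply: is_derive_line.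
have [s sh gs] : exists2 s, s \in `[0, h]%R & g h - g 0 =
   (partial i f (x + h *: ej + s *: ei) - partial i f (x + s *: ei)) * (h - 0).
  apply: MVT_segment => //; first exact: ltW.
  apply: continuous_subspaceT => s.
  by apply/differentiable_continuous/derivable1_diffP; case: (gd s).
pose k t := partial i f (x + s *: ei + t *: ej).
have kd (t : R) : is_derive t 1 k (partial j (partial i f) (x + s *: ei + t *: ej)).
  by rewrite -(dotvE j); apply: is_derive_line.
have [t th kt] : exists2 t, t \in `[0, h]%R & k h - k 0 =
   partial j (partial i f) (x + s *: ei + t *: ej) * (h - 0).
  apply: MVT_segment => //; first exact: ltW.
  apply: continuous_subspaceT => r.
  by apply/differentiable_continuous/derivable1_diffP; case: (kd r).
exists s, t; split; [by move: sh; rewrite in_itv|by move: th; rewrite in_itv|].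
move: gs kt; rewrite /g /k !scale0r !addr0 !subr0 => gs kt.
rewrite (addrAC x (h *: ei)) gs (addrAC x (h *: ej)) kt.
ring.
Qed.

(** Schwarz's theorem: both mixed derivatives, taken at points that tend to [x], equal
    the same normalised second difference, and both are continuous at [x]. *)
Lemma hess_sym f (df : twice_cont_diff f) x i j : hess f x i j = hess f x j i.
Proof.
rewrite !mxE.
suff: partial i (partial j f) x - partial j (partial i f) x = 0.
  by move/eqP; rewrite subr_eq0 => /eqP.
apply/eqP; rewrite -normr_eq0 eq_le normr_ge0 andbT; apply/ler_addgt0Pl => e e0.
rewrite addr0.
have e20 : 0 < e / 2 by rewrite divr_gt0.
case: (df) => _ _ cdf.
have near_x k l : exists2 d, 0 < d & forall s t, `|s| < d -> `|t| < d ->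
    `|partial k (partial l f) x -
      partial k (partial l f) (x + s *: delta_mx i ord0 + t *: delta_mx j ord0)| < e / 2.
  have c : {for (0, 0), continuous (fun st : R * R =>
      partial k (partial l f) (x + st.1 *: delta_mx i ord0 + st.2 *: delta_mx j ord0))}.
    apply: continuous_comp; last exact: cdf.
    apply: cvgD; last by apply: cvgZr_tmp; exact: cvg_snd.
    by apply: cvgD; [exact: cvg_cst|apply: cvgZr_tmp; exact: cvg_fst].
  move/cvgrPdist_lt : c => /(_ _ e20) /=.
  rewrite !scale0r !addr0 => -[[U V] /= [[d1 d10 U0] [d2 d20 V0]] UV].
  exists (Num.min d1 d2); first by rewrite lt_min d10.
  move=> s t; rewrite !lt_min => /andP[s1 s2] /andP[t1 t2].
  apply: (UV (s, t)); split => /=.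
    by apply: U0; rewrite /ball_ /= sub0r normrN.
  by apply: V0; rewrite /ball_ /= sub0r normrN.
have [d1 d10 h1] := near_x i j; have [d2 d20 h2] := near_x j i.
set h := Num.min d1 d2 / 2.
have dm0 : 0 < Num.min d1 d2 by rewrite lt_min d10.
have h0 : 0 < h by rewrite divr_gt0.
have hd : h < Num.min d1 d2 by rewrite /h; lra.
have [s [t [sh th E1]]] := second_difference_MVT df x i j h0.
have [s' [t' [sh' th' E2]]] := second_difference_MVT df x j i h0.
have small r : 0 <= r <= h -> `|r| < d1 /\ `|r| < d2.
  move=> /andP[r0 rh]; rewrite ger0_norm//.
  by apply/andP; rewrite -lt_min; exact: le_lt_trans hd.
have E : partial i (partial j f) (x + t' *: delta_mx i ord0 + s' *: delta_mx j ord0)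
       = partial j (partial i f) (x + s *: delta_mx i ord0 + t *: delta_mx j ord0).
  apply: (@mulfI _ (h ^+ 2)); first by rewrite expf_neq0// gt_eqF.
  rewrite (addrAC x (t' *: delta_mx i ord0)); apply: etrans (esym E2) _.
  by apply: etrans E1; rewrite (addrAC x (h *: delta_mx j ord0)); lra.
have [s1 s2] := small _ sh; have [t1 t2] := small _ th.
have [s1' s2'] := small _ sh'; have [t1' t2'] := small _ th'.
have /ltW := h1 _ _ t1' s1'; have /ltW := h2 _ _ s2 t2; rewrite E => A1 A2.
move: A1 A2; move: (partial j (partial i f) (x + _ + _)) (partial j (partial i f) x)
  (partial i (partial j f) x) => q q1 q2 A1 A2.
move: A1 A2 (ler_distD q q2 q1); rewrite (distrC q); clear; lra.
Qed.

(** The increment of the gradient is tested against itself, which reduces the claim to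
    a scalar function on the segment and needs no integral of vectors. *)
Lemma grad_lipschitz f (df : twice_cont_diff f) x u (b : R) :
  (forall s v, 0 <= s <= 1 -> enorm (hess f (x + s *: u) *m v) <= b * enorm v) ->
  enorm (grad f (x + u) - grad f x) <= b * enorm u.
Proof.
move=> hb; set w := grad f (x + u) - grad f x.
case: (df) => _ ddf _.
have [/enorm_eq0 w0|w0] := eqVneq (enorm w) 0.
  have h0 : 0 <= (0:R) <= 1 by rewrite lexx ler01.
  by rewrite w0 enorm0; exact: le_trans (enorm_ge0 _) (hb 0 u h0).
have {}w0 : 0 < enorm w by rewrite lt_neqAle eq_sym w0 enorm_ge0.
rewrite -(ler_pM2r w0) -expr2 enorm_sqr {2}/w dotvDr dotvNr.
have := @increment_le _ (fun r => dotv w (grad f (x + r *: u)))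
  (fun s => dotv u (hess f (x + s *: u) *m w)) (b * enorm u * enorm w).
rewrite scale1r scale0r addr0; apply.
  by move=> s; exact: is_derive_line_grad.
move=> s s01; apply: le_trans (cauchy_schwarz _ _) _.
rewrite mulrAC mulrC ler_wpM2r ?enorm_ge0//.
exact: hb.
Qed.

(** The defect [s |-> s * <grad f x, u> - f (x + s u) - b/2 |u|^2 s^2] has a
    nonpositive derivative on the segment, by the Lipschitz bound for the gradient. *)
Lemma quadratic_lower_bound f (df : twice_cont_diff f) x u (b : R) :
  (forall s v, 0 <= s <= 1 -> enorm (hess f (x + s *: u) *m v) <= b * enorm v) ->
  f x + dotv (grad f x) u - b / 2 * enorm u ^+ 2 <= f (x + u).
Proof.
move=> hb; case: (df) => df1 df2 _.
pose c := b / 2 * enorm u ^+ 2.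
pose g s := s * dotv (grad f x) u - (f (x + s *: u) + c * s ^+ 2).
suff: g 1 - g 0 <= 0.
  rewrite /g /c scale1r scale0r addr0; lra.
apply: (@increment_le _ g (fun s => dotv (grad f x) u
   - (dotv (grad f (x + s *: u)) u + c * (2 * s)))) => s.
  apply: is_deriveB.
    by apply: is_derive_eq; rewrite scaler0 add0r [_ *: _]mulr1.
  apply: is_deriveD; first exact: is_derive_line.
  apply: is_deriveZ; apply: is_derive_eq.
  by rewrite ![_%:A]mulr1 mulr_natl.
move=> /andP[s0 s1].
have G : enorm (grad f (x + s *: u) - grad f x) <= b * enorm (s *: u).
  apply: (grad_lipschitz df) => r v /andP[r0 r1].
  have rs : 0 <= r * s <= 1 by rewrite mulr_ge0//= mulr_ile1.
  by have := hb _ v rs; rewrite -scalerA.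
have := cauchy_schwarz (grad f x - grad f (x + s *: u)) u.
rewrite dotvDl dotvNl enormB.
move: G; rewrite enormZ ger0_norm// => /(ler_wpM2r (enorm_ge0 u)).
by rewrite /c; lra.
Qed.

End SecondDerivatives.

(** * Monotone DR-submodular functions *)

Section DRSubmodular.
Context {R : realType} {n : nat}.
Implicit Types (x y u : 'cV[R]_n).

Lemma convex_combination (K : set 'cV[R]_n) (l : R) x y :
  convex_set K -> K x -> K y -> 0 <= l <= 1 -> K (l *: x + (1 - l) *: y).
Proof.
move=> cK Kx Ky /andP[l0 l1].
have := cK x y (Itv01 l0 l1); rewrite !inE => /(_ Kx Ky).
by rewrite /conv/= /unstable.onem.
Qed.

(** Only steps to the left are available at a point of the upper boundary of the box,
    so the sign of the derivative comes from its continuity and the mean value theorem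
    rather than from a two-sided comparison. *)
Lemma partial_ge0_of_left_max (F : 'cV[R]_n -> R) (F_C2 : twice_cont_diff F) x i (r : R) :
  0 < r -> (forall s, 0 <= s <= r -> F (x - s *: delta_mx i ord0) <= F x) ->
  0 <= partial i F x.
Proof.
move=> r0 Fle; rewrite leNgt; apply/negP => neg.
case: (F_C2) => F1 _ _.
have c : {for 0, continuous (fun s : R => partial i F (x + s *: - delta_mx i ord0))}.
  apply: continuous_comp; last exact: continuous_partial.
  by apply: cvgD; [exact: cvg_cst|apply: cvgZr_tmp; exact: cvg_id].
have e0 : 0 < - partial i F x by rewrite oppr_gt0.
move/cvgrPdist_lt : c => /(_ _ e0) /=; rewrite scale0r addr0 => -[e /= e_gt0 he].
pose h := Num.min r (e / 2).
have h0 : 0 < h by rewrite lt_min r0 divr_gt0.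
have he2 : h < e by rewrite gt_min; apply/orP; right; lra.
have [s s0h] : exists2 s, s \in `]0, h[%R &
   F (x + h *: - delta_mx i ord0) - F (x + 0 *: - delta_mx i ord0) =
   dotv (grad F (x + s *: - delta_mx i ord0)) (- delta_mx i ord0) * (h - 0).
  apply: (@MVT _ (fun s : R => F (x + s *: - delta_mx i ord0))
    (fun s : R => dotv (grad F (x + s *: - delta_mx i ord0)) (- delta_mx i ord0))) => //.
    by move=> s _; exact: is_derive_line.
  apply: continuous_subspaceT => s.
  apply/differentiable_continuous/derivable1_diffP.
  by case: (@is_derive_line _ _ F x (- delta_mx i ord0) s (F1 _)).
rewrite scale0r addr0 subr0 scalerN => E.
have := Fle h; rewrite (ltW h0) ge_min lexx => /(_ isT); rewrite -subr_le0 E.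
rewrite leNgt => /negP; apply; apply: mulr_gt0 => //.
rewrite dotvNr dotv_delta mxE oppr_gt0.
move: s0h; rewrite in_itv/= => /andP[s0 sh].
have := he s; rewrite /ball_/= sub0r normrN gtr0_norm// => /(_ (lt_trans sh he2)).
rewrite ltr_norml => /andP[]; lra.
Qed.

(** The join [x + u] of [x] and [y] dominates [y], and the gradient decreases along
    the segment from [x] to the join, so [F y - F x <= <grad F x, u>]. The factors
    of the box need not be intervals, but each coordinate of that segment is one of a
    point of the convex set [K]. Passing from [u] to [y] in the inner product needs
    the partial derivative to be nonnegative only where [x] has a positive coordinate,
    and there one may move down towards [0]. *)
Lemma dr_gap_le (F : 'cV[R]_n -> R) (Xs : 'I_n -> set R) (K : set 'cV[R]_n) x y :
  twice_cont_diff F -> convex_set K -> K 0 -> K `<=` box Xs ->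
  (forall i r, Xs i r -> 0 <= r) ->
  monotone_on (box Xs) F -> dr_submodular_on (box Xs) F ->
  K x -> K y -> F y - F x <= dotv (grad F x) y.
Proof.
move=> F_C2 cK K0 KX X0 Fm Fdr Kx Ky; case: (F_C2) => F1 _ _.
have x0 i : 0 <= x i ord0 by apply: X0; exact: KX.
have y0 i : 0 <= y i ord0 by apply: X0; exact: KX.
(* [x + u] is the join of [x] and [y] *)
pose u : 'cV[R]_n := \col_i Num.max 0 (y i ord0 - x i ord0).
have u0 i : 0 <= u i ord0 by rewrite mxE le_max lexx.
(* the i-th coordinate either does not move, or it is that of a point of [x, y] *)
have box_seg s : 0 <= s <= 1 -> box Xs (x + s *: u).
  move=> s01 i; rewrite !mxE.
  have [yx|xy] := leP (y i ord0 - x i ord0) 0.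
    by rewrite mulr0 addr0; exact: KX.
  have -> : x i ord0 + s * (y i ord0 - x i ord0) =
    (s *: y + (1 - s) *: x) i ord0 by rewrite !mxE; lra.
  by apply: KX; exact: convex_combination.
have h01 : 0 <= (0:R) <= 1 by apply/andP; split; [exact: lexx|exact: ler01].
have h11 : 0 <= (1:R) <= 1 by apply/andP; split; [exact: ler01|exact: lexx].
have le_y_join : F y <= F (x + u).
  apply: Fm; [exact: KX|by have := box_seg _ h11; rewrite scale1r|].
  move=> i; rewrite !mxE -lerBlDl le_max lexx orbT //.
have join_le : F (x + u) - F x <= dotv (grad F x) u.
  have := @increment_le _ (fun s => F (x + s *: u))
    (fun s => dotv (grad F (x + s *: u)) u) (dotv (grad F x) u).
  rewrite scale1r scale0r addr0; apply.
    by move=> s; exact: is_derive_line.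
  move=> s s01; apply: ler_sum => i _; rewrite ler_wpM2r// !mxE.
  apply: Fdr; [by have := box_seg _ h01; rewrite scale0r addr0|exact: box_seg|].
  by move=> j; rewrite !mxE lerDl mulr_ge0//; [case/andP: s01|have := u0 j; rewrite mxE].
suff: dotv (grad F x) u <= dotv (grad F x) y by lra.
apply: ler_sum => i _.
have [xi0|xi0] := eqVneq (x i ord0) 0.
  by rewrite !mxE xi0 subr0 max_r.
(* moving down along the i-th axis: the moved coordinate is that of a multiple of x *)
have gi0 : 0 <= grad F x i ord0.
  have {}xi0 : 0 < x i ord0 by rewrite lt_neqAle eq_sym xi0 x0.
  rewrite mxE; apply: (partial_ge0_of_left_max F_C2 xi0) => s /andP[s0 sx].
  apply: Fm; [|exact: KX|]; last first.
    move=> j; rewrite !mxE lerBlDr lerDl; case: (j == i) => /=.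
      by rewrite mulr1.
    by rewrite mulr0.
  move=> j; rewrite !mxE; have [->|ji] := eqVneq j i; last first.
    by rewrite mulr0 subr0; exact: KX.
  have -> : x i ord0 - s * (true && (ord0 == ord0 :> 'I_1))%:R =
     (((x i ord0 - s) / x i ord0) *: x + (1 - (x i ord0 - s) / x i ord0) *: 0) i ord0.
    by rewrite !mxE eqxx mulr0 addr0 mulr1 divfK ?gt_eqF.
  apply: KX; apply: convex_combination => //.
  by rewrite ler_pdivlMr// mul0r subr_ge0 sx ler_pdivrMr// mul1r gerBl.
rewrite ler_wpM2l// mxE ge_max y0/= gerBl; exact: x0.
Qed.

End DRSubmodular.

(** * Measurability of functions continuous in the point and measurable in the sample *)

Section Caratheodory.
Context {R : realType} {n : nat}.

(** Replace [X t] by the lower corner of its cell in the grid of mesh [1/(k+1)]. The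
    corner takes countably many values, so for each grid the composite is measurable
    piece by piece, and it converges to [f (X t) (Y t)] by continuity in the point.
    The two maps [X] and [Y] live on an arbitrary measurable space, which covers joint
    measurability on a product as well as measurability of sampled quantities. *)
Lemma measurable_caratheodory (dT dZ : measure_display) (T : measurableType dT)
    (Z : measurableType dZ) (f : 'cV[R]_n -> Z -> R) (X : T -> 'cV[R]_n) (Y : T -> Z) :
  (forall z, continuous (f ^~ z)) -> (forall x, measurable_fun setT (f x)) ->
  (forall i, measurable_fun setT (fun t => X t i ord0)) -> measurable_fun setT Y ->
  measurable_fun setT (fun t => f (X t) (Y t)).
Proof.
move=> cf mf mX mY.
pose cell k t : {ffun 'I_n -> int} := [ffun i => Num.floor (X t i ord0 * k.+1%:R)].
pose corner (k : nat) (c : {ffun 'I_n -> int}) : 'cV[R]_n := \col_i ((c i)%:~R / k.+1%:R).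
apply: (measurable_fun_cvg (h := fun k t => f (corner k (cell k t)) (Y t))); last first.
  move=> t _.
  apply: (@cvg_comp _ _ _ (fun k => corner k (cell k t)) (f ^~ (Y t)) \oo
    (nbhs (X t))); last exact: cf.
  apply/cvg_ballP => e e0.
  have k0 : \forall k \near \oo, k.+1%:R^-1 < e by exact: near_infty_natSinv_lt (PosNum e0).
  near=> k; have ke : k.+1%:R^-1 < e by near: k.
  split => // i j; rewrite ord1 !mxE !ffunE /ball/=; apply: le_lt_trans ke.
  have k1 : (0:R) < k.+1%:R by rewrite ltr0n.
  have := floor_itv (X t i ord0 * k.+1%:R).
  move: (Num.floor _) => c; rewrite intrD => /andP[fl fu].
  have -> : X t i ord0 - c%:~R / k.+1%:R = (X t i ord0 * k.+1%:R - c%:~R) / k.+1%:R.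
    by rewrite mulrBl mulfK// gt_eqF.
  rewrite normrM [X in _ * X]gtr0_norm ?invr_gt0// ger0_norm ?subr_ge0//.
  by rewrite ler_piMl ?invr_ge0 ?ltW//; move: fu; lra.
move=> k _ A mA; rewrite setTI.
rewrite (_ : _ @^-1` A = \bigcup_(c in [set: {ffun 'I_n -> int}])
    ((\bigcap_(i in [set: 'I_n]) ((fun t => X t i ord0 * k.+1%:R) @^-1`
        `[(c i)%:~R, (c i + 1)%:~R[%classic)) `&` (Y @^-1` (f (corner k c) @^-1` A)))).
  apply: countable_bigcupT_measurable => [|c]; first exact: countableP.
  apply: measurableI.
    apply: fin_bigcap_measurable => [|i _]; first exact: finite_finset.
    rewrite -[X in measurable X]setTI.
    by apply: measurable_funM => //; exact: measurable_itv.
  rewrite -[X in measurable X]setTI; apply: mY => //.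
  by rewrite -[X in measurable X]setTI; exact: mf.
apply/seteqP; split => t /=.
  move=> At; exists (cell k t) => //; split => // i _ /=.
  by rewrite in_itv/= ffunE floor_itv.
case=> c _ [ct At]; suff <- : c = cell k t by [].
apply/ffunP => i; rewrite ffunE; apply/esym/eqP; rewrite floor_eq.
by have := ct i I; rewrite /= in_itv.
Unshelve. all: by end_near. Qed.

Lemma measurable_continuous (dT : measure_display) (T : measurableType dT)
    (f : 'cV[R]_n -> R) (X : T -> 'cV[R]_n) : continuous f ->
  (forall i, measurable_fun setT (fun t => X t i ord0)) ->
  measurable_fun setT (fun t => f (X t)).
Proof.
move=> cf mX.
by apply: (@measurable_caratheodory _ _ _ _ (fun x _ => f x) X id).
Qed.

End Caratheodory.

(** * Measures with a density, and disintegration of the law of a pair *)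

Section DensityMeasure.
Local Open Scope ereal_scope.
Context d (T : measurableType d) (R : realType) (m : {measure set T -> \bar R}).
Variable f : T -> R.
Hypotheses (f0 : forall x, (0 <= f x)%R) (mf : measurable_fun setT f).

(** The two proofs are arguments so that the measure structure, which depends on them,
    can be found from the term. *)
Definition density_measure (_ : forall x, (0 <= f x)%R) (_ : measurable_fun setT f)
  (A : set T) : \bar R := \int[m]_(x in A) (f x)%:E.

Let dens := density_measure f0 mf.

Let dens0 : dens set0 = 0.
Proof. exact: integral_set0. Qed.

Let dens_ge0 A : 0 <= dens A.
Proof. by apply: integral_ge0 => x _; rewrite lee_fin. Qed.

Let dens_sigma_additive : semi_sigma_additive dens.
Proof.
move=> /= F mF tF mUF; rewrite /dens /density_measure; apply: cvg_toP.
  apply: ereal_nondecreasing_is_cvgn => k l kl.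
  apply: lee_sum_nneg_natr => // i _ _.
  by apply: integral_ge0 => x _; rewrite lee_fin.
rewrite ge0_integral_bigcup//=.
- exact/measurable_funTS/measurable_EFinP.
- by move=> x _; rewrite lee_fin.
Qed.

HB.instance Definition _ := isMeasure.Build _ _ _ dens
  dens0 dens_ge0 dens_sigma_additive.

Definition density_measure_measure : {measure set T -> \bar R} := dens.

Import HBNNSimple.

Lemma integral_density_indic (E : set T) : measurable E ->
  \int[dens]_x (\1_E x)%:E = \int[m]_x ((\1_E x)%:E * (f x)%:E).
Proof.
move=> mE; rewrite integral_indic//= setIT /dens /density_measure integral_mkcond.
apply: eq_integral => x _; rewrite patchE indicE.
by case: (x \in E); rewrite ?mul1e ?mul0e.
Qed.

Lemma integral_density_nnsfun (g : {nnsfun T >-> R}) :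
  \int[dens]_x (g x)%:E = \int[m]_x ((g x)%:E * (f x)%:E).
Proof.
under [LHS]eq_integral do rewrite fimfunE -fsumEFin//.
rewrite [LHS]ge0_integral_fsum//; last 2 first.
  - by move=> r; exact/measurable_EFinP/measurableT_comp.
  - by move=> n x _; rewrite EFinM nnfun_muleindic_ge0.
under [RHS]eq_integral.
  move=> x xD; rewrite fimfunE -fsumEFin// ge0_mule_fsuml; last first.
    by move=> r; rewrite EFinM nnfun_muleindic_ge0.
  over.
rewrite [RHS]ge0_integral_fsum//; last 2 first.
  - move=> r; apply: emeasurable_funM; last exact/measurable_EFinP.
    by apply/measurable_EFinP; do 2 apply/measurableT_comp => //.
  - move=> n x _; rewrite EFinM mule_ge0//; first by rewrite nnfun_muleindic_ge0.
    by rewrite lee_fin.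
apply: eq_fsbigr => r rg.
have [r0|r0] := ltP r 0%R.
  have E0 : g @^-1` [set r] = set0.
    apply/seteqP; split => // x /= gxr.
    by move: r0; rewrite -gxr ltNge fun_ge0.
  rewrite !integral0_eq// => x _; rewrite E0 indicE in_set0 mulr0 ?mul0e//.
under [RHS]eq_integral do rewrite EFinM -muleA.
rewrite [RHS]ge0_integralZl//; last 2 first.
  - apply: emeasurable_funM; last exact/measurable_EFinP.
    exact/measurable_EFinP/measurable_indic.
  - by move=> x _; rewrite mule_ge0 ?lee_fin.
under [LHS]eq_integral do rewrite EFinM.
rewrite [LHS]ge0_integralZl//; last by exact/measurable_EFinP/measurable_indic.
by rewrite integral_density_indic.
Qed.

(** Both sides are continuous along increasing sequences of simple functions, and for
    an indicator the identity is the definition. *)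
Lemma ge0_integral_density (g : T -> \bar R) : measurable_fun setT g ->
  (forall x, 0 <= g x) -> \int[dens]_x g x = \int[m]_x (g x * (f x)%:E).
Proof.
move=> mg g0; pose g_ := nnsfun_approx measurableT mg.
transitivity (limn (fun n => \int[dens]_x (g_ n x)%:E)).
  rewrite -monotone_convergence//=.
  - apply: eq_integral => ? /[!inE] xD; apply/esym/cvg_lim => //=.
    exact: cvg_nnsfun_approx.
  - by move=> n; exact/measurable_EFinP/measurable_funTS.
  - by move=> n ? _; rewrite lee_fin.
  - by move=> ? _ ? ? mn; rewrite lee_fin; exact/lefP/nd_nnsfun_approx.
under eq_fun do rewrite integral_density_nnsfun.
rewrite -monotone_convergence//=.
- apply: eq_integral => x /[!inE] xD; apply/cvg_lim => //=.
  by apply: cvgeZr => //; exact: cvg_nnsfun_approx.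
- move=> n; apply: emeasurable_funM; last exact/measurable_EFinP.
  exact/measurable_EFinP/measurable_funTS.
- by move=> n x _; rewrite mule_ge0 ?lee_fin.
- move=> x _ k l kl; rewrite lee_wpmul2r ?lee_fin//.
  exact/lefP/nd_nnsfun_approx.
Qed.

End DensityMeasure.

Section Disintegration.
Local Open Scope ereal_scope.
Context {R : realType} {dO dH dZ : measure_display} {Omega : measurableType dO}
  {H : measurableType dH} {Z : measurableType dZ} {P : probability Omega R}.
Variables (mu : {sigma_finite_measure set Z -> \bar R}) (h : {mfun Omega >-> H})
  (Y : {mfun Omega >-> Z}) (q : H -> Z -> R).
Hypotheses (q0 : forall x z, (0 <= q x z)%R)
  (mq : measurable_fun setT (fun xz : H * Z => q xz.1 xz.2))
  (law : forall E A, measurable E -> measurable A ->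
    P (h @^-1` E `&` Y @^-1` A) =
    \int[P]_(w in h @^-1` E) \int[mu]_(y in A) (q (h w) y)%:E).

(** The law of [(h, Y)] and the measure of density [q] with respect to the product of
    the law of [h] and [mu] agree on rectangles by hypothesis, hence everywhere; Tonelli's
    theorem computes integrals against the latter. In the applications [h] is the
    identity onto a coarser sigma-algebra, the past, so that [h w] carries exactly the
    information that the conditioning allows. *)
Lemma ge0_disintegration (g : H * Z -> \bar R) : measurable_fun setT g ->
  (forall xz, 0 <= g xz) ->
  \int[P]_w g (h w, Y w) = \int[P]_w \int[mu]_y (g (h w, y) * (q (h w) y)%:E).
Proof.
move=> mg g0.
have mhY : measurable_fun setT (fun w => (h w, Y w)) by exact: measurable_fun_pair.
pose hY : {mfun Omega >-> (H * Z)%type} :=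
  HB.pack (fun w => (h w, Y w)) (isMeasurableFun.Build _ _ _ _ _ mhY).
pose m1 : {measure set (H * Z) -> \bar R} := distribution P hY.
pose Q : {sigma_finite_measure set H -> \bar R} := distribution P h.
have q0' (xz : H * Z) : (0 <= q xz.1 xz.2)%R by [].
pose m2 := density_measure_measure (Q \x mu) q0' mq.
have mqE : measurable_fun setT (fun xz : H * Z => (q xz.1 xz.2)%:E).
  exact/measurable_EFinP.
have m12 A : measurable A -> m1 A = m2 A.
  pose C : set (set (H * Z)) :=
    [set C | exists A, measurable A /\ exists B, measurable B /\ C = A `*` B].
  apply: (measure_unique C (fun=> setT)) => //.
  - rewrite measurable_prod_measurableType //; congr (<<s _ >>).
    rewrite predeqE; split => [[B mB [D mD <-]]|[B [mB [D [mD ->]]]]].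
      by exists B; split => //; exists D.
    by exists B => //; exists D.
  - move=> /= _ _ [X1 [mX1 [X2 [mX2 ->]]]] [Y1 [mY1 [Y2 [mY2 ->]]]].
    rewrite -setXI; exists (X1 `&` Y1); split; first exact: measurableI.
    by exists (X2 `&` Y2); split => //; exact: measurableI.
  - by move=> k; exists setT; split => //; exists setT; split => //; rewrite setXTT.
  - by rewrite bigcup_const.
  - move=> _ [B [mB [D [mD ->]]]].
    rewrite /m1 /m2 /= /distribution /pushforward /density_measure.
    rewrite (_ : _ @^-1` _ = h @^-1` B `&` Y @^-1` D)// law//.
    pose r := (fun xz : H * Z => (q xz.1 xz.2)%:E) \_ (B `*` D).
    have mr : measurable_fun setT r.
      by apply/(measurable_restrictT _ _).1; [exact: measurableX|exact/measurable_funTS].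
    have r0 xz : 0 <= r xz by apply: erestrict_ge0 => y _; rewrite lee_fin.
    rewrite [RHS]integral_mkcond -/r fubini_tonelli1//.
    rewrite [RHS]ge0_integral_pushforward//; last 2 first.
      exact: measurable_fun_fubini_tonelli_F.
      by move=> x _; exact: integral_ge0.
    rewrite [LHS]integral_mkcond; apply: eq_integral => w _ /=.
    rewrite patchE /fubini_F; case: ifPn => [hB|hB].
      rewrite [LHS]integral_mkcond; apply: eq_integral => y _.
      rewrite /r !patchE; congr (if _ then _ else _).
      apply/idP/idP; rewrite !inE/=; first by move=> Dy; split => //; rewrite inE in hB.
      by case.
    rewrite integral0_eq// => y _; rewrite /r patchE ifN//.
    apply: contra hB; rewrite !inE/=; by case.
  - by move=> k; rewrite ltey_eq fin_num_measure.
transitivity (\int[m1]_x g x).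
  by rewrite ge0_integral_pushforward.
rewrite (eq_measure_integral m2); last by move=> A mA _; exact: m12.
have mgq : measurable_fun setT (fun xz : H * Z => g xz * (q xz.1 xz.2)%:E).
  exact: emeasurable_funM.
have gq0 (xz : H * Z) : 0 <= g xz * (q xz.1 xz.2)%:E by rewrite mule_ge0 ?lee_fin.
rewrite ge0_integral_density// fubini_tonelli1//.
rewrite ge0_integral_pushforward//.
  exact: measurable_fun_fubini_tonelli_F.
by move=> x _; apply: integral_ge0 => y _; exact: (gq0 (x, y)).
Qed.

(** The signed case follows by splitting [g] into positive and negative parts. The inner
    integral is only required to be known almost everywhere, because the sampled point
    lies in the constraint set only almost surely. *)
Lemma disintegration (g : H * Z -> R) (k : Omega -> R) :
  measurable_fun setT g -> measurable_fun setT k ->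
  P.-integrable setT (fun w => (g (h w, Y w))%:E) ->
  {ae P, forall w, \int[mu]_y (g (h w, y) * q (h w) y)%:E = (k w)%:E} ->
  P.-integrable setT (fun w => (k w)%:E) /\
  \int[P]_w (g (h w, Y w))%:E = \int[P]_w (k w)%:E.
Proof.
move=> mg mk ig kE.
have mgE : measurable_fun setT (fun xz => (g xz)%:E) by exact/measurable_EFinP.
pose gp := (fun xz => (g xz)%:E)^\+; pose gn := (fun xz => (g xz)%:E)^\-.
have mgp : measurable_fun setT gp by exact: measurable_funepos.
have mgn : measurable_fun setT gn by exact: measurable_funeneg.
pose kp w := \int[mu]_y (gp (h w, y) * (q (h w) y)%:E).
pose kn w := \int[mu]_y (gn (h w, y) * (q (h w) y)%:E).
have kp0 w : 0 <= kp w.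
  by apply: integral_ge0 => y _; rewrite mule_ge0 ?lee_fin// funepos_ge0.
have kn0 w : 0 <= kn w.
  by apply: integral_ge0 => y _; rewrite mule_ge0 ?lee_fin// funeneg_ge0.
have mK (f : H * Z -> \bar R) : measurable_fun setT f -> (forall xz, 0 <= f xz) ->
    measurable_fun setT (fun w => \int[mu]_y (f (h w, y) * (q (h w) y)%:E)).
  move=> mf f0.
  apply: (measurableT_comp (f := fun x => \int[mu]_y (f (x, y) * (q x y)%:E))) => //.
  apply: (measurable_fun_fubini_tonelli_F (fun xz => f xz * (q xz.1 xz.2)%:E)).
    by apply: emeasurable_funM => //; exact/measurable_EFinP.
  by move=> xz; rewrite mule_ge0 ?lee_fin.
have mkp : measurable_fun setT kp by apply: mK => // xz; exact: funepos_ge0.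
have mkn : measurable_fun setT kn by apply: mK => // xz; exact: funeneg_ge0.
have Ep : \int[P]_w gp (h w, Y w) = \int[P]_w kp w.
  by apply: ge0_disintegration => // xz; exact: funepos_ge0.
have En : \int[P]_w gn (h w, Y w) = \int[P]_w kn w.
  by apply: ge0_disintegration => // xz; exact: funeneg_ge0.
have ip : P.-integrable setT (fun w => gp (h w, Y w)).
  apply: eq_integrable (integrable_funepos measurableT ig) => // w _.
  by rewrite /gp !funeposE.
have iN : P.-integrable setT (fun w => gn (h w, Y w)).
  apply: eq_integrable (integrable_funeneg measurableT ig) => // w _.
  by rewrite /gn !funenegE.
have fin_int (f f' : Omega -> \bar R) : (forall w, 0 <= f w) -> (forall w, 0 <= f' w) ->
    measurable_fun setT f' -> \int[P]_w f w = \int[P]_w f' w ->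
    P.-integrable setT f -> P.-integrable setT f'.
  move=> f0 f0' mf' E /integrableP[_].
  under eq_integral do rewrite gee0_abs//.
  rewrite E => oo; apply/integrableP; split => //.
  by under eq_integral do rewrite gee0_abs//.
have ikp : P.-integrable setT kp.
  by apply: (fin_int _ kp _ _ mkp Ep ip) => // w; exact: funepos_ge0.
have ikn : P.-integrable setT kn.
  by apply: (fin_int _ kn _ _ mkn En iN) => // w; exact: funeneg_ge0.
have kpn : ae_eq P setT (fun w => kp w - kn w) (fun w => (k w)%:E).
  apply: filterS kE => w <- _; rewrite [RHS]integralE.
  congr (_ - _); apply: eq_integral => y _.
    rewrite /gp !funeposE -!EFin_max -EFinM maxr_pMl//.
    by rewrite mul0r.
  rewrite /gn !funenegE -!EFinN -!EFin_max -EFinM maxr_pMl//.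
  by rewrite mul0r mulNr.
have mkE : measurable_fun setT (fun w => (k w)%:E) by exact/measurable_EFinP.
have ikpn := integrableB measurableT ikp ikn.
split.
  apply/integrableP; split => //.
  rewrite -(@ae_eq_integral _ _ _ P setT (fun w => `|(k w)%:E|)
    (fun w => `|kp w - kn w|)) => //.
  - by case/integrableP : ikpn.
  - by apply: measurableT_comp => //; exact: emeasurable_funB.
  - exact: measurableT_comp.
  - by apply: filterS kpn => w /= h1 _; rewrite h1.
rewrite -(ae_eq_integral (fun w => (k w)%:E) _ _ _ _ kpn)//; last exact: emeasurable_funB.
rewrite integralB// -Ep -En [LHS]integralE.
by congr (_ - _); apply: eq_integral => w _; rewrite /gp /gn ?funeposE ?funenegE.
Qed.

End Disintegration.

(** * Integrals against densities and Jensen's inequality *)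

Section DensityIntegrals.
Local Open Scope ereal_scope.
Context d (T : measurableType d) (R : realType).

(** An identity in the extended reals: as [q] is nonnegative, both sides split into
    positive and negative parts in the same way. *)
Lemma integral_density (m : {measure set T -> \bar R}) (q f : T -> R)
  (q0 : forall x, (0 <= q x)%R) (mq : measurable_fun setT q) :
  measurable_fun setT f ->
  \int[density_measure_measure m q0 mq]_x (f x)%:E = \int[m]_x (f x * q x)%:E.
Proof.
move=> mf; have mfE : measurable_fun setT (fun x => (f x)%:E) by exact/measurable_EFinP.
have mp := measurable_funepos mfE; have mn := measurable_funeneg mfE.
have p0 := funepos_ge0 (fun x => (f x)%:E); have n0 := funeneg_ge0 (fun x => (f x)%:E).
rewrite [LHS]integralE [RHS]integralE !ge0_integral_density//.
congr (_ - _); apply: eq_integral => y _.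
  rewrite !funeposE -!EFin_max -EFinM maxr_pMl//.
  by rewrite mul0r.
rewrite !funenegE -!EFinN -!EFin_max -EFinM maxr_pMl//.
by rewrite mul0r mulNr.
Qed.

(** The integral of a nonnegative function is a supremum over the simple functions below
    it, which grows with the function. The case in view is a bound by a spectral norm,
    the supremum of an uncountable family. *)
Lemma ge0_le_integral_nonmeasurable (m : {measure set T -> \bar R}) (f g : T -> \bar R) :
  (forall x, 0 <= f x) -> (forall x, f x <= g x) -> \int[m]_x f x <= \int[m]_x g x.
Proof.
move=> f0 fg; rewrite !ge0_integralTE//; last by move=> x; exact: le_trans (fg x).
by apply: le_ereal_sup => _ [h hf <-]; exists h => // x; exact: le_trans (fg x).
Qed.

End DensityIntegrals.

Section Moments.
Context d (T : measurableType d) (R : realType) (m : {measure set T -> \bar R}) (n : nat).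
Hypothesis m1 : m setT = 1%E.

Lemma measurable_dotv dT (U : measurableType dT) (u v : U -> 'cV[R]_n) :
  (forall i, measurable_fun setT (fun w => u w i ord0)) ->
  (forall i, measurable_fun setT (fun w => v w i ord0)) ->
  measurable_fun setT (fun w => dotv (u w) (v w)).
Proof.
move=> mu mv; apply: measurable_sum => i.
exact: measurable_funM.
Qed.

Lemma measurable_sqr_enorm dT (U : measurableType dT) (u : U -> 'cV[R]_n) :
  (forall i, measurable_fun setT (fun w => u w i ord0)) ->
  measurable_fun setT (fun w => enorm (u w) ^+ 2).
Proof.
move=> mu; under eq_fun do rewrite enorm_sqr.
exact: measurable_dotv.
Qed.

Lemma integrable_le (f g : T -> R) : measurable_fun setT f ->
  m.-integrable setT (EFin \o g) -> (forall x, `|f x| <= g x) ->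
  m.-integrable setT (EFin \o f).
Proof.
move=> mf ig fg; apply: le_integrable ig => //; first exact/measurable_EFinP.
move=> x _ /=; rewrite lee_fin; apply: le_trans (fg x) _.
exact: ler_norm.
Qed.

(** A finite difference of extended reals has finite terms. *)
Lemma integrable_of_fin_integral (f : T -> R) (r : R) : measurable_fun setT f ->
  (\int[m]_z (f z)%:E = r%:E)%E -> m.-integrable setT (EFin \o f).
Proof.
move=> mf fr; have mfE : measurable_fun setT (EFin \o f) by exact/measurable_EFinP.
have : (\int[m]_z (f z)%:E)%E \is a fin_num by rewrite fr.
rewrite integralE fin_numB => /andP[fp fn]; apply/integrableP; split => //.
have -> : (\int[m]_x `|(EFin \o f) x| =
    \int[m]_x ((EFin \o f)^\+ x) + \int[m]_x ((EFin \o f)^\- x))%E.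
  rewrite -ge0_integralD//.
  - by apply: eq_integral => x _; exact: (congr1 (fun g => g x) (fune_abse (EFin \o f))).
  - exact: measurable_funepos.
  - exact: measurable_funeneg.
by rewrite lte_add_pinfty// ltey_eq ?fp ?fn.
Qed.

Lemma ge0_integral_affine (a b : T -> R) (c1 c2 c3 : R) :
  measurable_fun setT a -> measurable_fun setT b ->
  (forall z, 0 <= a z) -> (forall z, 0 <= b z) -> 0 <= c1 -> 0 <= c2 -> 0 <= c3 ->
  (\int[m]_z (c1 * a z + c2 + c3 * b z)%:E =
   c1%:E * \int[m]_z (a z)%:E + c2%:E + c3%:E * \int[m]_z (b z)%:E)%E.
Proof.
move=> ma mb a0 b0 c1_0 c2_0 c3_0.
have mE (f : T -> R) (c : R) : measurable_fun setT f ->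
    measurable_fun setT (fun z => c%:E * (f z)%:E)%E.
  by move=> mf; apply: emeasurable_funM => //; exact/measurable_EFinP.
have e1 z : (0 <= c1%:E * (a z)%:E)%E by rewrite -EFinM lee_fin mulr_ge0.
have e3 z : (0 <= c3%:E * (b z)%:E)%E by rewrite -EFinM lee_fin mulr_ge0.
have e12 z : (0 <= c1%:E * (a z)%:E + c2%:E)%E by rewrite adde_ge0.
have me1 := mE a c1 ma; have me3 := mE b c3 mb.
have m12 : measurable_fun setT (fun z => c1%:E * (a z)%:E + c2%:E)%E.
  exact: emeasurable_funD.
have Zl (f : T -> R) (c : R) : measurable_fun setT f -> (forall z, 0 <= f z) -> 0 <= c ->
    (\int[m]_z (c%:E * (f z)%:E) = c%:E * \int[m]_z (f z)%:E)%E.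
  move=> mf f0 c0; apply: ge0_integralZl => //; first exact/measurable_EFinP.
  by move=> z _; rewrite lee_fin.
under eq_integral do rewrite !EFinD !EFinM.
rewrite ge0_integralD//.
rewrite ge0_integralD//.
by rewrite (Zl a)// (Zl b)// (integral_cst _ measurableT c2%:E) m1 mule1.
Qed.

(** Integrate [2 <e, h> <= |e|^2 + |h|^2]: as [h] has mean [e], the left-hand side
    integrates to [2 |e|^2]. *)
Lemma jensen_sqr_enorm (h : T -> 'cV[R]_n) (e : 'cV[R]_n) (c : R) :
  (forall i, measurable_fun setT (fun z => h z i ord0)) ->
  (forall i, \int[m]_z (h z i ord0)%:E = (e i ord0)%:E)%E ->
  (\int[m]_z (enorm (h z) ^+ 2)%:E <= c%:E)%E ->
  enorm e ^+ 2 <= c.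
Proof.
move=> mh he hc.
have mh2 : measurable_fun setT (fun z => enorm (h z) ^+ 2) by exact: measurable_sqr_enorm.
have ih2 : m.-integrable setT (fun z => (enorm (h z) ^+ 2)%:E).
  apply/integrableP; split; first exact/measurable_EFinP.
  under eq_integral do rewrite gee0_abs ?lee_fin ?sqr_ge0//.
  by apply: le_lt_trans hc _; rewrite ltry.
have icst r : m.-integrable setT (fun=> r%:E).
  apply/integrableP; split => //.
  by rewrite (integral_cst _ _ `|r|%:E)// m1 mule1 ltry.
have ih i : m.-integrable setT (fun z => (h z i ord0)%:E).
  apply: (@integrable_le _ (fun z => 1 + enorm (h z) ^+ 2)) => //.
    exact: (integrableD measurableT (icst 1) ih2).
  move=> z; have := norm_coord_le (h z) i; have := sqr_ge0 (enorm (h z) - 1).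
  have := sqr_ge0 (enorm (h z)); lra.
have E : (\int[m]_z (dotv e (h z))%:E = (dotv e e)%:E)%E.
  under eq_integral do rewrite /dotv -sumEFin.
  rewrite integral_sum//; last first.
    by move=> i; exact: (integrableZl measurableT (e i ord0) (ih i)).
  rewrite /dotv -sumEFin; apply: eq_bigr => i _.
  by under eq_integral do rewrite EFinM; rewrite integralZl// he.
have idot : m.-integrable setT (fun z => (dotv e (h z))%:E).
  apply: (@integrable_le _ (fun z => enorm e ^+ 2 + enorm (h z) ^+ 2)).
  - exact: measurable_dotv.
  - exact: (integrableD measurableT (icst _) ih2).
  - move=> z; apply: le_trans (norm_dotv_le _ _) _.
    have := sqr_ge0 (enorm (h z) - enorm e).
    have := sqr_ge0 (enorm (h z)); have := sqr_ge0 (enorm e); lra.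
have : (2%:E * (enorm e ^+ 2)%:E <= (enorm e ^+ 2)%:E + c%:E)%E.
  rewrite {1}enorm_sqr -E -integralZl//.
  have -> : ((enorm e ^+ 2)%:E = \int[m]_z (enorm e ^+ 2)%:E)%E.
    by rewrite (integral_cst _ _ (enorm e ^+ 2)%:E)// m1 mule1.
  apply: le_trans (leeD2l _ hc); rewrite -integralD//.
  apply: le_integral => //.
  - exact: (integrableZl measurableT 2 idot).
  - exact: (integrableD measurableT (icst _) ih2).
  - by move=> z _; rewrite -EFinM -EFinD lee_fin; exact: dotv_young.
by rewrite -EFinM -EFinD lee_fin; lra.
Qed.

End Moments.

(** * The Hessian estimator *)

Section ContinuousRealOps.
Context {R : realType} {V : topologicalType}.
Implicit Types g h : V -> R.

Lemma continuous_addr g h : continuous g -> continuous h ->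
  continuous (fun x => g x + h x).
Proof. by move=> cg ch x; apply: cvgD; [exact: cg|exact: ch]. Qed.

Lemma continuous_mulr g h : continuous g -> continuous h ->
  continuous (fun x => g x * h x).
Proof. by move=> cg ch x; apply: cvgM; [exact: cg|exact: ch]. Qed.

End ContinuousRealOps.

Section Estimators.
Context {R : realType} {n : nat} {dZ : measure_display} {Z : measurableType dZ}.
Implicit Types (f : 'cV[R]_n -> R) (x u : 'cV[R]_n) (p Ft : 'cV[R]_n -> Z -> R).

Lemma continuous_grad f : twice_cont_diff f -> forall i,
  continuous (fun x => grad f x i ord0).
Proof.
move=> df i; under eq_fun do rewrite mxE.
exact: continuous_partial.
Qed.

Lemma continuous_hess f : twice_cont_diff f -> forall i j,
  continuous (fun x => hess f x i j).
Proof. by case=> _ _ df i j; under eq_fun do rewrite mxE; exact: df. Qed.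

Lemma continuous_twice_cont_diff f : twice_cont_diff f -> continuous f.
Proof. by case=> df _ _ x; exact: differentiable_continuous. Qed.

Lemma hess_estE p Ft x z i j : hess_est p Ft x z i j =
  Ft x z * (grad (logp p ^~ z) x i ord0 * grad (logp p ^~ z) x j ord0)
  + hess (Ft ^~ z) x i j + grad (Ft ^~ z) x i ord0 * grad (logp p ^~ z) x j ord0
  + Ft x z * hess (logp p ^~ z) x i j
  + grad (logp p ^~ z) x i ord0 * grad (Ft ^~ z) x j ord0.
Proof.
rewrite /hess_est; move: (grad _ x) (grad _ x) (hess _ x) (hess _ x) (Ft x z).
by move=> s g H S c; rewrite !(mxE, big_ord1).
Qed.

Lemma continuous_hess_est p Ft z : twice_cont_diff (Ft ^~ z) ->
  twice_cont_diff (logp p ^~ z) -> forall i j, continuous (fun x => hess_est p Ft x z i j).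
Proof.
move=> dF dp i j; under eq_fun do rewrite hess_estE.
have cF := continuous_twice_cont_diff dF.
have cg := continuous_grad dF; have cs := continuous_grad dp.
have cH := continuous_hess dF; have cS := continuous_hess dp.
apply: continuous_addr; last by apply: continuous_mulr; [exact: cs|exact: cg].
apply: continuous_addr; last by apply: continuous_mulr; [exact: cF|exact: cS].
apply: continuous_addr; last by apply: continuous_mulr; [exact: cg|exact: cs].
apply: continuous_addr; last exact: cH.
by apply: continuous_mulr; [exact: cF|apply: continuous_mulr; exact: cs].
Qed.

Lemma measurable_hess_est p Ft x : measurable_z Ft -> measurable_z (logp p) ->
  forall i j, measurable_fun setT (fun z => hess_est p Ft x z i j).
Proof.
move=> /(_ x)[mF mg mH] /(_ x)[_ ms mS] i j; under eq_fun do rewrite hess_estE.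
apply: measurable_funD; last by apply: measurable_funM; [exact: ms|exact: mg].
apply: measurable_funD; last by apply: measurable_funM; [exact: mF|exact: mS].
apply: measurable_funD; last by apply: measurable_funM; [exact: mg|exact: ms].
apply: measurable_funD; last exact: mH.
by apply: measurable_funM; [exact: mF|apply: measurable_funM; exact: ms].
Qed.

Lemma mulmx_outer (s t u : 'cV[R]_n) : s *m t^T *m u = dotv t u *: s.
Proof.
apply/matrixP => i j; rewrite ord1 -mulmxA !mxE big_ord1 mulrC; congr (_ * _).
by rewrite mxE; apply: eq_bigr => k _; rewrite mxE.
Qed.

(** The four summands whose squared norms are bounded separately; the two cross
    products of gradients count as one, which produces the constants of [hess_bound]. *)
Lemma hess_est_form_mulmx (c : R) (s g u : 'cV[R]_n) (H S : 'M[R]_n) :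
  (c *: (s *m s^T) + H + g *m s^T + c *: S + s *m g^T) *m u =
  (c * dotv s u) *: s + H *m u + (dotv s u *: g + dotv g u *: s) + c *: (S *m u).
Proof.
rewrite !mulmxDl -!scalemxAl !mulmx_outer scalerA.
by rewrite -!addrA; congr (_ + (_ + (_ + _))); rewrite addrC.
Qed.

(** The mixed term [|g|^2 |s|^2] is replaced by [(|g|^4 + |s|^4) / 2], so that the
    score [s] enters only through its fourth power, the moment that is controlled. *)
Lemma hess_est_form_sqr (c : R) (s g u : 'cV[R]_n) (H S : 'M[R]_n) (B GF LF : R) :
  `|c| <= B -> enorm g <= GF -> specnorm H <= LF ->
  enorm ((c *: (s *m s^T) + H + g *m s^T + c *: S + s *m g^T) *m u) ^+ 2 <=
    (4 * B ^+ 2 + 8) * enorm u ^+ 2 * enorm s ^+ 4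
    + (4 * LF ^+ 2 + 8 * GF ^+ 4) * enorm u ^+ 2 + 4 * B ^+ 2 * enorm (S *m u) ^+ 2.
Proof.
move=> hB hG hL; rewrite hess_est_form_mulmx.
apply: le_trans (enormD4_sqr _ _ _ _) _.
have B0 : 0 <= B by exact: le_trans hB.
have G0 : 0 <= GF by apply: le_trans hG; exact: enorm_ge0.
have L0 : 0 <= LF by apply: le_trans hL; exact: specnorm_ge0.
have s0 := enorm_ge0 s; have u0 := enorm_ge0 u; have g0 := enorm_ge0 g.
have sq (a b : R) : 0 <= a -> a <= b -> a ^+ 2 <= b ^+ 2.
  by move=> a0 ab; rewrite ler_pXn2r// nnegrE//; exact: le_trans ab.
have h1 : enorm ((c * dotv s u) *: s) ^+ 2 <= (B * enorm s ^+ 2 * enorm u) ^+ 2.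
  apply: sq; first exact: enorm_ge0.
  rewrite enormZ normrM (_ : B * _ * _ = B * (enorm s * enorm u) * enorm s); last by ring.
  by rewrite ler_wpM2r// ler_pM// norm_dotv_le.
have h2 : enorm (H *m u) ^+ 2 <= (LF * enorm u) ^+ 2.
  apply: sq; first exact: enorm_ge0.
  by apply: le_trans (enorm_mulmx_le _ _) _; rewrite ler_wpM2r.
have h3 : enorm (dotv s u *: g + dotv g u *: s) ^+ 2 <= (2 * (enorm s * GF * enorm u)) ^+ 2.
  apply: sq; first exact: enorm_ge0.
  apply: le_trans (enormD _ _) _; rewrite !enormZ mulr_natl mulr2n.
  apply: lerD.
    rewrite mulrAC; apply: le_trans (ler_wpM2l (normr_ge0 _) hG) _.
    by rewrite ler_wpM2r// norm_dotv_le.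
  rewrite -mulrA [leRHS]mulrC ler_wpM2r//.
  by apply: le_trans (norm_dotv_le _ _) _; rewrite ler_wpM2r.
have h4 : enorm (c *: (S *m u)) ^+ 2 <= B ^+ 2 * enorm (S *m u) ^+ 2.
  rewrite -exprMn; apply: sq; first exact: enorm_ge0.
  by rewrite enormZ ler_wpM2r// enorm_ge0.
have h3' : (2 * (enorm s * GF * enorm u)) ^+ 2 <= 2 * (enorm s ^+ 4 + GF ^+ 4) * enorm u ^+ 2.
  rewrite (_ : (2 * _) ^+ 2 = 2 * (2 * enorm s ^+ 2 * GF ^+ 2) * enorm u ^+ 2); last by ring.
  rewrite ler_wpM2r ?sqr_ge0// ler_wpM2l//.
  have := sqr_ge0 (enorm s ^+ 2 - GF ^+ 2); rewrite -subr_ge0; congr (0 <= _); ring.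
have -> : (4 * B ^+ 2 + 8) * enorm u ^+ 2 * enorm s ^+ 4
    + (4 * LF ^+ 2 + 8 * GF ^+ 4) * enorm u ^+ 2 + 4 * B ^+ 2 * enorm (S *m u) ^+ 2 =
    4 * ((B * enorm s ^+ 2 * enorm u) ^+ 2 + (LF * enorm u) ^+ 2 +
     2 * (enorm s ^+ 4 + GF ^+ 4) * enorm u ^+ 2 + B ^+ 2 * enorm (S *m u) ^+ 2) by ring.
rewrite ler_wpM2l//; apply: lerD h4; apply: lerD (le_trans h3 h3').
exact: lerD.
Qed.

End Estimators.

(** The bound on the Hessian of the objective that appears in the convergence rate. *)
Definition hess_bound {R : realType} (B G L : R) : R :=
  Num.sqrt (4 * B ^+ 2 * G ^+ 4 + 16 * G ^+ 4 + 4 * L ^+ 2 + 4 * B ^+ 2 * L ^+ 2).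

Lemma hess_bound_sqr {R : realType} (B G L : R) : hess_bound B G L ^+ 2 =
  4 * B ^+ 2 * G ^+ 4 + 16 * G ^+ 4 + 4 * L ^+ 2 + 4 * B ^+ 2 * L ^+ 2.
Proof.
have G4 : 0 <= G ^+ 4 by rewrite (exprM G 2 2) sqr_ge0.
rewrite /hess_bound sqr_sqrtr//; apply: addr_ge0; last first.
  by apply: mulr_ge0; [apply: mulr_ge0 => //|]; exact: sqr_ge0.
apply: addr_ge0; last by apply: mulr_ge0 => //; exact: sqr_ge0.
apply: addr_ge0; last exact: mulr_ge0.
by apply: mulr_ge0 => //; apply: mulr_ge0 => //; exact: sqr_ge0.
Qed.

Section EstimatorMoments.
Context {R : realType} {n : nat} {dZ : measure_display} {Z : measurableType dZ}
  (mu : {sigma_finite_measure set Z -> \bar R}) (p Ft : 'cV[R]_n -> Z -> R)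
  (F : 'cV[R]_n -> R) (x : 'cV[R]_n).
Context (p_dens : is_density mu (p x)) (Ft_meas : measurable_z Ft)
  (logp_meas : measurable_z (logp p)).

Lemma density_ge0 z : 0 <= p x z. Proof. by case: p_dens. Qed.

Lemma density_measurable : measurable_fun setT (p x). Proof. by case: p_dens. Qed.

Lemma density_mass : density_measure_measure mu density_ge0 density_measurable setT = 1%E.
Proof. by case: p_dens. Qed.

Lemma Ez_density_measure (f : Z -> R) : measurable_fun setT f ->
  Ez mu p x f = (\int[density_measure_measure mu density_ge0 density_measurable]_z (f z)%:E)%E.
Proof. by move=> mf; rewrite integral_density. Qed.

(** In the applications [g] involves a spectral norm, the supremum of an uncountable
    family. *)
Lemma Ez_le_nonmeasurable (f g : Z -> R) : (forall z, 0 <= f z <= g z) ->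
  (Ez mu p x f <= Ez mu p x g)%E.
Proof.
move=> fg; apply: ge0_le_integral_nonmeasurable => z; have /andP[f0 fgz] := fg z.
  by rewrite lee_fin mulr_ge0// density_ge0.
by rewrite lee_fin ler_wpM2r// density_ge0.
Qed.

Lemma mulmx_coord_measurable (M : Z -> 'M[R]_n) (u : 'cV[R]_n) :
  (forall i j, measurable_fun setT (fun z => M z i j)) ->
  forall i, measurable_fun setT (fun z => (M z *m u) i ord0).
Proof.
move=> mM i; under eq_fun do rewrite mxE.
by apply: measurable_sum => j; apply: measurable_funM.
Qed.

(** The bound is proved for a unit vector, where only monotonicity relates the measurable
    integrand to the spectral norm, and then rescaled; pulling the scalar out of the
    integral of the spectral norm would require its measurability. *)
Lemma hess_logp_mulmx_moment (Lp : R) u :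
  (Ez mu p x (fun z => specnorm (hess (logp p ^~ z) x) ^+ 2)%R <= (Lp ^+ 2)%:E)%E ->
  (Ez mu p x (fun z => enorm (hess (logp p ^~ z) x *m u) ^+ 2)%R <=
     (Lp ^+ 2 * enorm u ^+ 2)%:E)%E.
Proof.
move=> hLp; have [u0|u0] := eqVneq (enorm u) 0.
  rewrite /Ez integral0_eq => [|z _]; first exact: mulr_ge0 (sqr_ge0 _) (sqr_ge0 _).
  by rewrite (enorm_eq0 u0) mulmx0 enorm0 expr0n mul0r.
have {}u0 : 0 < enorm u by rewrite lt_neqAle eq_sym u0 enorm_ge0.
pose v := (enorm u)^-1 *: u.
have v1 : enorm v = 1.
  by rewrite enormZ ger0_norm ?invr_ge0 ?enorm_ge0// mulVf ?gt_eqF.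
have mS : measurable_fun setT (fun z => enorm (hess (logp p ^~ z) x *m v) ^+ 2).
  by apply: measurable_sqr_enorm; apply: mulmx_coord_measurable; case: (logp_meas x).
have uv : (Ez mu p x (fun z => enorm (hess (logp p ^~ z) x *m u) ^+ 2)%R =
  (enorm u ^+ 2)%:E * Ez mu p x (fun z => enorm (hess (logp p ^~ z) x *m v) ^+ 2)%R)%E.
  rewrite /Ez -ge0_integralZl//; last 3 first.
  - by apply/measurable_EFinP; apply: measurable_funM => //; exact: density_measurable.
  - by move=> z _; rewrite lee_fin mulr_ge0 ?sqr_ge0// density_ge0.
  - by rewrite lee_fin sqr_ge0.
  apply: eq_integral => z _; rewrite -EFinM mulrA; congr (_ * _)%:E.
  rewrite -exprMn /v -scalemxAr enormZ ger0_norm ?invr_ge0 ?enorm_ge0//.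
  by rewrite mulrA divff ?mul1r ?gt_eqF.
rewrite uv (mulrC (Lp ^+ 2)) [leRHS]EFinM; apply: lee_wpmul2l; first by rewrite lee_fin sqr_ge0.
apply: le_trans hLp; apply: Ez_le_nonmeasurable => z; rewrite sqr_ge0/=.
by rewrite ler_pXn2r// ?nnegrE ?enorm_ge0 ?specnorm_ge0// specnorm_ge// v1.
Qed.

Context (B GF Gp LF Lp : R) (Gp_ge0 : 0 <= Gp) (Lp_ge0 : 0 <= Lp)
  (Ft_bound : forall z, `|Ft x z| <= B)
  (gradFt_bound : forall z, enorm (grad (Ft ^~ z) x) <= GF)
  (gradp_bound : (Ez mu p x (fun z => enorm (grad (logp p ^~ z) x) ^+ 4)%R <= (Gp ^+ 4)%:E)%E)
  (hessFt_bound : forall z, specnorm (hess (Ft ^~ z) x) <= LF)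
  (hessp_bound : (Ez mu p x (fun z => specnorm (hess (logp p ^~ z) x) ^+ 2)%R <= (Lp ^+ 2)%:E)%E).

Let G := Num.max GF Gp.
Let L := Num.max LF Lp.

(** Integrate the pointwise bound on the estimator against the density of the sample.
    The point [z0] witnesses that the uniform bounds are nonnegative. *)
Lemma hess_est_second_moment u (z0 : Z) :
  (Ez mu p x (fun z => enorm (hess_est p Ft x z *m u) ^+ 2)%R <=
     (hess_bound B G L ^+ 2 * enorm u ^+ 2)%:E)%E.
Proof.
have GF0 : 0 <= GF by apply: le_trans (gradFt_bound z0); exact: enorm_ge0.
have LF0 : 0 <= LF by apply: le_trans (hessFt_bound z0); exact: specnorm_ge0.
pose a z := enorm (grad (logp p ^~ z) x) ^+ 4.
pose b z := enorm (hess (logp p ^~ z) x *m u) ^+ 2.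
pose c1 := (4 * B ^+ 2 + 8) * enorm u ^+ 2.
pose c2 := (4 * LF ^+ 2 + 8 * GF ^+ 4) * enorm u ^+ 2.
pose c3 := 4 * B ^+ 2.
have sq0 (r : R) : 0 <= r ^+ 2 by exact: sqr_ge0.
have GF4 : 0 <= GF ^+ 4 by exact: exprn_ge0.
have c1_0 : 0 <= c1 by apply: mulr_ge0 => //; apply: addr_ge0 => //; exact: mulr_ge0.
have c2_0 : 0 <= c2 by apply: mulr_ge0 => //; apply: addr_ge0; exact: mulr_ge0.
have c3_0 : 0 <= c3 by exact: mulr_ge0.
have a0 z : 0 <= a z by rewrite exprn_ge0 ?enorm_ge0.
have b0 z : 0 <= b z by rewrite exprn_ge0 ?enorm_ge0.
have p0 := density_ge0; have mp := density_measurable.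
have ma : measurable_fun setT a.
  have -> : a = (fun z => (enorm (grad (logp p ^~ z) x) ^+ 2) ^+ 2).
    by apply/funext => z; rewrite /a -exprM.
  apply: measurable_funX; apply: measurable_sqr_enorm.
  by case: (logp_meas x).
have mb : measurable_fun setT b.
  by apply: measurable_sqr_enorm; apply: mulmx_coord_measurable; case: (logp_meas x).
apply: (@le_trans _ _ (Ez mu p x (fun z => c1 * a z + c2 + c3 * b z))).
  apply: Ez_le_nonmeasurable => z; rewrite sqr_ge0/=.
  exact: hess_est_form_sqr.
have -> : Ez mu p x (fun z => c1 * a z + c2 + c3 * b z) =
    (c1%:E * Ez mu p x a + c2%:E + c3%:E * Ez mu p x b)%E.
  rewrite !Ez_density_measure//; last first.
    by do 2?[apply: measurable_funD => //]; apply: measurable_funM.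
  exact: (ge0_integral_affine density_mass).
have hb := hess_logp_mulmx_moment u hessp_bound.
apply: (@le_trans _ _ (c1 * Gp ^+ 4 + c2 + c3 * (Lp ^+ 2 * enorm u ^+ 2))%:E).
  rewrite 2!EFinD !EFinM; apply: leeD; last by rewrite lee_wpmul2l ?lee_fin.
  by rewrite leeD2r// lee_wpmul2l ?lee_fin.
have gG : GF <= G by rewrite le_max lexx.
have pG : Gp <= G by rewrite le_max lexx orbT.
have lL : LF <= L by rewrite le_max lexx.
have pL : Lp <= L by rewrite le_max lexx orbT.
have pow (r s : R) k : 0 <= r -> r <= s -> r ^+ k <= s ^+ k.
  by move=> r0 rs; apply: lerXn2r => //; rewrite nnegrE//; exact: le_trans rs.
rewrite lee_fin hess_bound_sqr.
rewrite /c1 /c2 /c3.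
rewrite (_ : _ + _ = (4 * B ^+ 2 * Gp ^+ 4 + (8 * Gp ^+ 4 + 8 * GF ^+ 4) + 4 * LF ^+ 2
   + 4 * B ^+ 2 * Lp ^+ 2) * enorm u ^+ 2); last by ring.
rewrite ler_wpM2r ?sqr_ge0// !lerD//.
- by apply: ler_wpM2l; [exact: mulr_ge0|exact: pow].
- have := pow _ _ 4%N GF0 gG; have := pow _ _ 4%N Gp_ge0 pG; lra.
- by rewrite ler_wpM2l// pow.
- by apply: ler_wpM2l; [exact: mulr_ge0|exact: pow].
Qed.

Context (grad_unbiased : forall i,
     Ez mu p x (fun z => grad (Ft ^~ z) x i ord0) = (grad F x i ord0)%:E)
  (hess_unbiased : forall i j,
     Ez mu p x (fun z => hess_est p Ft x z i j) = (hess F x i j)%:E).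

(** Jensen's inequality for the unbiased gradient estimator. *)
Lemma grad_objective_le (z0 : Z) : enorm (grad F x) <= GF.
Proof.
have GF0 : 0 <= GF by apply: le_trans (gradFt_bound z0); exact: enorm_ge0.
rewrite -(@ler_pXn2r _ 2)// ?nnegrE ?enorm_ge0//.
have [_ mg _] := Ft_meas x.
apply: (jensen_sqr_enorm density_mass (h := fun z => grad (Ft ^~ z) x)).
- exact: mg.
- by move=> i; rewrite -Ez_density_measure.
- apply: (@le_trans _ _ (\int[density_measure_measure mu density_ge0 density_measurable]_z (GF ^+ 2)%:E)%E).
    apply: ge0_le_integral_nonmeasurable => z; rewrite lee_fin ?sqr_ge0//.
    by rewrite ler_pXn2r ?nnegrE ?enorm_ge0.
  by rewrite (integral_cst _ _ (GF ^+ 2)%:E)// density_mass mule1.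
Qed.

Lemma hess_est_mulmx_unbiased (c : R) (u : 'cV[R]_n) (i : 'I_n) :
  Ez mu p x (fun z => c * (hess_est p Ft x z *m u) i ord0) =
  (c * (hess F x *m u) i ord0)%:E.
Proof.
have mh := measurable_hess_est x Ft_meas logp_meas.
have ih j := integrable_of_fin_integral (mh i j)
    (etrans (esym (Ez_density_measure (mh i j))) (hess_unbiased i j)).
have mhu := mulmx_coord_measurable u mh.
rewrite Ez_density_measure; last exact: measurable_funM.
have E z : (c * (hess_est p Ft x z *m u) i ord0)%:E =
    (\sum_j (c * u j ord0)%:E * (hess_est p Ft x z i j)%:E)%E.
  rewrite mxE mulr_sumr -sumEFin; apply: eq_bigr => j _.
  by rewrite -EFinM -mulrA (mulrC (u j ord0)).
under eq_integral do rewrite E.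
rewrite integral_sum//; last first.
  by move=> j; exact: (integrableZl measurableT (c * u j ord0) (ih j)).
rewrite mxE mulr_sumr -sumEFin; apply: eq_bigr => j _.
rewrite integralZl//; last exact: ih.
by rewrite -Ez_density_measure// hess_unbiased -EFinM -mulrA (mulrC (u j ord0)).
Qed.

Lemma grad_est_unbiased (c : R) (i : 'I_n) :
  Ez mu p x (fun z => c * grad (Ft ^~ z) x i ord0) = (c * grad F x i ord0)%:E.
Proof.
have [_ mg _] := Ft_meas x.
have ig := integrable_of_fin_integral (mg i)
    (etrans (esym (Ez_density_measure (mg i))) (grad_unbiased i)).
rewrite Ez_density_measure; last exact: measurable_funM.
under eq_integral do rewrite EFinM.
by rewrite integralZl// -Ez_density_measure// grad_unbiased -EFinM.
Qed.

(** Jensen's inequality for the unbiased Hessian estimator: the smoothness of the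
    objective is inherited from the second moment of its estimator. *)
Lemma hess_objective_le (z0 : Z) u :
  enorm (hess F x *m u) <= hess_bound B G L * enorm u.
Proof.
rewrite -(@ler_pXn2r _ 2)// ?nnegrE ?mulr_ge0 ?enorm_ge0 ?sqrtr_ge0// exprMn.
have mh := measurable_hess_est x Ft_meas logp_meas.
have mhu := mulmx_coord_measurable u mh.
apply: (jensen_sqr_enorm density_mass (h := fun z => hess_est p Ft x z *m u)) => //.
- move=> i; rewrite -Ez_density_measure//.
  rewrite -[X in _ = X%:E]mul1r -hess_est_mulmx_unbiased.
  by congr Ez; apply/funext => z; rewrite mul1r.
- rewrite -Ez_density_measure; first exact: hess_est_second_moment.
  exact: measurable_sqr_enorm.
Qed.

End EstimatorMoments.

(** * The Hessian averaged over a segment *)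

Section AveragedHessian.
Context {R : realType} {n : nat}.
Implicit Types (f : 'cV[R]_n -> R) (x y : 'cV[R]_n).

Lemma continuous_fsum {V : topologicalType} {I : Type} (s : seq I) (g : I -> V -> R) :
  (forall i, continuous (g i)) -> continuous (fun r => \sum_(i <- s) g i r).
Proof.
move=> cg; elim: s => [|i s ih].
  by under eq_fun do rewrite big_nil; exact: cst_continuous.
under eq_fun do rewrite big_cons.
exact: continuous_addr.
Qed.

(** The fundamental theorem of calculus for the i-th partial derivative along the
    segment. The derivative involves the i-th column of the Hessian whereas the
    product [hess f *m _] involves its i-th row: this is where the symmetry of the
    Hessian is needed. The uniform density encodes the interval of integration. *)
Lemma averaged_hessian f (f_C2 : twice_cont_diff f) x y i (c : R) :
  (\int[lebesgue_measure]_r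
     ((c * (hess f (r *: x + (1 - r) *: y) *m (x - y)) i ord0) * uniform_pdf 0 1 r)%:E
   = (c * (grad f x i ord0 - grad f y i ord0))%:E)%E.
Proof.
set u := x - y.
pose g r := c * dotv (delta_mx i ord0) (grad f (y + r *: u)).
pose dg r := c * \sum_j hess f (y + r *: u) i j * u j ord0.
have gd (r : R) : is_derive r 1 g (dg r).
  have -> : dg r = c *: dotv u (hess f (y + r *: u) *m delta_mx i ord0).
    rewrite /dg dotv_mulmx; congr (_ * _); apply: eq_bigr => j _.
    rewrite (bigD1 i)//= big1 ?addr0 => [|k ki].
      by rewrite [delta_mx _ _ _ _]mxE !eqxx mulr1 mulrC (hess_sym f_C2).
    by rewrite [delta_mx _ _ _ _]mxE (negbTE ki) !mulr0.
  apply: is_deriveZ; apply: is_derive_line_grad.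
  by case: f_C2.
have cg r : {for r, continuous g}.
  by apply/differentiable_continuous/derivable1_diffP; case: (gd r).
have cdg : continuous dg.
  apply: continuous_mulr; first exact: cst_continuous.
  apply: continuous_fsum => j; apply: continuous_mulr; last exact: cst_continuous.
  move=> r; apply: (@continuous_comp _ _ _ (fun r : R => y + r *: u) (fun q => hess f q i j)).
    by apply: cvgD; [exact: cvg_cst|apply: cvgZr_tmp; exact: cvg_id].
  exact: (continuous_hess f_C2).
transitivity ((\int[lebesgue_measure]_(r in `[0%R, 1%R]) (dg r)%:E)%E).
  rewrite [RHS]integral_mkcond; apply: eq_integral => r _.
  rewrite patchE /uniform_pdf; case: ifPn => r01; last first.
    case: ifPn => //; last by rewrite mulr0.
    by rewrite inE /= in_itv/= (negbTE r01).
  rewrite ifT; last by rewrite inE/= in_itv.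
  rewrite subr0 invr1 mulr1; congr (c * _)%:E.
  have -> : r *: x + (1 - r) *: y = y + r *: u.
    by rewrite /u scalerBr scalerBl scale1r addrCA addrA.
  by rewrite mxE.
rewrite (@continuous_FTC2 _ _ g)//.
- rewrite /g scale1r scale0r addr0 /u subrKC -EFinB -mulrBr.
  by rewrite !(dotvC (delta_mx _ _)) !dotv_delta.
- exact: continuous_subspaceT.
- split.
  + by move=> r _; case: (gd r).
  + by apply: cvg_at_right_filter; exact: cg.
  + by apply: cvg_at_left_filter; exact: cg.
- by move=> r _; rewrite derive1E; case: (gd r).
Qed.

End AveragedHessian.

(** * Square-integrable random variables and vectors *)

Section SquareIntegrable.
Context {d : measure_display} {T : measurableType d} {R : realType} (P : probability T R).
Implicit Types (f g h : T -> R).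

Definition integ f := P.-integrable setT (EFin \o f).

Definition expect f : R := (\int[P]_w f w)%R.

Lemma integ_measurable f : integ f -> measurable_fun setT f.
Proof. by move/measurable_int/measurable_EFinP. Qed.

Lemma expectE f : integ f -> (\int[P]_w (f w)%:E = (expect f)%:E)%E.
Proof. by move=> fi; rewrite fineK//; exact: integrable_fin_num. Qed.

Lemma integ_cst (r : R) : integ (fun=> r).
Proof. by apply: finite_measure_integrable_cst. Qed.

Lemma integD f g : integ f -> integ g -> integ (fun w => f w + g w).
Proof. by move=> fi gi; exact: (integrableD measurableT fi gi). Qed.

Lemma integZ (r : R) f : integ f -> integ (fun w => r * f w).
Proof. by move=> fi; exact: (integrableZl measurableT r fi). Qed.

Lemma expectD f g : integ f -> integ g ->
  expect (fun w => f w + g w) = expect f + expect g.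
Proof. by move=> fi gi; rewrite /expect RintegralD. Qed.

Lemma expectZ (r : R) f : integ f -> expect (fun w => r * f w) = r * expect f.
Proof. by move=> fi; rewrite /expect RintegralZl. Qed.

Lemma expect_cst (r : R) : expect (fun=> r) = r.
Proof.
rewrite /expect Rintegral_cst//. rewrite -[RHS]mulr1; congr (_ * _).
by rewrite -[RHS]/(fine 1%E); congr fine; exact: probability_setT.
Qed.

Lemma integ_le_ae f g : measurable_fun setT f -> integ g ->
  {ae P, forall w, `|f w| <= g w} -> integ f.
Proof.
move=> mf gi fg; apply/integrableP; split; first exact/measurable_EFinP.
have mg := integ_measurable gi.
case/integrableP : (gi) => _; apply: le_lt_trans.
apply: ae_ge0_le_integral => //.
- by apply: measurableT_comp => //; exact/measurable_EFinP.
- by apply: measurableT_comp => //; exact/measurable_EFinP.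
- by apply: filterS fg => w fgw _ /=; rewrite lee_fin (le_trans fgw)// ler_norm.
Qed.

Lemma integ_le f g : measurable_fun setT f -> integ g ->
  (forall w, `|f w| <= g w) -> integ f.
Proof. by move=> mf gi fg; apply: integ_le_ae gi _ => //; exact: aeW. Qed.

Lemma integ_norm f : integ f -> integ (fun w => `|f w|).
Proof. by move=> fi; exact: (integrable_abse fi). Qed.

Lemma expect_le f g : integ f -> integ g -> (forall w, f w <= g w) ->
  expect f <= expect g.
Proof. by move=> fi gi fg; apply: le_Rintegral => // w _. Qed.

(** The larger function is modified to the maximum of the two, which changes it only on
    a negligible set. *)
Lemma expect_le_ae f g : integ f -> integ g -> {ae P, forall w, f w <= g w} ->
  expect f <= expect g.
Proof.
move=> fi gi fg; pose h w := Num.max (f w) (g w).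
have mf := integ_measurable fi; have mg := integ_measurable gi.
have mh : measurable_fun setT h by exact: measurable_maxr.
have hi : integ h.
  apply: (integ_le mh (integD (integ_norm fi) (integ_norm gi))) => w /=.
  have fn := normr_ge0 (f w); have gn := normr_ge0 (g w).
  by rewrite /h; case: (leP (f w) (g w)) => _; rewrite ?lerDl ?lerDr.
apply: (@le_trans _ _ (expect h)).
  by apply: expect_le => // w; rewrite /h le_max lexx.
suff -> : expect h = expect g by [].
rewrite /expect /Rintegral; congr fine.
apply: ae_eq_integral => //; try exact/measurable_EFinP.
by apply: filterS fg => w fgw _; rewrite /h max_r.
Qed.

Lemma expect_ge0 f : (forall w, 0 <= f w) -> 0 <= expect f.
Proof. by move=> f0; apply: Rintegral_ge0. Qed.

Lemma integ_sum n (f : 'I_n -> T -> R) : (forall i, integ (f i)) ->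
  integ (fun w => \sum_i f i w).
Proof.
move=> fi; rewrite /integ (_ : EFin \o _ = fun w => (\sum_i (f i w)%:E)%E).
  apply: (@integrable_sum _ _ _ P setT measurableT _ _ xpredT (fun i w => (f i w)%:E)).
  by move=> i _; exact: fi.
by apply/funext => w /=; rewrite sumEFin.
Qed.

Lemma expect_sum n (f : 'I_n -> T -> R) : (forall i, integ (f i)) ->
  expect (fun w => \sum_i f i w) = \sum_i expect (f i).
Proof.
move=> fi; apply: EFin_inj; rewrite -expectE; last exact: integ_sum.
under eq_integral do rewrite -sumEFin.
rewrite integral_sum// -sumEFin; apply: eq_bigr => i _.
exact: expectE.
Qed.

Definition sqint f := measurable_fun setT f /\ integ (fun w => f w ^+ 2).

Lemma sqintM f g : sqint f -> sqint g -> integ (fun w => f w * g w).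
Proof.
move=> [mf fi] [mg gi].
apply: (integ_le _ (integD fi gi)); first exact: measurable_funM.
move=> w; rewrite normrM -(real_normK (num_real (f w))) -(real_normK (num_real (g w))).
have := sqr_ge0 (`|f w| - `|g w|); have := sqr_ge0 (`|f w|); have := sqr_ge0 (`|g w|).
by move: (`|f w|) (`|g w|); clear; move=> a b; lra.
Qed.

Lemma sqint_le f h : measurable_fun setT f -> integ h ->
  {ae P, forall w, f w ^+ 2 <= h w} -> sqint f.
Proof.
move=> mf hi fh; split => //; apply: (integ_le_ae _ hi).
  exact: measurable_funX.
by apply: filterS fh => w; rewrite ger0_norm ?sqr_ge0.
Qed.

Lemma sqint_bounded f (c : R) : measurable_fun setT f ->
  {ae P, forall w, `|f w| <= c} -> sqint f.
Proof.
move=> mf fc; apply: (sqint_le mf (integ_cst (c ^+ 2))).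
apply: filterS fc => w fw; rewrite -real_normK ?num_real//.
by rewrite ler_pXn2r// nnegrE//; exact: le_trans fw.
Qed.

Lemma sqintD f g : sqint f -> sqint g -> sqint (fun w => f w + g w).
Proof.
move=> [mf fi] [mg gi].
apply: (sqint_le _ (integD (integZ 2 fi) (integZ 2 gi))); first exact: measurable_funD.
apply: aeW => w; have := sqr_ge0 (f w - g w).
by move: (f w) (g w); clear; move=> a b; lra.
Qed.

Lemma sqintZ (r : R) f : sqint f -> sqint (fun w => r * f w).
Proof.
move=> [mf fi]; apply: (sqint_le _ (integZ (r ^+ 2) fi)); first exact: measurable_funM.
by apply: aeW => w; rewrite exprMn.
Qed.

Context {n : nat}.
Implicit Types (u v : T -> 'cV[R]_n).

Definition vsqint u := forall i, sqint (fun w => u w i ord0).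

Lemma vsqintD u v : vsqint u -> vsqint v -> vsqint (fun w => u w + v w).
Proof. by move=> us vs i; under eq_fun do rewrite mxE; exact: sqintD. Qed.

Lemma vsqintZ (r : R) u : vsqint u -> vsqint (fun w => r *: u w).
Proof. by move=> us i; under eq_fun do rewrite mxE; exact: sqintZ. Qed.

Lemma vsqintB u v : vsqint u -> vsqint v -> vsqint (fun w => u w - v w).
Proof.
move=> us vs; under eq_fun do rewrite -scaleN1r.
by apply: vsqintD => //; exact: vsqintZ.
Qed.

Lemma vsqint_bounded u (c : R) : (forall i, measurable_fun setT (fun w => u w i ord0)) ->
  {ae P, forall w, enorm (u w) <= c} -> vsqint u.
Proof.
move=> mu uc i; apply: (sqint_bounded (c := c)) => //.
by apply: filterS uc => w; apply: le_trans; exact: norm_coord_le.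
Qed.

Lemma integ_dotv u v : vsqint u -> vsqint v -> integ (fun w => dotv (u w) (v w)).
Proof. by move=> us vs; apply: integ_sum => i; exact: sqintM. Qed.

Lemma integ_sqr_enorm u : vsqint u -> integ (fun w => enorm (u w) ^+ 2).
Proof. by move=> us; under eq_fun do rewrite enorm_sqr; exact: integ_dotv. Qed.

Lemma vsqint_of_integ u : (forall i, measurable_fun setT (fun w => u w i ord0)) ->
  integ (fun w => enorm (u w) ^+ 2) -> vsqint u.
Proof.
move=> mu ui i; apply: (sqint_le _ ui) => //; apply: aeW => w.
rewrite -real_normK ?num_real// ler_pXn2r ?nnegrE ?enorm_ge0//.
exact: norm_coord_le.
Qed.

Lemma expect_dotv u v : vsqint u -> vsqint v ->
  expect (fun w => dotv (u w) (v w)) = \sum_i expect (fun w => u w i ord0 * v w i ord0).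
Proof. by move=> us vs; apply: expect_sum => i; exact: sqintM. Qed.

End SquareIntegrable.

(** * The sigma-algebras of the past *)

Notation meas_wrt G f := (@measurable_fun _ _ (g_sigma_algebraType G) _ setT f).

Section SubSigmaAlgebra.
Context {d : measure_display} {Omega : measurableType d}.

(** The inclusion is into the generated sigma-algebra, so that it can be checked on
    generators. *)
Lemma meas_wrt_sub (G G' : set (set Omega)) d' (U : measurableType d') (f : Omega -> U) :
  G `<=` <<s G' >> -> meas_wrt G f -> meas_wrt G' f.
Proof.
move=> GG' mf _ A mA; have := mf measurableT A mA.
by apply: smallest_sub => //; exact: smallest_sigma_algebra.
Qed.

Lemma meas_wrt_measurable (G : set (set Omega)) d' (U : measurableType d') (f : Omega -> U) :
  G `<=` measurable -> meas_wrt G f -> measurable_fun setT f.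
Proof.
move=> Gm mf _ A mA; have := mf measurableT A mA.
by apply: smallest_sub => //; exact: sigma_algebra_measurable.
Qed.

Lemma meas_wrt_preimage (G : set (set Omega)) d' (U : measurableType d') (f : Omega -> U) :
  preimage_set_system setT f measurable `<=` <<s G>> -> meas_wrt G f.
Proof. by move=> fG _ A mA; apply: fG; exists A. Qed.

Lemma measurable_id_sub (G : set (set Omega)) : G `<=` measurable ->
  @measurable_fun _ _ Omega (g_sigma_algebraType G) setT id.
Proof.
move=> Gm _ A; rewrite setTI preimage_id.
by apply: smallest_sub => //; exact: sigma_algebra_measurable.
Qed.

End SubSigmaAlgebra.

Section Past.
Context {R : realType} {n : nat} {dO dZ : measure_display} {Omega : measurableType dO}
  {Z : measurableType dZ} (a : nat -> Omega -> R) (z : nat -> Omega -> Z)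
  (v : nat -> Omega -> 'cV[R]_n).

Lemma past_sigma_algebra t : <<s past a z v t >> = past a z v t.
Proof. by apply: sigma_algebra_id; exact: smallest_sigma_algebra. Qed.

Lemma past_and_a_sigma_algebra t : <<s past_and_a a z v t >> = past_and_a a z v t.
Proof. by apply: sigma_algebra_id; exact: smallest_sigma_algebra. Qed.

Lemma past_z s t : (1 <= s < t)%N -> meas_wrt (past a z v t) (z s).
Proof.
move=> st; apply: meas_wrt_preimage; rewrite past_sigma_algebra => E zE.
by apply: sub_sigma_algebra; left; exists s => //; left.
Qed.

Lemma past_v s t i : (1 <= s < t)%N -> meas_wrt (past a z v t) (fun w => v s w i ord0).
Proof.
move=> st; apply: meas_wrt_preimage; rewrite past_sigma_algebra => E zE.
by apply: sub_sigma_algebra; left; exists s => //; right; exists i.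
Qed.

Lemma past_mono s t : (s <= t)%N -> past a z v s `<=` past a z v t.
Proof.
move=> st; apply: smallest_sub; first exact: smallest_sigma_algebra.
move=> E [[r /= /andP[r1 rs] h]|[r /= /andP[r1 rs] h]]; apply: sub_sigma_algebra; [left|right].
  by exists r => //=; rewrite r1 (leq_trans rs).
by exists r => //=; rewrite r1 (leq_trans rs).
Qed.

Lemma past_sub_and_a t : past a z v t `<=` past_and_a a z v t.
Proof. by move=> E pE; apply: sub_sigma_algebra; left. Qed.

Lemma past_and_a_a t : meas_wrt (past_and_a a z v t) (a t).
Proof.
apply: meas_wrt_preimage; rewrite past_and_a_sigma_algebra => E zE.
by apply: sub_sigma_algebra; right.
Qed.

Lemma past_measurable t : (forall s, (1 <= s < t)%N -> measurable_fun setT (z s)) ->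
  (forall s i, (1 <= s < t)%N -> measurable_fun setT (fun w => v s w i ord0)) ->
  (forall s, (2 <= s < t)%N -> measurable_fun setT (a s)) ->
  past a z v t `<=` measurable.
Proof.
move=> mz mv ma; apply: smallest_sub; first exact: sigma_algebra_measurable.
move=> E [[s /= st [|[i _]] [A mA <-]]|[s /= st [A mA <-]]].
- exact: mz.
- exact: mv.
- exact: ma.
Qed.

Lemma past_and_a_measurable t : past a z v t `<=` measurable ->
  measurable_fun setT (a t) -> past_and_a a z v t `<=` measurable.
Proof.
move=> pm ma; apply: smallest_sub; first exact: sigma_algebra_measurable.
by move=> E [/pm//|[A mA <-]]; exact: ma.
Qed.

End Past.
(** * Arithmetic of the rates *)

Section RateArithmetic.
Context {R : realType}.
Implicit Types (C m A Ap Q b : R).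

(** With [S m = m^2 A], the recursion adds at most [C / 2] from the variance, [C / 32]
    from the scale of the bias and [3 C / 16] from its coupling with the previous error,
    which leaves room below the slope [3 C / 4] of the induction hypothesis. *)
Lemma moment_recursion_step C m A (Ap : R) Q b : 2 <= m ->
  m ^+ 2 * A <= (m - 1) ^+ 2 * Ap + Q + (m - 1) / (2 * m) * (Ap + b) ->
  2 * Q <= C -> 16 * b <= C -> 0 <= b ->
  4 * ((m - 1) ^+ 2 * Ap) <= C * (3 * (m - 1) - 1) ->
  4 * (m ^+ 2 * A) <= C * (3 * m - 1).
Proof.
move=> m2 hA hQ hb b0 hAp.
have C0 : 0 <= C by lra.
have m0 : 0 < m by lra.
have k0 : 0 < m - 1 by lra.
have kAp : (m - 1) * Ap <= 3 / 4 * C.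
  rewrite -(ler_pM2l k0); nra.
have q0 : 0 <= (2 * m)^-1 by rewrite invr_ge0; lra.
have q1 : (2 * m)^-1 <= 4^-1 by rewrite lef_pV2 ?posrE; lra.
have h1 : (m - 1) / (2 * m) * Ap <= 4^-1 * (3 / 4 * C).
  rewrite mulrAC mulrC; apply: (@le_trans _ _ ((2 * m)^-1 * (3 / 4 * C))).
    exact: ler_wpM2l.
  apply: ler_wpM2r => //; lra.
have h2 : (m - 1) / (2 * m) * b <= 2^-1 * b.
  apply: ler_wpM2r => //; rewrite ler_pdivrMr; lra.
rewrite mulrDr in hA; nra.
Qed.

(** [(3 m - 1) (m + 1) <= 4 m^2] is [0 <= (m - 1)^2]. *)
Lemma rate_of_moment C m A : 1 <= m -> 0 <= C ->
  4 * (m ^+ 2 * A) <= C * (3 * m - 1) -> A * (m + 1) <= C.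
Proof.
move=> m1 C0 h; have m0 : 0 < m ^+ 2 by rewrite exprn_gt0; lra.
rewrite -(ler_pM2l m0); have := mulr_ge0 C0 (sqr_ge0 (m - 1)).
have m10 : 0 <= m + 1 by lra.
have := ler_wpM2l m10 h; nra.
Qed.

(** [1 / sqrt (T + 1) <= 2 (sqrt (T + 1) - sqrt T)], since
    [2 sqrt T sqrt (T + 1) <= 2 T + 1]. *)
Lemma sum_inv_sqrt_le (T : nat) :
  \sum_(i < T) (Num.sqrt (i.+1%:R : R))^-1 <= 2 * Num.sqrt T%:R.
Proof.
elim: T => [|T ih]; first by rewrite big_ord0 sqrtr0 mulr0.
rewrite big_ord_recr/=; apply: le_trans (lerD ih (lexx _)) _.
set s := Num.sqrt T%:R; set r := Num.sqrt T.+1%:R.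
have s0 : 0 <= s by exact: sqrtr_ge0.
have r0 : 0 < r by rewrite sqrtr_gt0 ltr0n.
have s2 : s ^+ 2 = T%:R by rewrite sqr_sqrtr.
have r2 : r ^+ 2 = T%:R + 1 by rewrite sqr_sqrtr ?natr1.
rewrite -lerBrDl -mulrBr -(ler_pM2r r0) mulVf ?gt_eqF//.
have := sqr_ge0 (r - s); nra.
Qed.

Lemma one_minus_inv_exp_le (T : nat) : (1 <= T)%N ->
  (1 - T%:R^-1 : R) ^+ T <= expR (- 1).
Proof.
move=> T1; have T0 : (0 : R) < T%:R by rewrite ltr0n.
have -> : expR (- 1 : R) = expR (- T%:R^-1) ^+ T.
  by rewrite -expRM_natl mulrN mulfV ?gt_eqF.
apply: lerXn2r; rewrite ?nnegrE ?expR_ge0//.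
  by rewrite subr_ge0 invf_le1// ler1n.
exact: expR_ge1Dx.
Qed.

Lemma gap_recursion (f e : nat -> R) (q b : R) (T : nat) : 0 <= q <= 1 ->
  (forall t, 0 <= e t) -> 0 <= b ->
  (forall t, (t < T)%N -> f t.+1 <= q * f t + (e t + b)) ->
  f T <= q ^+ T * f 0%N + \sum_(i < T) e i + T%:R * b.
Proof.
move=> /andP[q0 q1] e0 b0; elim: T => [|T ih] hf.
  by rewrite big_ord0 expr0 mul1r mul0r !addr0.
have {}ih : f T <= q ^+ T * f 0%N + \sum_(i < T) e i + T%:R * b.
  by apply: ih => t tT; apply: hf; exact: ltnW.
apply: le_trans (hf T (ltnSn T)) _.
rewrite big_ord_recr/= exprS -natr1 mulrDl mul1r.
have s0 : 0 <= \sum_(i < T) e i by apply: sumr_ge0.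
have := ler_wpM2l q0 ih; have Tb : 0 <= T%:R * b by rewrite mulr_ge0.
move: s0 Tb; move: (\sum_(i < T) e i) (T%:R * b) (q ^+ T) (f 0%N) (f T) => S U Q f0 fT.
move=> S0 U0 h.
have := ler_wpM2r (addr_ge0 S0 U0) q1; nra.
Qed.

End RateArithmetic.

(** * Iterates, queries and the conditional laws of a run *)

Section Run.
Context {R : realType} {n : nat} {dZ : measure_display} {Z : measurableType dZ}
  (mu : {sigma_finite_measure set Z -> \bar R})
  (p Ft : 'cV[R]_n -> Z -> R) (F : 'cV[R]_n -> R)
  (p_dens : forall x, is_density mu (p x))
  (p_gt0 : forall x z, 0 < p x z)
  (F_C2 : twice_cont_diff F)
  (Ft_C2 : forall z, twice_cont_diff (Ft ^~ z))
  (logp_C2 : forall z, twice_cont_diff (logp p ^~ z))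
  (Ft_meas : measurable_z Ft)
  (logp_meas : measurable_z (logp p))
  (K : set 'cV[R]_n) (Rad : R)
  (K_convex : convex_set K) (K_0 : K 0)
  (Rad_ub : forall x, K x -> enorm x <= Rad)
  (grad_unbiased : forall x, K x -> forall i,
     Ez mu p x (fun z => grad (Ft ^~ z) x i ord0) = (grad F x i ord0)%:E)
  (hess_unbiased : forall x, K x -> forall i j,
     Ez mu p x (fun z => hess_est p Ft x z i j) = (hess F x i j)%:E)
  (B GF Gp LF Lp : R)
  (Gp_ge0 : 0 <= Gp) (Lp_ge0 : 0 <= Lp)
  (Ft_bound : forall x z, K x -> `|Ft x z| <= B)
  (gradFt_bound : forall x z, K x -> enorm (grad (Ft ^~ z) x) <= GF)
  (gradp_bound : forall x, K x ->
     (Ez mu p x (fun z => enorm (grad (logp p ^~ z) x) ^+ 4)%R <= (Gp ^+ 4)%:E)%E)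
  (hessFt_bound : forall x z, K x -> specnorm (hess (Ft ^~ z) x) <= LF)
  (hessp_bound : forall x, K x ->
     (Ez mu p x (fun z => specnorm (hess (logp p ^~ z) x) ^+ 2)%R
        <= (Lp ^+ 2)%:E)%E)
  (T : nat) (T_ge1 : (1 <= T)%N)
  {dO : measure_display} {Omega : measurableType dO} (P : probability Omega R)
  (a : nat -> {RV P >-> R}) (z : nat -> {RV P >-> Z})
  (x d v : nat -> Omega -> 'cV[R]_n)
  (run : sfw_run mu p Ft K (fun t => (t.-1)%:R^-1) (fun _ => T%:R^-1) 0 T
           a z x d v).

Let G := Num.max GF Gp.
Let L := Num.max LF Lp.
Let Lbar := hess_bound B G L.

Lemma T_gt0 : (0 : R) < T%:R. Proof. by rewrite ltr0n. Qed.

(** The iterate [x t.+1] is [1/T] times a sum of [t] points of [K], that is [t/T] times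
    their mean. *)
Lemma iterate_scaled t w : (t <= T)%N ->
  exists2 k, K k & x t.+1 w = (t%:R / T%:R) *: k.
Proof.
elim: t => [_|t ih tT].
  by exists 0 => //; rewrite (run_x1 run) mul0r scale0r.
have [k Kk xk] := ih (ltnW tT).
have [Kv _] := run_v run (t := t.+1) tT w.
exists ((t%:R / t.+1%:R) *: k + (1 - t%:R / t.+1%:R) *: v t.+1 w).
  apply: convex_combination => //.
  by rewrite divr_ge0//= ler_pdivrMr ?ltr0n// mul1r ler_nat.
have T1 : (T%:R : R) != 0 by rewrite gt_eqF ?T_gt0.
have t1 : (t%:R + 1 : R) != 0 by rewrite natr1 pnatr_eq0.
rewrite (run_x run)// xk scalerDr !scalerA -natr1; congr (_ *: _ + _ *: _).
  by field; rewrite T1 t1.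
by field; rewrite T1 t1.
Qed.

Lemma iterate_K t w : (1 <= t <= T.+1)%N -> K (x t w).
Proof.
case: t => // t /= tT; have [k Kk ->] := iterate_scaled w tT.
have -> : (t%:R / T%:R) *: k = (t%:R / T%:R) *: k + (1 - t%:R / T%:R) *: 0.
  by rewrite scaler0 addr0.
apply: convex_combination => //.
by rewrite divr_ge0//= ler_pdivrMr ?T_gt0// mul1r ler_nat.
Qed.

Lemma step_le t w : (2 <= t <= T.+1)%N -> enorm (x t w - x t.-1 w) <= Rad / T%:R.
Proof.
case: t => // t /= tT.
rewrite (run_x run)// addrC addKr enormZ ger0_norm ?invr_ge0//.
rewrite mulrC ler_wpM2r ?invr_ge0//; apply: Rad_ub.
by case: (run_v run (t := t) tT w).
Qed.

Lemma Rad_ge0 : 0 <= Rad.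
Proof. by apply: le_trans (Rad_ub K_0); exact: enorm_ge0. Qed.

(** The random point [x_t(a_t)] at which the t-th Hessian is estimated. *)
Definition query t w := a t w *: x t w + (1 - a t w) *: x t.-1 w.

Lemma run_past_measurable t : (t <= T.+1)%N -> past a z v t `<=` measurable.
Proof.
move=> tT; apply: past_measurable => // s i /andP[s1 st].
by apply: (run_v_meas run); rewrite s1 -ltnS (leq_trans st).
Qed.

Lemma run_past_and_a_measurable t : (t <= T.+1)%N -> past_and_a a z v t `<=` measurable.
Proof. by move=> tT; apply: past_and_a_measurable => //; exact: run_past_measurable. Qed.

Lemma iterate_past t i : (1 <= t <= T.+1)%N ->
  meas_wrt (past a z v t) (fun w => x t w i ord0).
Proof.
elim: t => // -[_ _|t ih /= tT].
  rewrite (_ : (fun w => _) = cst 0); first exact: measurable_cst.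
  by apply/funext => w; rewrite (run_x1 run) mxE.
rewrite (_ : (fun w => _) = (fun w => x t.+1 w i ord0 + T%:R^-1 * v t.+1 w i ord0)); last first.
  by apply/funext => w; rewrite (run_x run)// !mxE.
apply: (@measurable_funD _ (g_sigma_algebraType (past a z v t.+2))).
  apply: (@meas_wrt_sub _ _ (past a z v t.+1)); last by apply: ih; exact: ltnW.
  by move=> E pE; rewrite past_sigma_algebra; exact: (past_mono _ pE).
apply: measurable_funM => //.
by apply: past_v; rewrite ltnS /=.
Qed.

Lemma query_past t i : (2 <= t <= T)%N ->
  meas_wrt (past_and_a a z v t) (fun w => query t w i ord0).
Proof.
move=> /andP[t2 tT].
have ma : meas_wrt (past_and_a a z v t) (a t) by exact: past_and_a_a.
have mx s : (1 <= s <= t)%N -> meas_wrt (past_and_a a z v t) (fun w => x s w i ord0).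
  move=> /andP[s1 st]; apply: (@meas_wrt_sub _ _ (past a z v s)); last first.
    by apply: iterate_past; rewrite s1 (leq_trans st)// ltnW.
  move=> E pE; rewrite past_and_a_sigma_algebra; apply: past_sub_and_a.
  exact: (past_mono st).
rewrite (_ : (fun w => _) = (fun w => a t w * x t w i ord0 + (1 - a t w) * x t.-1 w i ord0));
  last by apply/funext => w; rewrite !mxE.
apply: (@measurable_funD _ (g_sigma_algebraType (past_and_a a z v t))).
  by apply: measurable_funM => //; apply: mx; rewrite leqnn ltnW.
apply: measurable_funM; first exact: measurable_funB.
apply: mx; rewrite leq_pred andbT.
by case: (t) t2.
Qed.

Lemma query_past_next t i : (2 <= t <= T)%N ->
  meas_wrt (past a z v t.+1) (fun w => query t w i ord0).
Proof.
move=> tT; have /andP[t2 _] := tT.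
apply: (@meas_wrt_sub _ _ (past_and_a a z v t)); last exact: query_past.
rewrite past_sigma_algebra; apply: smallest_sub; first exact: smallest_sigma_algebra.
move=> E [/(past_mono (leqnSn t))//|aE].
apply: sub_sigma_algebra; right; exists t => //=.
by rewrite t2 ltnSn.
Qed.

Lemma iterate_past_le s t i : (1 <= s <= t)%N -> (t <= T.+1)%N ->
  meas_wrt (past a z v t) (fun w => x s w i ord0).
Proof.
move=> /andP[s1 st] tT; apply: (@meas_wrt_sub _ _ (past a z v s)); last first.
  by apply: iterate_past; rewrite s1 (leq_trans st).
by move=> E pE; rewrite past_sigma_algebra; exact: (past_mono st).
Qed.

(** The direction [d t] depends on the t-th sample, hence the shift: it belongs to the
    past of the next iteration. *)
Lemma direction_past t i : (1 <= t <= T)%N ->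
  meas_wrt (past a z v t.+1) (fun w => d t w i ord0).
Proof.
elim: t i => // -[_ i _|t ih i tT].
  rewrite (_ : (fun w => _) = (fun w => grad (Ft ^~ (z 1%N w)) 0 i ord0)); last first.
    by apply/funext => w; rewrite (run_d1 run).
  have [_ mg _] := Ft_meas 0.
  apply: (@measurableT_comp _ _ _ (g_sigma_algebraType (past a z v 2)) _ _
    (fun y => grad (Ft ^~ y) 0 i ord0)).
    exact: mg.
  exact: past_z.
set H := g_sigma_algebraType (past a z v t.+3).
have mz : @measurable_fun _ _ H _ setT (z t.+2) by apply: past_z; rewrite /= ltnSn.
have mq j : @measurable_fun _ _ H _ setT (fun w => query t.+2 w j ord0).
  exact: query_past_next.
have mx s j : (1 <= s <= t.+3)%N -> @measurable_fun _ _ H _ setT (fun w => x s w j ord0).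
  by move=> s3; apply: iterate_past_le.
have mh j : @measurable_fun _ _ H _ setT (fun w => hess_est p Ft (query t.+2 w) (z t.+2 w) i j).
  apply: (measurable_caratheodory (f := fun y zz => hess_est p Ft y zz i j)) => //.
    by move=> zz; exact: (continuous_hess_est (Ft_C2 zz) (logp_C2 zz)).
  by move=> y; exact: (measurable_hess_est y Ft_meas logp_meas).
have mg : @measurable_fun _ _ H _ setT (fun w => grad (Ft ^~ (z t.+2 w)) (x t.+2 w) i ord0).
  apply: (measurable_caratheodory (f := fun y zz => grad (Ft ^~ zz) y i ord0)) => //.
  - by move=> zz; exact: (continuous_grad (Ft_C2 zz)).
  - by move=> y; case: (Ft_meas y).
  - by move=> j; apply: mx; rewrite leqnSn.
have md : @measurable_fun _ _ H _ setT (fun w => d t.+1 w i ord0).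
  apply: (@meas_wrt_sub _ _ (past a z v t.+2)); last by apply: ih; case/andP: tT => _ /ltnW.
  by move=> E pE; rewrite past_sigma_algebra; exact: (past_mono _ pE).
rewrite (_ : (fun w => _) = (fun w => (1 - (t.+2.-1)%:R^-1) * (d t.+1 w i ord0 +
    \sum_j hess_est p Ft (query t.+2 w) (z t.+2 w) i j * (x t.+2 w j ord0 - x t.+1 w j ord0))
    + (t.+2.-1)%:R^-1 * grad (Ft ^~ (z t.+2 w)) (x t.+2 w) i ord0)); last first.
  apply/funext => w; rewrite (run_d run)//= -/(query t.+2 w).
  move: (hess_est _ _ _ _) (grad _ _) => M g.
  rewrite !mxE; congr (_ * (_ + _) + _).
  by apply: eq_bigr => j _; rewrite !mxE.
apply: (@measurable_funD _ H).
  apply: measurable_funM => //; apply: (@measurable_funD _ H) => //.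
  apply: (@measurable_sum _ H) => j; apply: measurable_funM => //.
  apply: measurable_funB; apply: mx; first by rewrite /= leqnSn.
  by rewrite /= (leq_trans (leqnSn _) (leqnSn _)).
by apply: measurable_funM.
Qed.

Lemma query_coef_ae t : (2 <= t <= T)%N -> {ae P, forall w, 0 <= a t w <= 1}.
Proof.
move=> tT; have := run_a_unif run tT (measurable_itv `[0, 1]).
rewrite {1}/uniform_prob integral_uniform_pdf1//= /distribution /pushforward => Pa.
have mA : measurable (a t @^-1` `[0, 1]%classic).
  by rewrite -[X in measurable X]setTI; exact: measurable_funP.
exists (~` (a t @^-1` `[0, 1]%classic)); split.
- exact: measurableC.
- by rewrite probability_setC// Pa subee.
- by move=> w /= h1 h2; apply: h1; move: h2; rewrite in_itv.
Qed.

Lemma query_K t w : (2 <= t <= T)%N -> 0 <= a t w <= 1 -> K (query t w).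
Proof.
move=> /andP[t2 tT] a01; apply: convex_combination => //; apply: iterate_K.
  by rewrite (ltnW t2) (leq_trans tT).
by case: (t) t2 tT => // s s1 sT; rewrite /= (leq_trans (ltnW sT))// andbT.
Qed.

(** Only almost surely: the uniform variable may leave the unit interval on a null event,
    and there nothing is known about the query. *)
Lemma query_K_ae t : (2 <= t <= T)%N -> {ae P, forall w, K (query t w)}.
Proof. by move=> tT; apply: filterS (query_coef_ae tT) => w; exact: query_K. Qed.

Lemma continuous_density y : continuous (p ^~ y).
Proof.
have -> : p ^~ y = (fun x0 => expR (logp p x0 y)).
  by apply/funext => x0; rewrite /logp lnK ?posrE.
have c := continuous_twice_cont_diff (logp_C2 y).
by move=> x0; apply: continuous_comp; [exact: c|exact: continuous_expR].
Qed.

(** The density is continuous in the point because its logarithm is. *)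
Lemma query_density_measurable t : (2 <= t <= T)%N ->
  measurable_fun setT (fun wy : g_sigma_algebraType (past_and_a a z v t) * Z =>
    p (query t wy.1) wy.2).
Proof.
move=> tT; apply: (measurable_caratheodory (f := p)) => //.
- exact: continuous_density.
- by move=> y; case: (p_dens y).
- by move=> i; exact: (measurableT_comp (query_past i tT) measurable_fst).
Qed.

(** The identity of the sample space, seen as a measurable map onto a coarser space. *)
Definition past_and_a_proj t (tT : (t <= T.+1)%N) :
    {mfun Omega >-> g_sigma_algebraType (past_and_a a z v t)} :=
  HB.pack id (isMeasurableFun.Build _ _ _ _ _
    (measurable_id_sub (run_past_and_a_measurable tT))).

Definition past_proj t (tT : (t <= T.+1)%N) :
    {mfun Omega >-> g_sigma_algebraType (past a z v t)} :=
  HB.pack id (isMeasurableFun.Build _ _ _ _ _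
    (measurable_id_sub (run_past_measurable tT))).

Lemma sample_law t (tT : (2 <= t <= T)%N) (tT1 : (t <= T.+1)%N) E A :
  measurable E -> measurable A ->
  P (past_and_a_proj tT1 @^-1` E `&` z t @^-1` A) =
  (\int[P]_(w in past_and_a_proj tT1 @^-1` E) \int[mu]_(y in A)
    (p (query t (past_and_a_proj tT1 w)) y)%:E)%E.
Proof.
have sub X : <<s past_and_a a z v t >> X -> past_and_a a z v t X.
  by rewrite past_and_a_sigma_algebra.
by move=> /sub mE mA; exact: (run_z run).
Qed.

Lemma coef_measurable t : @measurable_fun _ _ Omega (measurableTypeR R) setT (a t).
Proof.
have ma : measurable_fun setT (a t) by exact: measurable_funP.
by move=> _ A mA; exact: (ma measurableT A mA).
Qed.

(** The variable [a t] with values in the measurable space that carries Lebesgue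
    measure. *)
Definition coef_rv t : {mfun Omega >-> measurableTypeR R} :=
  HB.pack (a t : Omega -> measurableTypeR R)
    (isMeasurableFun.Build _ _ _ _ _ (@coef_measurable t)).

(** The uniform law is written with its density with respect to Lebesgue measure; as it
    does not depend on the past, the hypothesis of disintegration is independence. *)
Lemma coef_law t (tT : (2 <= t <= T)%N) (tT1 : (t <= T.+1)%N) E A :
  measurable E -> measurable A ->
  P (past_proj tT1 @^-1` E `&` coef_rv t @^-1` A) =
  (\int[P]_(w in past_proj tT1 @^-1` E) \int[lebesgue_measure]_(r in A)
    (uniform_pdf 0 1 r)%:E)%E.
Proof.
have sub X : <<s past a z v t >> X -> past a z v t X by rewrite past_sigma_algebra.
move=> mE mA; rewrite (run_a_indep run tT (sub _ mE) mA).
have mE' : measurable (past_proj tT1 @^-1` E).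
  by rewrite -[X in measurable X]setTI; exact: measurable_funP.
rewrite [RHS](integral_cst _ mE') muleC; congr (_ * _)%E.
exact: (run_a_unif run tT mA).
Qed.

(** The function [g] is evaluated at the new sample on the left and averaged on the
    right; its first argument may use the past and the coefficient [a t]. *)
Lemma sample_expect t (g : Omega -> Z -> R) (k : Omega -> R) : (2 <= t <= T)%N ->
  measurable_fun setT (fun wy : g_sigma_algebraType (past_and_a a z v t) * Z => g wy.1 wy.2) ->
  measurable_fun setT k -> integ P (fun w => g w (z t w)) ->
  {ae P, forall w, (\int[mu]_y (g w y * p (query t w) y)%:E = (k w)%:E)%E} ->
  integ P k /\ expect P (fun w => g w (z t w)) = expect P k.
Proof.
move=> tT mg mk ig gk; have tT1 : (t <= T.+1)%N by case/andP: tT => _ /leqW.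
have [ik E] := disintegration (h := past_and_a_proj tT1) (Y := z t)
  (q := fun w y => p (query t w) y) (fun w y => ltW (p_gt0 _ y))
  (query_density_measurable tT) (sample_law tT tT1) mg mk ig gk.
split => //; apply: EFin_inj.
by rewrite -!expectE.
Qed.

Lemma sample_moment_le t (g : Omega -> Z -> R) (c : R) : (2 <= t <= T)%N ->
  measurable_fun setT (fun wy : g_sigma_algebraType (past_and_a a z v t) * Z => g wy.1 wy.2) ->
  (forall w y, 0 <= g w y) -> 0 <= c ->
  {ae P, forall w, (\int[mu]_y (g w y * p (query t w) y)%:E <= c%:E)%E} ->
  (\int[P]_w (g w (z t w))%:E <= c%:E)%E.
Proof.
move=> tT mg g0 c0 gc; have tT1 : (t <= T.+1)%N by case/andP: tT => _ /leqW.
have mgE : measurable_fun setT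
    (fun wy : g_sigma_algebraType (past_and_a a z v t) * Z => (g wy.1 wy.2)%:E).
  exact/measurable_EFinP.
have gE0 (wy : g_sigma_algebraType (past_and_a a z v t) * Z) : (0 <= (g wy.1 wy.2)%:E)%E.
  by rewrite lee_fin.
have mq := query_density_measurable tT.
have := ge0_disintegration (h := past_and_a_proj tT1) (Y := z t)
  (q := fun w y => p (query t w) y) (fun w y => ltW (p_gt0 _ y)) mq (sample_law tT tT1) mgE gE0.
move=> /= ->.
have mgq : measurable_fun setT
    (fun wy : g_sigma_algebraType (past_and_a a z v t) * Z =>
       ((g wy.1 wy.2)%:E * (p (query t wy.1) wy.2)%:E)%E).
  by apply: emeasurable_funM => //; exact/measurable_EFinP.
have gq0 wy : (0 <= (g wy.1 wy.2)%:E * (p (query t wy.1) wy.2)%:E)%E.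
  by rewrite mule_ge0 ?lee_fin// ltW.
apply: (@le_trans _ _ (\int[P]_w c%:E)%E); last first.
  have /= := expectE (integ_cst P c); rewrite expect_cst => ->; exact: lexx.
apply: ae_ge0_le_integral => //.
- by move=> w _; apply: integral_ge0 => y _; exact: (gq0 (w, y)).
- exact: (measurableT_comp (measurable_fun_fubini_tonelli_F _ mgq gq0)
    (measurable_id_sub (run_past_and_a_measurable tT1))).
- by apply: filterS gc => w + _; under eq_integral do rewrite EFinM.
Qed.

Lemma coef_expect t (g : Omega -> R -> R) (k : Omega -> R) : (2 <= t <= T)%N ->
  measurable_fun setT (fun wr : g_sigma_algebraType (past a z v t) * measurableTypeR R => g wr.1 wr.2) ->
  measurable_fun setT k -> integ P (fun w => g w (a t w)) ->
  (forall w, (\int[lebesgue_measure]_r (g w r * uniform_pdf 0 1 r)%:E = (k w)%:E)%E) ->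
  integ P k /\ expect P (fun w => g w (a t w)) = expect P k.
Proof.
move=> tT mg mk ig gk; have tT1 : (t <= T.+1)%N by case/andP: tT => _ /leqW.
have mq : measurable_fun setT
    (fun wr : g_sigma_algebraType (past a z v t) * measurableTypeR R => uniform_pdf 0 1 wr.2 : R).
  by apply: measurableT_comp => //; exact: measurable_uniform_pdf.
have [ik E] := disintegration (mu := @lebesgue_measure R) (h := past_proj tT1) (Y := coef_rv t)
  (q := fun w r => uniform_pdf 0 1 r) (fun w r => uniform_pdf_ge0 r (@ltr01 R))
  mq (coef_law tT tT1) mg mk ig (aeW _ gk).
split => //; apply: EFin_inj.
by rewrite -!expectE.
Qed.

Definition step t w := x t w - x t.-1 w.

(** The estimator of the increment of the gradient between two iterates. *)
Definition hess_step t w := hess_est p Ft (query t w) (z t w) *m step t w.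

Lemma pred_iterate t : (2 <= t <= T)%N -> (1 <= t.-1 <= t)%N.
Proof. by case: t => // t /andP[t1 _]; rewrite /= leqnSn andbT. Qed.

Lemma leq_horizon t : (2 <= t <= T)%N -> (t <= T.+1)%N.
Proof. by case/andP => _ /leqW. Qed.

Lemma past_and_a_of_past t (f : Omega -> R) : meas_wrt (past a z v t) f ->
  meas_wrt (past_and_a a z v t) f.
Proof.
apply: meas_wrt_sub => E pE; rewrite past_and_a_sigma_algebra.
exact: past_sub_and_a.
Qed.

Lemma step_past t i : (2 <= t <= T)%N -> meas_wrt (past a z v t) (fun w => step t w i ord0).
Proof.
move=> tT; have tT1 := leq_horizon tT.
rewrite (_ : (fun w => _) = (fun w => x t w i ord0 - x t.-1 w i ord0)); last first.
  by apply/funext => w; rewrite !mxE.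
apply: (@measurable_funB _ (g_sigma_algebraType (past a z v t))); apply: iterate_past_le => //.
  by rewrite leqnn andbT; case/andP: tT => /ltnW.
exact: pred_iterate.
Qed.

Lemma hess_query_measurable t i j : (2 <= t <= T)%N ->
  measurable_fun setT (fun wy : g_sigma_algebraType (past_and_a a z v t) * Z =>
    hess_est p Ft (query t wy.1) wy.2 i j).
Proof.
move=> tT; apply: (measurable_caratheodory (f := fun y zz => hess_est p Ft y zz i j)) => //.
- by move=> zz; exact: (continuous_hess_est (Ft_C2 zz) (logp_C2 zz)).
- by move=> y; exact: (measurable_hess_est y Ft_meas logp_meas).
- by move=> k; exact: (measurableT_comp (query_past k tT) measurable_fst).
Qed.

Lemma grad_query_measurable t i : (2 <= t <= T)%N ->
  measurable_fun setT (fun wy : g_sigma_algebraType (past_and_a a z v t) * Z =>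
    grad (Ft ^~ wy.2) (query t wy.1) i ord0).
Proof.
move=> tT; apply: (measurable_caratheodory (f := fun y zz => grad (Ft ^~ zz) y i ord0)) => //.
- by move=> zz; exact: (continuous_grad (Ft_C2 zz)).
- by move=> y; case: (Ft_meas y).
- by move=> k; exact: (measurableT_comp (query_past k tT) measurable_fst).
Qed.

Lemma hess_step_measurable t i : (2 <= t <= T)%N ->
  measurable_fun setT (fun wy : g_sigma_algebraType (past_and_a a z v t) * Z =>
    (hess_est p Ft (query t wy.1) wy.2 *m step t wy.1) i ord0).
Proof.
move=> tT; rewrite (_ : (fun wy => _) = (fun wy => \sum_j
    hess_est p Ft (query t wy.1) wy.2 i j * step t wy.1 j ord0)); last first.
  by apply/funext => wy; rewrite mxE.
apply: measurable_sum => j; apply: measurable_funM; first exact: hess_query_measurable.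
exact: (measurableT_comp (past_and_a_of_past (step_past j tT)) measurable_fst).
Qed.

Lemma sample_measurable t d' (U : measurableType d') (f : Omega * Z -> U) : (t <= T.+1)%N ->
  measurable_fun setT (f : g_sigma_algebraType (past_and_a a z v t) * Z -> U) ->
  measurable_fun setT (fun w => f (w, z t w)).
Proof.
move=> tT mf.
have mi : measurable_fun setT
    (fun w => (w, z t w) : g_sigma_algebraType (past_and_a a z v t) * Z).
  apply: measurable_fun_pair => //.
  exact: (measurable_id_sub (run_past_and_a_measurable tT)).
exact: (measurableT_comp mf mi).
Qed.

(** Disintegrate along the sample: for almost every past and coefficient the query lies
    in [K], where the second moment of the Hessian estimator is bounded, and the step
    has length at most [Rad / T]. *)
Lemma hess_step_sqint t : (2 <= t <= T)%N ->
  vsqint P (hess_step t) /\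
  expect P (fun w => enorm (hess_step t w) ^+ 2) <= Lbar ^+ 2 * (Rad / T%:R) ^+ 2.
Proof.
move=> tT; have tT1 := leq_horizon tT.
have mD i : measurable_fun setT (fun w => hess_step t w i ord0).
  exact: (@sample_measurable t _ _ (fun wy => (hess_est p Ft (query t wy.1) wy.2 *m step t wy.1) i ord0) tT1 (hess_step_measurable i tT)).
have mD2 : measurable_fun setT (fun w => enorm (hess_step t w) ^+ 2).
  exact: measurable_sqr_enorm.
have c0 : 0 <= Lbar ^+ 2 * (Rad / T%:R) ^+ 2 by apply: mulr_ge0; exact: sqr_ge0.
have bound : (\int[P]_w (enorm (hess_step t w) ^+ 2)%:E <=
    (Lbar ^+ 2 * (Rad / T%:R) ^+ 2)%:E)%E.
  apply: (@sample_moment_le t (fun w y => enorm (hess_est p Ft (query t w) y *m step t w) ^+ 2)) => //.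
  - by apply: measurable_sqr_enorm => i; exact: hess_step_measurable.
  - by move=> w y; exact: sqr_ge0.
  apply: filterS (query_K_ae tT) => w Kq.
  have h := hess_est_second_moment (p_dens (query t w)) logp_meas Gp_ge0 Lp_ge0
    (fun y => Ft_bound y Kq) (fun y => gradFt_bound y Kq) (gradp_bound Kq)
    (fun y => hessFt_bound y Kq) (hessp_bound Kq) (step t w) (z t w).
  apply: le_trans h _; rewrite lee_fin; apply: ler_wpM2l; first exact: sqr_ge0.
  rewrite ler_pXn2r ?nnegrE ?enorm_ge0 ?divr_ge0 ?Rad_ge0//.
  by apply: step_le; case/andP: tT => -> /leqW ->.
have iD : integ P (fun w => enorm (hess_step t w) ^+ 2).
  apply/integrableP; split; first exact/measurable_EFinP.
  under eq_integral do rewrite gee0_abs ?lee_fin ?sqr_ge0//.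
  by apply: le_lt_trans bound _; rewrite ltry.
split; first exact: vsqint_of_integ.
by rewrite -lee_fin -expectE.
Qed.

Lemma iterate_segment_past t dW (W : measurableType dW)
    (f : W -> g_sigma_algebraType (past a z v t)) (r : W -> R) i : (2 <= t <= T)%N ->
  measurable_fun setT f -> measurable_fun setT r ->
  measurable_fun setT (fun y => (r y *: x t (f y) + (1 - r y) *: x t.-1 (f y)) i ord0).
Proof.
move=> tT mf mr; have tT1 := leq_horizon tT.
have mx s : (1 <= s <= t)%N -> measurable_fun setT (fun y => x s (f y) i ord0).
  by move=> st; exact: (measurableT_comp (iterate_past_le i st tT1) mf).
have m1 : measurable_fun setT (fun y => x t (f y) i ord0).
  by apply: mx; rewrite leqnn andbT; case/andP: tT => /ltnW.
have m2 := mx _ (pred_iterate tT).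
under eq_fun do rewrite !mxE.
by apply: measurable_funD; apply: measurable_funM => //; exact: measurable_funB.
Qed.

(** The estimator is unbiased when tested against the past. Averaging over the sample
    first replaces the estimator by the Hessian of [F] at the query; averaging over the
    coefficient then replaces this Hessian by the increment of the gradient. *)
Lemma hess_step_expect t (xi : Omega -> R) i : (2 <= t <= T)%N ->
  meas_wrt (past a z v t) xi -> sqint P xi ->
  expect P (fun w => xi w * hess_step t w i ord0) =
  expect P (fun w => xi w * (grad F (x t w) i ord0 - grad F (x t.-1 w) i ord0)).
Proof.
move=> tT mxi xi2; have tT1 := leq_horizon tT.
have [D2 _] := hess_step_sqint tT.
have mpast (f : Omega -> R) : meas_wrt (past a z v t) f -> measurable_fun setT f.
  by apply: meas_wrt_measurable; exact: run_past_measurable.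
have mHF i' : measurable_fun setT (fun w => (hess F (query t w) *m step t w) i' ord0).
  under eq_fun do rewrite mxE.
  apply: measurable_sum => j; apply: measurable_funM; last by apply: mpast; exact: step_past.
  apply: (measurable_continuous (f := fun y => hess F y i' j)); first exact: continuous_hess.
  move=> k; apply: (@meas_wrt_measurable _ _ (past_and_a a z v t)); last exact: query_past.
  exact: run_past_and_a_measurable.
pose g w y := xi w * (hess_est p Ft (query t w) y *m step t w) i ord0.
pose k w := xi w * (hess F (query t w) *m step t w) i ord0.
have mg : measurable_fun setT
    (fun wy : g_sigma_algebraType (past_and_a a z v t) * Z => g wy.1 wy.2).
  apply: measurable_funM; last exact: hess_step_measurable.
  exact: (measurableT_comp (past_and_a_of_past mxi) measurable_fst).
have mk : measurable_fun setT k by apply: measurable_funM => //; exact: mpast.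
have ig : integ P (fun w => g w (z t w)) by exact: sqintM.
have gk : {ae P, forall w, (\int[mu]_y (g w y * p (query t w) y)%:E = (k w)%:E)%E}.
  apply: filterS (query_K_ae tT) => w Kq.
  exact: (hess_est_mulmx_unbiased (p_dens _) Ft_meas logp_meas (hess_unbiased Kq)).
have [ik Egk] := sample_expect tT mg mk ig gk.
apply: (etrans Egk).
have mgr s j : (1 <= s <= t)%N -> measurable_fun setT (fun w => grad F (x s w) j ord0).
  move=> st; apply: (measurable_continuous (f := fun y => grad F y j ord0)).
    exact: continuous_grad.
  by move=> l; apply: mpast; exact: iterate_past_le.
pose g2 w r := xi w * (hess F (r *: x t w + (1 - r) *: x t.-1 w) *m step t w) i ord0.
pose k2 w := xi w * (grad F (x t w) i ord0 - grad F (x t.-1 w) i ord0).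
have mg2 : measurable_fun setT
    (fun wr : g_sigma_algebraType (past a z v t) * measurableTypeR R => g2 wr.1 wr.2).
  apply: measurable_funM; first exact: (measurableT_comp mxi measurable_fst).
  rewrite (_ : (fun wr => _) = (fun wr : g_sigma_algebraType (past a z v t) * measurableTypeR R =>
    \sum_j hess F (wr.2 *: x t wr.1 + (1 - wr.2) *: x t.-1 wr.1) i j * step t wr.1 j ord0));
    last by apply/funext => wr; rewrite mxE.
  apply: measurable_sum => j; apply: measurable_funM; last first.
    exact: (measurableT_comp (step_past j tT) measurable_fst).
  apply: (measurable_continuous (f := fun y => hess F y i j)); first exact: continuous_hess.
  by move=> l; apply: iterate_segment_past => //.
have mk2 : measurable_fun setT k2.
  apply: measurable_funM; first exact: mpast.
  apply: measurable_funB; apply: mgr; last exact: pred_iterate.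
  by rewrite leqnn andbT; case/andP: tT => /ltnW.
have gk2 w : (\int[lebesgue_measure]_r (g2 w r * uniform_pdf 0 1 r)%:E = (k2 w)%:E)%E.
  exact: averaged_hessian.
exact: (coef_expect tT mg2 mk2 ik gk2).2.
Qed.

(** The gradient is unbiased at the query, whose law generated the sample, and not at
    the iterate. *)
Lemma grad_query_expect t (xi : Omega -> R) i : (2 <= t <= T)%N ->
  meas_wrt (past a z v t) xi -> sqint P xi ->
  expect P (fun w => xi w * grad (Ft ^~ (z t w)) (query t w) i ord0) =
  expect P (fun w => xi w * grad F (query t w) i ord0).
Proof.
move=> tT mxi xi2; have tT1 := leq_horizon tT.
have mxiO : measurable_fun setT xi.
  by apply: (meas_wrt_measurable _ mxi); exact: run_past_measurable.
have mg : measurable_fun setT (fun w => grad (Ft ^~ (z t w)) (query t w) i ord0).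
  exact: (@sample_measurable t _ _ (fun wy => grad (Ft ^~ wy.2) (query t wy.1) i ord0) tT1 (grad_query_measurable i tT)).
pose g w y := xi w * grad (Ft ^~ y) (query t w) i ord0.
pose k w := xi w * grad F (query t w) i ord0.
have mg2 : measurable_fun setT
    (fun wy : g_sigma_algebraType (past_and_a a z v t) * Z => g wy.1 wy.2).
  apply: measurable_funM; last exact: grad_query_measurable.
  exact: (measurableT_comp (past_and_a_of_past mxi) measurable_fst).
have mk : measurable_fun setT k.
  apply: measurable_funM => //.
  apply: (measurable_continuous (f := fun y => grad F y i ord0)); first exact: continuous_grad.
  move=> l; apply: (@meas_wrt_measurable _ _ (past_and_a a z v t)); last exact: query_past.
  exact: run_past_and_a_measurable.
have ig : integ P (fun w => g w (z t w)).
  apply: sqintM => //; apply: (sqint_bounded (c := GF)) => //.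
  apply: filterS (query_K_ae tT) => w Kq.
  exact: le_trans (norm_coord_le _ _) (gradFt_bound _ Kq).
have gk : {ae P, forall w, (\int[mu]_y (g w y * p (query t w) y)%:E = (k w)%:E)%E}.
  apply: filterS (query_K_ae tT) => w Kq.
  exact: (grad_est_unbiased (p_dens _) Ft_meas (grad_unbiased Kq)).
exact: (sample_expect tT mg2 mk ig gk).2.
Qed.

(** * The recursion for the error of the direction *)

Definition err t w := d t w - grad F (x t w).

Definition hess_noise t w := hess_step t w - (grad F (x t w) - grad F (x t.-1 w)).

(** The fresh gradient error splits at the query: [grad_noise] is centred given the
    past, and [grad_bias] is the cost of evaluating both gradients at the iterate. *)
Definition grad_noise t w := grad (Ft ^~ (z t w)) (query t w) - grad F (query t w).

Definition grad_bias t w := grad (Ft ^~ (z t w)) (x t w) - grad (Ft ^~ (z t w)) (query t w)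
  + (grad F (query t w) - grad F (x t w)).

Lemma grad_iterate_past t i : (1 <= t <= T.+1)%N ->
  meas_wrt (past a z v t) (fun w => grad F (x t w) i ord0).
Proof.
move=> tT; apply: (@measurable_continuous _ _ _ (g_sigma_algebraType (past a z v t))
  (fun y => grad F y i ord0) (x t)); first exact: continuous_grad.
by move=> k; exact: iterate_past.
Qed.

Lemma past_next t (f : Omega -> R) : meas_wrt (past a z v t) f ->
  meas_wrt (past a z v t.+1) f.
Proof.
apply: meas_wrt_sub => E pE; rewrite past_sigma_algebra.
exact: (past_mono (leqnSn t)).
Qed.

Lemma past_meas t (f : Omega -> R) : (t <= T.+1)%N -> meas_wrt (past a z v t) f ->
  measurable_fun setT f.
Proof. by move=> tT; apply: meas_wrt_measurable; exact: run_past_measurable. Qed.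

Lemma err_past t i : (1 <= t <= T)%N -> meas_wrt (past a z v t.+1) (fun w => err t w i ord0).
Proof.
move=> tT; rewrite (_ : (fun w => _) = (fun w => d t w i ord0 - grad F (x t w) i ord0)).
  apply: (@measurable_funB _ (g_sigma_algebraType (past a z v t.+1))).
    exact: direction_past.
  by apply: past_next; apply: grad_iterate_past; case/andP: tT => -> /leqW.
by apply/funext => w; rewrite /err; move: (grad _ _) => g; rewrite !mxE.
Qed.

Lemma grad_objective_K t w : (1 <= t <= T.+1)%N -> enorm (grad F (x t w)) <= GF.
Proof.
move=> tT; have Kx := iterate_K w tT.
exact: (grad_objective_le (p_dens (x t w)) Ft_meas (fun y => gradFt_bound y Kx)
  (grad_unbiased Kx) (z t w)).
Qed.

Lemma GF_le_G : GF <= G. Proof. by rewrite le_max lexx. Qed.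

Lemma sample_gap_le t w : (1 <= t <= T)%N ->
  enorm (grad (Ft ^~ (z t w)) (x t w) - grad F (x t w)) <= 2 * G.
Proof.
move=> /andP[t1 tT]; have tT1 : (1 <= t <= T.+1)%N by rewrite t1 leqW.
apply: le_trans (enormD _ _) _; rewrite enormN.
have h1 := gradFt_bound (z t w) (iterate_K w tT1); have h2 := grad_objective_K w tT1.
rewrite mulr_natl mulr2n; apply: lerD; exact: le_trans GF_le_G.
Qed.

Lemma err_1 w : enorm (err 1 w) <= 2 * G.
Proof.
rewrite /err (run_d1 run) -{1}(run_x1 run w).
exact: (@sample_gap_le 1).
Qed.

Lemma err_step t w : (2 <= t <= T)%N -> let rho := (t.-1)%:R^-1 in
  err t w = (1 - rho) *: (err t.-1 w + hess_noise t w)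
    + rho *: (grad (Ft ^~ (z t w)) (x t w) - grad F (x t w)).
Proof.
move=> tT rho; rewrite /err /hess_noise (run_d run tT w) -/(query t w) -/rho -/(step t w).
rewrite -/(hess_step t w).
move: (d t.-1 w) (hess_step t w) (grad (Ft ^~ (z t w)) (x t w)) (grad F (x t w)) (grad F (x t.-1 w)).
move=> D H g g1 g0; apply/matrixP => i j; rewrite !mxE.
by ring.
Qed.

(** The iterate and the query lie on a common segment of [K], along which the Hessian is
    bounded; their distance is at most the length of the step. *)
Lemma gradient_gap f (b : R) t w : twice_cont_diff f -> (2 <= t <= T)%N -> 0 <= a t w <= 1 -> 0 <= b ->
  (forall y u, K y -> enorm (hess f y *m u) <= b * enorm u) ->
  enorm (grad f (x t w) - grad f (query t w)) <= b * (Rad / T%:R).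
Proof.
move=> fC2 tT a01 b0 hb; have Kq := query_K tT a01.
have tT1 : (2 <= t <= T.+1)%N by case/andP: tT => -> /leqW ->.
have Kx : K (x t w) by apply: iterate_K; case/andP: tT1 => /ltnW -> ->.
set u := x t w - query t w.
have uE : u = (1 - a t w) *: step t w.
  rewrite /u /query /step; apply/matrixP => i j; rewrite !mxE; ring.
have ru : enorm u <= Rad / T%:R.
  rewrite uE enormZ; apply: le_trans (step_le w tT1).
  rewrite ler_piMl ?enorm_ge0// ger0_norm; case/andP: a01 => ? ?; first by rewrite gerBl.
  by rewrite subr_ge0.
apply: (@le_trans _ _ (b * enorm u)); last exact: ler_wpM2l.
have -> : x t w = query t w + u by rewrite /u subrKC.
apply: (grad_lipschitz fC2) => s y s01; apply: hb.
have -> : query t w + s *: u = s *: x t w + (1 - s) *: query t w.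
  by rewrite /u scalerBr scalerBl scale1r addrCA addrA [RHS]addrAC; apply: addrAC.
exact: convex_combination.
Qed.

Lemma L_ge0 (w : Omega) : 0 <= L.
Proof.
apply: le_trans (_ : LF <= L); last by rewrite le_max lexx.
by apply: le_trans (hessFt_bound (z 1%N w) K_0); exact: specnorm_ge0.
Qed.

Lemma grad_bias_le t w : (2 <= t <= T)%N -> 0 <= a t w <= 1 ->
  enorm (grad_bias t w) <= (Lbar + L) * (Rad / T%:R).
Proof.
move=> tT a01; apply: le_trans (enormD _ _) _; rewrite addrC mulrDl; apply: lerD.
  rewrite enormB; apply: (gradient_gap F_C2 tT a01 (sqrtr_ge0 _)).
  move=> y u Ky; exact: (hess_objective_le (p_dens y) Ft_meas logp_meas Gp_ge0 Lp_ge0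
    (fun y' => Ft_bound y' Ky) (fun y' => gradFt_bound y' Ky) (gradp_bound Ky)
    (fun y' => hessFt_bound y' Ky) (hessp_bound Ky) (hess_unbiased Ky) (z t w)).
apply: (gradient_gap (Ft_C2 (z t w)) tT a01 (L_ge0 w)).
move=> y u Ky; apply: le_trans (enorm_mulmx_le _ _) _.
rewrite ler_wpM2r ?enorm_ge0//; apply: le_trans (hessFt_bound _ Ky) _.
by rewrite le_max lexx.
Qed.

Lemma grad_diff_sqint t : (2 <= t <= T)%N ->
  vsqint P (fun w => grad F (x t w) - grad F (x t.-1 w)) /\
  forall i, meas_wrt (past a z v t) (fun w => (grad F (x t w) - grad F (x t.-1 w)) i ord0).
Proof.
move=> tT; have tT1 := leq_horizon tT.
have t1 : (1 <= t <= T.+1)%N by case/andP: tT => /ltnW -> /leqW ->.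
have p1 : (1 <= t.-1 <= T.+1)%N.
  by case/andP: (pred_iterate tT) => -> /leq_trans ->.
have ms i : meas_wrt (past a z v t) (fun w => (grad F (x t w) - grad F (x t.-1 w)) i ord0).
  rewrite (_ : (fun w => _) = (fun w => grad F (x t w) i ord0 - grad F (x t.-1 w) i ord0)).
    apply: (@measurable_funB _ (g_sigma_algebraType (past a z v t))).
      exact: grad_iterate_past.
    apply: (@measurable_continuous _ _ _ (g_sigma_algebraType (past a z v t))
      (fun y => grad F y i ord0) (x t.-1)); first exact: continuous_grad.
    by move=> k; apply: iterate_past_le => //; exact: pred_iterate.
  by apply/funext => w; move: (grad _ _) (grad F (x t.-1 w)) => g g'; rewrite !mxE.
split => //; apply: (vsqint_bounded (c := GF + GF)).
  by move=> i; apply: (past_meas tT1).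
apply: aeW => w; apply: le_trans (enormD _ _) _; rewrite enormN.
by apply: lerD; exact: grad_objective_K.
Qed.

Lemma hess_noise_sqint t : (2 <= t <= T)%N -> vsqint P (hess_noise t).
Proof.
move=> tT; apply: vsqintB; first by case: (hess_step_sqint tT).
by case: (grad_diff_sqint tT).
Qed.

Lemma hess_noise_orthogonal t (xi : Omega -> 'cV[R]_n) : (2 <= t <= T)%N ->
  vsqint P xi -> (forall i, meas_wrt (past a z v t) (fun w => xi w i ord0)) ->
  expect P (fun w => dotv (xi w) (hess_noise t w)) = 0.
Proof.
move=> tT xi2 mxi; have W2 := hess_noise_sqint tT.
have [D2 _] := hess_step_sqint tT; have [g2 _] := grad_diff_sqint tT.
rewrite expect_dotv// big1// => i _.
rewrite (_ : (fun w => _) = (fun w => xi w i ord0 * hess_step t w i ord0 +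
   -1 * (xi w i ord0 * (grad F (x t w) - grad F (x t.-1 w)) i ord0))); last first.
  apply/funext => w; rewrite /hess_noise; move: (grad F (x t w) - _) (hess_step t w) => g h.
  by rewrite !mxE mulrBr mulN1r.
rewrite expectD; last 2 first.
- exact: sqintM.
- by apply: integZ; exact: sqintM.
rewrite expectZ; last exact: sqintM.
rewrite hess_step_expect// mulN1r; apply/eqP; rewrite subr_eq0; apply/eqP.
congr expect; apply/funext => w.
by move: (grad F (x t w)) (grad F (x t.-1 w)) => g g'; rewrite !mxE.
Qed.

(** The variance is at most the second moment: the noise is orthogonal to the increment
    of the gradient, which belongs to the past. *)
Lemma hess_noise_moment t : (2 <= t <= T)%N ->
  expect P (fun w => enorm (hess_noise t w) ^+ 2) <= Lbar ^+ 2 * (Rad / T%:R) ^+ 2.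
Proof.
move=> tT; have W2 := hess_noise_sqint tT.
have [D2 hD] := hess_step_sqint tT; have [g2 mg] := grad_diff_sqint tT.
apply: le_trans hD.
pose Dl w := grad F (x t w) - grad F (x t.-1 w).
have E : (fun w => enorm (hess_step t w) ^+ 2) = (fun w => enorm (hess_noise t w) ^+ 2 +
    (2 * dotv (Dl w) (hess_noise t w) + enorm (Dl w) ^+ 2)).
  apply/funext => w; have -> : hess_step t w = hess_noise t w + Dl w by rewrite subrK.
  move: (hess_noise t w) (Dl w) => W D.
  by rewrite !enorm_sqr !(dotvDl, dotvDr) (dotvC W D); ring.
have iW := integ_sqr_enorm W2; have iD := integ_sqr_enorm g2.
have iDW := integ_dotv g2 W2.
rewrite E expectD//; last by apply: integD => //; exact: integZ.
rewrite expectD//; last exact: integZ.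
rewrite expectZ// hess_noise_orthogonal// mulr0 add0r lerDl.
by apply: expect_ge0 => w; exact: sqr_ge0.
Qed.

Lemma grad_noise_sqint t : (2 <= t <= T)%N -> vsqint P (grad_noise t).
Proof.
move=> tT; have tT1 := leq_horizon tT.
apply: (vsqint_bounded (c := GF + GF)).
  move=> i; rewrite (_ : (fun w => _) = (fun w => grad (Ft ^~ (z t w)) (query t w) i ord0
      - grad F (query t w) i ord0)); last first.
    apply/funext => w; rewrite /grad_noise.
    by move: (grad _ _) (grad F _) => g g'; rewrite !mxE.
  apply: measurable_funB.
    exact: (@sample_measurable t _ _ (fun wy => grad (Ft ^~ wy.2) (query t wy.1) i ord0) tT1 (grad_query_measurable i tT)).
  apply: (measurable_continuous (f := fun y => grad F y i ord0)); first exact: continuous_grad.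
  move=> l; apply: (@meas_wrt_measurable _ _ (past_and_a a z v t)); last exact: query_past.
  exact: run_past_and_a_measurable.
apply: filterS (query_K_ae tT) => w Kq.
apply: le_trans (enormD _ _) _; rewrite enormN; apply: lerD; first exact: gradFt_bound.
exact: (grad_objective_le (p_dens (query t w)) Ft_meas (fun y => gradFt_bound y Kq)
  (grad_unbiased Kq) (z t w)).
Qed.

Lemma grad_noise_orthogonal t (xi : Omega -> 'cV[R]_n) : (2 <= t <= T)%N ->
  vsqint P xi -> (forall i, meas_wrt (past a z v t) (fun w => xi w i ord0)) ->
  expect P (fun w => dotv (xi w) (grad_noise t w)) = 0.
Proof.
move=> tT xi2 mxi; have W2 := grad_noise_sqint tT; have tT1 := leq_horizon tT.
rewrite expect_dotv// big1// => i _.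
have bounded (f : Omega -> R) : measurable_fun setT f ->
    {ae P, forall w, `|f w| <= GF} -> integ P (fun w => xi w i ord0 * f w).
  by move=> mf fG; apply: sqintM => //; exact: sqint_bounded fG.
have i1 : integ P (fun w => xi w i ord0 * grad (Ft ^~ (z t w)) (query t w) i ord0).
  apply: bounded.
    exact: (@sample_measurable t _ _ (fun wy => grad (Ft ^~ wy.2) (query t wy.1) i ord0) tT1 (grad_query_measurable i tT)).
  apply: filterS (query_K_ae tT) => w Kq.
  exact: le_trans (norm_coord_le _ _) (gradFt_bound _ Kq).
have i2 : integ P (fun w => xi w i ord0 * grad F (query t w) i ord0).
  apply: bounded.
    apply: (measurable_continuous (f := fun y => grad F y i ord0)); first exact: continuous_grad.
    move=> l; apply: (@meas_wrt_measurable _ _ (past_and_a a z v t)); last exact: query_past.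
    exact: run_past_and_a_measurable.
  apply: filterS (query_K_ae tT) => w Kq; apply: le_trans (norm_coord_le _ _) _.
  exact: (grad_objective_le (p_dens (query t w)) Ft_meas (fun y => gradFt_bound y Kq)
    (grad_unbiased Kq) (z t w)).
rewrite (_ : (fun w => _) = (fun w => xi w i ord0 * grad (Ft ^~ (z t w)) (query t w) i ord0 +
   -1 * (xi w i ord0 * grad F (query t w) i ord0))); last first.
  apply/funext => w; rewrite /grad_noise; move: (grad _ _) (grad F _) => g h.
  by rewrite !mxE mulrBr mulN1r.
rewrite expectD//; last exact: integZ.
by rewrite expectZ// grad_query_expect// mulN1r subrr.
Qed.

Let beta := 2 * Rad * (Lbar + L).

(** Take expectations in [momentum_step_sqr] with [rho = 1/m], [b = beta] and
    [c = 1/(2m)]. The choice of [c] is possible because [1/T <= 1/m]. The two inner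
    products vanish, as the previous error belongs to the past. *)
Lemma err_recursion t : (2 <= t <= T)%N -> vsqint P (err t.-1) ->
  let m : R := (t.-1)%:R in
  let A s := expect P (fun w => enorm (err s w) ^+ 2) in
  vsqint P (err t) /\
  m ^+ 2 * A t <= (m - 1) ^+ 2 * A t.-1 + (2 * (Lbar * Rad) ^+ 2 + 8 * G ^+ 2)
     + (m - 1) / (2 * m) * (A t.-1 + beta ^+ 2).
Proof.
move=> tT e2 m A; have tT1 := leq_horizon tT.
have t1T : (1 <= t <= T)%N by case/andP: tT => /ltnW ->.
have /andP[p1 pt] := pred_iterate tT.
have m1 : 1 <= m by rewrite ler1n.
have m0 : 0 < m by exact: lt_le_trans m1.
have mT : m <= T%:R.
  by rewrite ler_nat; case/andP: t1T => _; exact: leq_trans.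
pose rho := m^-1.
have r0 : 0 < rho by rewrite invr_gt0.
have r1 : rho <= 1 by rewrite invf_le1.
have r01 : 0 <= rho <= 1 by rewrite ltW.
pose c := (2 * m)^-1.
have c0 : 0 <= c by rewrite invr_ge0 mulr_ge0// ltW.
have pK : (t.-1.+1)%N = t by apply: prednK; case/andP: t1T.
have me i : meas_wrt (past a z v t) (fun w => err t.-1 w i ord0).
  have h := @err_past t.-1 i; rewrite pK in h; apply: h; rewrite p1/=.
  by case/andP: t1T => _; exact: leq_trans.
have W2 := hess_noise_sqint tT; have N2 := grad_noise_sqint tT.
pose V w := grad (Ft ^~ (z t w)) (x t w) - grad F (x t w).
have VE w : V w = grad_noise t w + grad_bias t w.
  rewrite /V /grad_noise /grad_bias.
  move: (grad _ _) (grad F _) (grad _ (query t w)) (grad F _) => g f g' f'.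
  by apply/matrixP => i j; rewrite !mxE; ring.
have iE := integ_sqr_enorm e2; have iW := integ_sqr_enorm W2.
have ieW := integ_dotv e2 W2; have ieN := integ_dotv e2 N2.
have merr i : measurable_fun setT (fun w => err t w i ord0).
  apply: (past_meas (t := t.+1)); last exact: err_past.
  by case/andP: t1T.
have merr2 : measurable_fun setT (fun w => enorm (err t w) ^+ 2).
  exact: measurable_sqr_enorm.
pose g0 := 2 * rho ^+ 2 * (2 * G) ^+ 2 + (1 - rho) * rho * c * beta ^+ 2.
pose f1 w := ((1 - rho) ^+ 2 + (1 - rho) * rho * c) * enorm (err t.-1 w) ^+ 2.
pose f2 w := 2 * (1 - rho) ^+ 2 * enorm (hess_noise t w) ^+ 2.
pose f3 w := 2 * (1 - rho) ^+ 2 * dotv (err t.-1 w) (hess_noise t w).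
pose f4 w := 2 * ((1 - rho) * rho) * dotv (err t.-1 w) (grad_noise t w).
have if1 : integ P f1 by exact: integZ.
have if2 : integ P f2 by exact: integZ.
have if3 : integ P f3 by exact: integZ.
have if4 : integ P f4 by exact: integZ.
have if12 := integD if1 if2; have if123 := integD if12 if3.
have if1234 := integD if123 if4.
have ig0 := integ_cst P g0.
have step_bound : {ae P, forall w, enorm (err t w) ^+ 2 <= f1 w + f2 w + f3 w + f4 w + g0}.
  apply: filterS (query_coef_ae tT) => w a01.
  rewrite (err_step w tT); apply: (momentum_step_sqr _ _ r01 c0 (VE w)).
    exact: sample_gap_le.
  apply: le_trans (grad_bias_le tT a01) _.
  have -> : c * beta = (Lbar + L) * (Rad / m).
    by rewrite /c /beta; field; rewrite gt_eqF.
  apply: ler_wpM2l; first by apply: addr_ge0; [exact: sqrtr_ge0|exact: (L_ge0 w)].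
  by apply: ler_wpM2l; [exact: Rad_ge0|rewrite lef_pV2 ?posrE ?T_gt0].
have ierr : integ P (fun w => enorm (err t w) ^+ 2).
  apply: (integ_le_ae merr2 (integD if1234 ig0)).
  by apply: filterS step_bound => w; rewrite ger0_norm ?sqr_ge0.
split; first exact: vsqint_of_integ.
have := expect_le_ae ierr (integD if1234 ig0) step_bound.
rewrite (expectD if1234 ig0) (expectD if123 if4) (expectD if12 if3) (expectD if1 if2).
rewrite /f1 /f2 /f3 /f4 !expectZ// hess_noise_orthogonal// grad_noise_orthogonal//.
rewrite !mulr0 !addr0 expect_cst -!/(A _).
have hW := hess_noise_moment tT.
move: (expect P (fun w => enorm (hess_noise t w) ^+ 2)) hW => w2 hW.
move: (A t) (A t.-1) => At Ap hA.
have m20 : 0 < m ^+ 2 by rewrite exprn_gt0.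
have rm : rho * m = 1 by rewrite /rho mulVf// gt_eqF.
have cm : c * m = 2^-1 by rewrite /c invfM -mulrA mulVf ?mulr1// gt_eqF.
have hW' : (1 - rho) ^+ 2 * w2 <= (Lbar * Rad) ^+ 2 / m ^+ 2.
  apply: (@le_trans _ _ (1 * ((Lbar * Rad) ^+ 2 / m ^+ 2))); last by rewrite mul1r.
  apply: (@le_trans _ _ ((1 - rho) ^+ 2 * ((Lbar * Rad) ^+ 2 / m ^+ 2))).
    apply: ler_wpM2l; first exact: sqr_ge0.
    apply: le_trans hW _.
    have -> : (Lbar * Rad) ^+ 2 / m ^+ 2 = Lbar ^+ 2 * (Rad / m) ^+ 2.
      by field; rewrite gt_eqF.
    apply: ler_wpM2l; first exact: sqr_ge0.
    rewrite ler_pXn2r ?nnegrE ?divr_ge0 ?Rad_ge0 ?(ltW m0)//.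
    by apply: ler_wpM2l; [exact: Rad_ge0|rewrite lef_pV2 ?posrE ?T_gt0].
  apply: ler_wpM2r; first by rewrite divr_ge0 ?sqr_ge0.
  by rewrite expr_le1// ?subr_ge0// gerBl ltW.
have := ler_wpM2l (ltW m20) hA.
have := ler_wpM2l (ltW m20) hW'.
rewrite [m ^+ 2 * (_ / _)]mulrC divfK ?gt_eqF// => hw ha.
have E : m ^+ 2 * (((1 - rho) ^+ 2 + (1 - rho) * rho * c) * Ap + 2 * (1 - rho) ^+ 2 * w2 + g0) =
   (m - 1) ^+ 2 * Ap + 2 * (m ^+ 2 * ((1 - rho) ^+ 2 * w2)) + 8 * G ^+ 2 + (m - 1) / (2 * m) * (Ap + beta ^+ 2).
  by rewrite /g0 /rho /c; field; rewrite gt_eqF.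
rewrite E in ha; apply: le_trans ha _; rewrite lerD2r addrA lerD2r lerD2l.
exact: ler_wpM2l.
Qed.

(** The first entry dominates the variance term of the recursion. The other two serve
    the bias together: [256 <= C] makes [C] at least [16 sqrt C], and [beta ^+ 4 <= C]
    bounds [beta ^+ 2] by [sqrt C]. *)
Let C := Num.max (4 * (2 * G + Rad * Lbar) ^+ 2) (Num.max 256 (beta ^+ 4)).

(** [2 a^2 + 2 b^2 <= 2 (a + b)^2] for the nonnegative numbers [a = 2 G] and
    [b = Rad Lbar]. The outcome [w] provides a sample, by which [G] is nonnegative. *)
Lemma C_ge_noise (w : Omega) : 2 * (2 * (Lbar * Rad) ^+ 2 + 8 * G ^+ 2) <= C.
Proof.
apply: (@le_trans _ _ (4 * (2 * G + Rad * Lbar) ^+ 2)); last by rewrite le_max lexx.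
have g0 : 0 <= G.
  by apply: le_trans GF_le_G; apply: le_trans (gradFt_bound (z 1%N w) K_0); exact: enorm_ge0.
have := mulr_ge0 g0 (mulr_ge0 Rad_ge0 (sqrtr_ge0 _ : 0 <= Lbar)).
by move: G Lbar Rad => g l r h; rewrite !exprMn; nra.
Qed.

(** Since [beta^4 <= C] and [256 <= C], [16 beta^2 <= C] whether or not [beta^2] exceeds
    [16]. *)
Lemma C_ge_bias : 16 * beta ^+ 2 <= C.
Proof.
have h1 : 256 <= C by rewrite !le_max lexx !orbT.
have h2 : beta ^+ 4 <= C by rewrite !le_max lexx !orbT.
have b4 : beta ^+ 4 = (beta ^+ 2) ^+ 2 by rewrite -exprM.
rewrite b4 in h2; have b0 := sqr_ge0 beta.
move: C (beta ^+ 2) h1 h2 b0 => c b h1 h2 b0.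
have [b16|b16] := leP b 16; nra.
Qed.

Lemma C_gt0 : 0 < C.
Proof. by apply: (@lt_le_trans _ _ 256) => //; rewrite !le_max lexx !orbT. Qed.

(** At [t = 0] there is no recursion, only the uniform bound on the first error. At
    [t = 1] the weight of the past vanishes, since the second iteration uses
    [rho = 1] and discards the first direction. *)
Lemma err_sqint_moment t : (t < T)%N -> vsqint P (err t.+1) /\
  ((0 < t)%N -> 4 * (t%:R ^+ 2 * expect P (fun w => enorm (err t.+1 w) ^+ 2))
     <= C * (3 * t%:R - 1)).
Proof.
have w0 : Omega by exact: point.
elim: t => [_|t ih tT].
  split => //; apply: (vsqint_bounded (c := 2 * G)); last by apply: aeW => w; exact: err_1.
  by move=> i; apply: (@past_meas 2) => //; apply: err_past.
have [e2 hA] := ih (ltnW tT).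
have tT' : (2 <= t.+2 <= T)%N by [].
have [e2' /= rec] := err_recursion tT' e2; split => // _.
have hQ := C_ge_noise w0; have hb := C_ge_bias; have b0 := sqr_ge0 beta.
move: rec hA; rewrite -natr1 addrK.
move: (expect P (fun w => enorm (err t.+1 w) ^+ 2)) (expect P (fun w => enorm (err t.+2 w) ^+ 2)).
move=> Ap A rec hA.
have [t0|t0] := posnP t.
  move: rec; rewrite t0 !add0r expr0n/= !mul0r add0r addr0 expr1n mul1r => rec.
  move: rec hQ; move: (2 * (Lbar * Rad) ^+ 2 + 8 * G ^+ 2) C => q c; lra.
apply: (moment_recursion_step _ _ hQ hb b0 (Ap := Ap)).
- by rewrite natr1 (ler_nat _ 2).
- by rewrite addrK.
- by rewrite addrK; exact: hA.
Qed.

Lemma err_rate t : (t < T)%N ->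
  expect P (fun w => enorm (err t.+1 w) ^+ 2) <= C / t.+1%:R.
Proof.
move=> tT; have [e2 hA] := err_sqint_moment tT.
have [t0|t0] := posnP t; last first.
  rewrite ler_pdivlMr ?ltr0n// -natr1.
  apply: rate_of_moment; [by rewrite ler1n|exact: ltW C_gt0|exact: hA].
subst t; rewrite divr1; apply: (@le_trans _ _ ((2 * G) ^+ 2)).
  rewrite -(expect_cst P ((2 * G) ^+ 2)); apply: expect_le.
  - exact: integ_sqr_enorm.
  - exact: integ_cst.
  - move=> w; have h := err_1 w; rewrite ler_pXn2r ?nnegrE ?enorm_ge0//.
    exact: le_trans (enorm_ge0 _) h.
have w0 : Omega by exact: point.
apply: le_trans (C_ge_noise w0); have := sqr_ge0 (Lbar * Rad); have := sqr_ge0 G.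
by rewrite [(2 * G) ^+ 2]exprMn; move: (G ^+ 2) ((Lbar * Rad) ^+ 2) => g l; lra.
Qed.

Lemma integ_enorm_err t : (t < T)%N -> integ P (fun w => enorm (err t.+1 w)).
Proof.
move=> tT; have [e2 _] := err_sqint_moment tT.
have ie := integ_sqr_enorm e2.
apply: (integ_le _ (integD (integ_cst P 1) ie)).
  apply: (@measurableT_comp _ _ _ _ _ _ (@Num.sqrt R)).
    by apply: continuous_measurable_fun; exact: sqrt_continuous.
  by apply: measurable_dotv => i; case: (e2 i).
move=> w; rewrite ger0_norm ?enorm_ge0//.
have := sqr_ge0 (enorm (err t.+1 w) - 1); have := sqr_ge0 (enorm (err t.+1 w)).
by move: (enorm _) => k; lra.
Qed.

(** Integrate [2 |e| <= (r / s) |e|^2 + s / r], with [s = sqrt C] and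
    [r = sqrt (t + 1)] balancing the two terms. *)
Lemma expect_enorm_err t : (t < T)%N ->
  expect P (fun w => enorm (err t.+1 w)) <= Num.sqrt C * (Num.sqrt t.+1%:R)^-1.
Proof.
move=> tT; have [e2 _] := err_sqint_moment tT; have ie := integ_sqr_enorm e2.
have i1 := integ_enorm_err tT.
set s := Num.sqrt C; set r := Num.sqrt t.+1%:R.
have s0 : 0 < s by rewrite sqrtr_gt0 C_gt0.
have r0 : 0 < r by rewrite sqrtr_gt0 ltr0n.
have h : 2 * expect P (fun w => enorm (err t.+1 w)) <=
    r / s * expect P (fun w => enorm (err t.+1 w) ^+ 2) + s / r.
  rewrite -!expectZ// -(expect_cst P (s / r)) -expectD//; last 2 first.
  - exact: integZ.
  - exact: integ_cst.
  apply: expect_le; [exact: integZ|by apply: integD; [exact: integZ|exact: integ_cst]|].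
  move=> w; move: (enorm _) => k.
  have rs : 0 <= r / s by rewrite divr_ge0 ?ltW.
  have := mulr_ge0 rs (sqr_ge0 (k - s / r)).
  have -> : r / s * (k - s / r) ^+ 2 = r / s * k ^+ 2 + s / r - 2 * k.
    by field; rewrite !gt_eqF.
  by move: (r / s * k ^+ 2) (s / r) => *; lra.
have h2 : r / s * expect P (fun w => enorm (err t.+1 w) ^+ 2) <= s / r.
  apply: (@le_trans _ _ (r / s * (C / t.+1%:R))).
    by apply: ler_wpM2l (err_rate tT); rewrite divr_ge0 ?ltW.
  have -> : C = s ^+ 2 by rewrite sqr_sqrtr// ltW// C_gt0.
  have -> : t.+1%:R = r ^+ 2 by rewrite sqr_sqrtr.
  by have -> : r / s * (s ^+ 2 / r ^+ 2) = s / r by field; rewrite !gt_eqF.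
move: h h2; move: (r / s * _) (expect P _) (s / r) => y e k; lra.
Qed.

(** * Progress of one step and the final bound *)

Context (Xs : 'I_n -> set R) (Xs_ge0 : forall i r, Xs i r -> 0 <= r)
  (K_sub : K `<=` box Xs) (F_ge0 : forall x, box Xs x -> 0 <= F x)
  (F_mono : monotone_on (box Xs) F) (F_dr : dr_submodular_on (box Xs) F)
  (xstar : 'cV[R]_n) (K_xstar : K xstar).

(** Smoothness bounds the loss of the linear approximation. In the linear term, the
    gradient is [d - err]: the optimality of [v] for [d] trades [v] for [xstar] at the
    cost of [<err, v - xstar>], and DR-submodularity turns [<grad F x, xstar>] into
    the gap. *)
Lemma one_step_progress t w : (t < T)%N ->
  F xstar - F (x t.+2 w) <= (1 - T%:R^-1) * (F xstar - F (x t.+1 w)) +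
    (2 * Rad / T%:R * enorm (err t.+1 w) + Lbar * Rad ^+ 2 / (2 * T%:R ^+ 2)).
Proof.
move=> tT; have Kx : K (x t.+1 w) by apply: iterate_K; rewrite /= ltnW.
have Kx' : K (x t.+2 w) by apply: iterate_K.
have [Kv vmax] := run_v run (t := t.+1) tT w.
have T0 := T_gt0; have Ti : 0 < T%:R^-1 :> R by rewrite invr_gt0.
pose u := T%:R^-1 *: v t.+1 w.
have xE : x t.+2 w = x t.+1 w + u by rewrite (run_x run).
have Kseg s : 0 <= s <= 1 -> K (x t.+1 w + s *: u).
  move=> s01; have -> : x t.+1 w + s *: u = s *: x t.+2 w + (1 - s) *: x t.+1 w.
    by rewrite xE; apply/matrixP => i j; rewrite !mxE; ring.
  exact: convex_combination.
have quad := quadratic_lower_bound F_C2 (x := x t.+1 w) (u := u) (b := Lbar).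
have {quad} : F (x t.+1 w) + dotv (grad F (x t.+1 w)) u - Lbar / 2 * enorm u ^+ 2 <= F (x t.+2 w).
  rewrite xE; apply: quad => s y s01; have Ky := Kseg s s01.
  exact: (hess_objective_le (p_dens _) Ft_meas logp_meas Gp_ge0 Lp_ge0
    (fun y' => Ft_bound y' Ky) (fun y' => gradFt_bound y' Ky) (gradp_bound Ky)
    (fun y' => hessFt_bound y' Ky) (hessp_bound Ky) (hess_unbiased Ky) (z 1%N w)).
have u_le : Lbar / 2 * enorm u ^+ 2 <= Lbar * Rad ^+ 2 / (2 * T%:R ^+ 2).
  rewrite (_ : Lbar * Rad ^+ 2 / (2 * T%:R ^+ 2) = Lbar / 2 * (T%:R^-1 * Rad) ^+ 2); last first.
    by field; rewrite gt_eqF.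
  apply: ler_wpM2l; first by rewrite divr_ge0 ?sqrtr_ge0.
  rewrite ler_pXn2r ?nnegrE ?enorm_ge0 ?mulr_ge0 ?Rad_ge0 ?(ltW Ti)//.
  by rewrite enormZ gtr0_norm// ler_wpM2l ?(ltW Ti)// Rad_ub.
have gE : dotv (grad F (x t.+1 w)) u = T%:R^-1 * dotv (grad F (x t.+1 w)) (v t.+1 w).
  by rewrite dotvZr.
have gap := dr_gap_le F_C2 K_convex K_0 K_sub Xs_ge0 F_mono F_dr Kx K_xstar.
have lin : dotv (grad F (x t.+1 w)) xstar - 2 * Rad * enorm (err t.+1 w) <=
    dotv (grad F (x t.+1 w)) (v t.+1 w).
  have hv := vmax _ K_xstar.
  have cs := cauchy_schwarz (err t.+1 w) (v t.+1 w - xstar).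
  have vx : enorm (v t.+1 w - xstar) <= 2 * Rad.
    apply: le_trans (enormD _ _) _; rewrite enormN mulr_natl mulr2n.
    by apply: lerD; exact: Rad_ub.
  have := le_trans cs (ler_wpM2l (enorm_ge0 _) vx).
  have -> : grad F (x t.+1 w) = d t.+1 w - err t.+1 w by rewrite /err subKr.
  move: hv; rewrite !(dotvDl, dotvDr, dotvNl, dotvNr) !(dotvC _ (d t.+1 w)).
  move: (dotv _ _) (dotv _ _) (dotv _ _) (dotv _ _) (enorm _) => a1 a2 a3 a4 k.
  by move: Rad => rad; lra.
rewrite gE; have := ler_wpM2l (ltW Ti) (le_trans (lerB gap (lexx (2 * Rad * enorm (err t.+1 w)))) lin).
move: u_le; rewrite (_ : 2 * Rad / T%:R * enorm (err t.+1 w) = T%:R^-1 * (2 * Rad * enorm (err t.+1 w))); last by ring.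
move: (F (x t.+1 w)) (F (x t.+2 w)) (F xstar) (dotv _ _) (2 * Rad * enorm (err t.+1 w)) (T%:R^-1)
  (Lbar * Rad ^+ 2 / (2 * T%:R ^+ 2)) (Lbar / 2 * enorm u ^+ 2).
by move=> f0 f1 fs g e q b0 b1; lra.
Qed.

Context (xstar_max : forall x, K x -> F x <= F xstar).

Lemma integ_objective : integ P (fun w => F (x T.+1 w)).
Proof.
have KT w : K (x T.+1 w) by apply: iterate_K; rewrite /= leqnn.
apply: (integ_le _ (integ_cst P (F xstar))).
  apply: (measurable_continuous (f := F)); first exact: continuous_twice_cont_diff.
  by move=> i; apply: (@past_meas T.+1) => //; apply: iterate_past; rewrite /= leqnn.
by move=> w; rewrite ger0_norm ?xstar_max//; apply: F_ge0; exact: K_sub.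
Qed.

(** The one-step bounds are summed along each path, and expectations are taken once at
    the end; [F 0] is dropped because it is nonnegative. *)
Lemma expected_objective_ge :
  (1 - expR (-1)) * F xstar - 4 * Rad * Num.sqrt C / Num.sqrt T%:R
    - Lbar * Rad ^+ 2 / (2 * T%:R) <= expect P (fun w => F (x T.+1 w)).
Proof.
have T0 := T_gt0; have Rad0 := Rad_ge0.
have Fs0 : 0 <= F xstar by apply: F_ge0; exact: K_sub.
have F00 : 0 <= F 0 by apply: F_ge0; exact: K_sub.
pose q : R := 1 - T%:R^-1.
have q0 : 0 <= q by rewrite subr_ge0 invf_le1// ler1n.
have q1 : q <= 1 by rewrite gerBl invr_ge0 ltW.
pose b := Lbar * Rad ^+ 2 / (2 * T%:R ^+ 2).
have b0 : 0 <= b.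
  apply: divr_ge0; first by apply: mulr_ge0; [exact: sqrtr_ge0|exact: sqr_ge0].
  by apply: mulr_ge0 => //; exact: sqr_ge0.
pose k := 2 * Rad / T%:R.
have k0 : 0 <= k by rewrite divr_ge0 ?mulr_ge0.
pose S w := \sum_(i < T) k * enorm (err i.+1 w).
have pathwise w : F xstar + - (q ^+ T * (F xstar - F 0) + T%:R * b) + -1 * S w <= F (x T.+1 w).
  have := @gap_recursion _ (fun t => F xstar - F (x t.+1 w)) (fun t => k * enorm (err t.+1 w)) q b T.
  rewrite (run_x1 run) q0 q1 => /(_ isT) H.
  have {}H : F xstar - F (x T.+1 w) <= q ^+ T * (F xstar - F 0) + S w + T%:R * b.
    apply: H => //; first by move=> t; rewrite mulr_ge0 ?enorm_ge0.
    by move=> t tT; exact: one_step_progress.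
  rewrite mulN1r -addrA -opprD lerBlDr -lerBlDl; apply: le_trans H _.
  by rewrite addrAC.
have iS : integ P S.
  by apply: integ_sum => i; apply: integZ; exact: integ_enorm_err.
have ic := integ_cst P (F xstar + - (q ^+ T * (F xstar - F 0) + T%:R * b)).
have := expect_le (integD ic (integZ (-1) iS)) integ_objective pathwise.
rewrite (expectD ic (integZ (-1) iS)) expectZ// expect_cst.
have ES : expect P S <= 4 * Rad * Num.sqrt C / Num.sqrt T%:R.
  rewrite /S expect_sum; last by move=> i; apply: integZ; exact: integ_enorm_err.
  apply: (@le_trans _ _ (\sum_(i < T) k * Num.sqrt C * (Num.sqrt (i.+1%:R : R))^-1)).
    apply: ler_sum => i _; rewrite expectZ; last exact: integ_enorm_err.
    by rewrite -mulrA; apply: ler_wpM2l => //; exact: expect_enorm_err.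
  rewrite -mulr_sumr; apply: (@le_trans _ _ (k * Num.sqrt C * (2 * Num.sqrt T%:R))).
    by apply: ler_wpM2l; [rewrite mulr_ge0 ?sqrtr_ge0|exact: sum_inv_sqrt_le].
  have r0 : 0 < Num.sqrt (T%:R : R) by rewrite sqrtr_gt0.
  rewrite le_eqVlt; apply/orP; left; apply/eqP.
  rewrite /k -{1}(sqr_sqrtr (ltW T0)); move: r0; move: (Num.sqrt T%:R) (Num.sqrt C) => r c r0.
  by field; rewrite gt_eqF.
have Tb : T%:R * b = Lbar * Rad ^+ 2 / (2 * T%:R).
  by rewrite /b; field; rewrite gt_eqF.
have qT : q ^+ T * (F xstar - F 0) <= expR (-1) * F xstar.
  apply: (@le_trans _ _ (q ^+ T * F xstar)).
    by apply: ler_wpM2l; [rewrite exprn_ge0|rewrite gerBl].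
  by apply: ler_wpM2r => //; exact: one_minus_inv_exp_le.
rewrite Tb; apply: le_trans; move: qT ES; lra.
Qed.

End Run.

Theorem theorem3 (R : realType) (n : nat)
  (dZ : measure_display) (Z : measurableType dZ)
  (mu : {sigma_finite_measure set Z -> \bar R})
  (p Ft : 'cV[R]_n -> Z -> R) (F : 'cV[R]_n -> R)
  (* densities, objective, regularity, measurability *)
  (p_dens : forall x, is_density mu (p x))
  (p_gt0 : forall x z, 0 < p x z)
  (F_def : forall x, Ez mu p x (Ft x) = (F x)%:E)
  (F_C2 : twice_cont_diff F)
  (Ft_C2 : forall z, twice_cont_diff (Ft ^~ z))
  (logp_C2 : forall z, twice_cont_diff (logp p ^~ z))
  (Ft_meas : measurable_z Ft)
  (logp_meas : measurable_z (logp p))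
  (* constraint set *)
  (K : set 'cV[R]_n) (Rad : R)
  (K_convex : convex_set K) (K_compact : compact K) (K_0 : K 0)
  (Rad_attained : exists2 x, K x & enorm x = Rad)
  (Rad_ub : forall x, K x -> enorm x <= Rad)
  (* unbiasedness of the estimators on K *)
  (grad_unbiased : forall x, K x -> forall i,
     Ez mu p x (fun z => grad (Ft ^~ z) x i ord0) = (grad F x i ord0)%:E)
  (hess_unbiased : forall x, K x -> forall i j,
     Ez mu p x (fun z => hess_est p Ft x z i j) = (hess F x i j)%:E)
  (* bounds (i)-(iii) *)
  (B GF Gp LF Lp : R)
  (Gp_ge0 : 0 <= Gp) (Lp_ge0 : 0 <= Lp)
  (Ft_bound : forall x z, K x -> `|Ft x z| <= B)
  (gradFt_bound : forall x z, K x -> enorm (grad (Ft ^~ z) x) <= GF)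
  (gradp_bound : forall x, K x ->
     (Ez mu p x (fun z => enorm (grad (logp p ^~ z) x) ^+ 4)%R <= (Gp ^+ 4)%:E)%E)
  (hessFt_bound : forall x z, K x -> specnorm (hess (Ft ^~ z) x) <= LF)
  (hessp_bound : forall x, K x ->
     (Ez mu p x (fun z => specnorm (hess (logp p ^~ z) x) ^+ 2)%R
        <= (Lp ^+ 2)%:E)%E)
  (* the DR-submodular domain *)
  (Xs : 'I_n -> set R)
  (Xs_compact : forall i, compact (Xs i))
  (Xs_ge0 : forall i r, Xs i r -> 0 <= r)
  (K_sub : K `<=` box Xs)
  (F_ge0 : forall x, box Xs x -> 0 <= F x)
  (F_mono : monotone_on (box Xs) F)
  (F_dr : dr_submodular_on (box Xs) F)
  (* maximizer *)
  (xstar : 'cV[R]_n) (K_xstar : K xstar)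
  (xstar_max : forall x, K x -> F x <= F xstar)
  (* the algorithm *)
  (T : nat) (T_ge1 : (1 <= T)%N)
  (dO : measure_display) (Omega : measurableType dO) (P : probability Omega R)
  (a : nat -> {RV P >-> R}) (z : nat -> {RV P >-> Z})
  (x d v : nat -> Omega -> 'cV[R]_n)
  (run : sfw_run mu p Ft K (fun t => (t.-1)%:R^-1) (fun _ => T%:R^-1) 0 T
           a z x d v) :
  let G := Num.max GF Gp in
  let L := Num.max LF Lp in
  let Lbar := Num.sqrt (4 * B ^+ 2 * G ^+ 4 + 16 * G ^+ 4 + 4 * L ^+ 2
                        + 4 * B ^+ 2 * L ^+ 2) in
  let C := Num.max (4 * (2 * G + Rad * Lbar) ^+ 2)
             (Num.max 256 ((2 * Rad * (Lbar + L)) ^+ 4)) in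
  (forall w, K (x T.+1 w)) /\
  (((1 - expR (-1)) * F xstar - 4 * Rad * Num.sqrt C / Num.sqrt T%:R
      - Lbar * Rad ^+ 2 / (2 * T%:R))%:E
   <= 'E_P[fun w => F (x T.+1 w)])%E.
Proof.
move=> G L Lbar C; split=> [w|].
  by apply: (iterate_K K_convex K_0 T_ge1 run); rewrite /= leqnn.
rewrite unlock expectE; last first.
  exact: (integ_objective F_C2 K_convex K_0 T_ge1 run K_sub F_ge0 xstar_max).
rewrite lee_fin.
exact: (expected_objective_ge p_dens p_gt0 F_C2 Ft_C2 logp_C2 Ft_meas logp_meas
  K_convex K_0 Rad_ub grad_unbiased hess_unbiased Gp_ge0 Lp_ge0 Ft_bound gradFt_bound
  gradp_bound hessFt_bound hessp_bound T_ge1 run Xs_ge0 K_sub F_ge0 F_mono F_dr K_xstar xstar_max).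
Qed.
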